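(* Let $n$ be a positive integer divisible by $5$, $7$, $8$ or $12$. Then the subperiods of the $n$-fold tilings enforce planarity.
   Context: **Rhombus tilings.** Fix $m\ge 3$ pairwise non-collinear unit vectors $\vec v_1,\dots,\vec v_m$ of the Euclidean plane (all tilings considered use the same $\vec v_i$'s). They define the prototiles $T_{ij}=\{\lambda\vec v_i+\mu\vec v_j : 0\le\lambda,\mu\le1\}$, $i<j$. A tile is a translated prototile. A rhombus tiling is a covering of $\mathbb{R}^2$ by interior-disjoint tiles which is edge-to-edge: a non-empty intersection of two distinct tiles is either a vertex or an entire edge. **Lift.** Let $\vec e_1,\dots,\vec e_m$ be the canonical basis of $\mathbb{R}^m$. A rhombus tiling is lifted in $\mathbb{R}^m$ by mapping an arbitrary vertex to the origin and each tile $T_{ij}$ to a two-dimensional face of a unit hypercube of $\mathbb{Z}^m$ generated by $\vec e_i,\vec e_j$, tiles adjacent along an edge $\vec v_i$ being mapped to faces adjacent along an edge $\vec e_i$. The lift is unique up to the choice of the initial vertex. **Planarity.** A rhombus tiling is planar if there are $t\ge1$ and an affine ($2$-dimensional) plane $E\subset\mathbb{R}^m$ such that the tiling can be lifted into $E+[0,t]^m$; the smallest such $t$ is the thickness and the corresponding $E$ is the slope. It is strongly planar if the thickness is $1$. **$n$-fold tilings.** Let $m=n$ if $n$ is odd and $m=n/2$ if $n$ is even. A rhombus tiling (with lift in $\mathbb{R}^m$) is $n$-fold if it is strongly planar with a slope parallel to the plane generated by $(\cos(2k\pi/n))_{0\le k\le m-1}$ and $(\sin(2k\pi/n))_{0\le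 k\le m-1}$. **Subperiods.** For $i<j<k$, the $ijk$-shadow of a rhombus tiling is the orthogonal projection of its lift onto the space generated by $\vec e_i,\vec e_j,\vec e_k$. An $ijk$-subperiod is a prime period of the $ijk$-shadow, i.e. a translation vector leaving the shadow invariant that is not a proper multiple of another such vector (hence an integer vector). A tiling has given subperiods if its corresponding shadows are invariant under translation by these vectors. A set of subperiods enforces planarity if all the rhombus tilings having all these subperiods are planar with a uniformly bounded thickness (there is no restriction on the number of slopes).
   Formalization: The edge vectors are arbitrary pairwise non-collinear unit vectors for which at least one n-fold tiling exists; otherwise there are no subperiods and the claim fails. ''The subperiods of the n-fold tilings'' are those of all n-fold tilings with these vectors, taken together. *)

(* Defs.v *)
From HB Require Import structures.
From mathcomp Require Import all_boot all_order all_algebra.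
From mathcomp Require Import all_classical all_reals all_analysis.
Set Implicit Arguments.
Unset Strict Implicit.
Unset Printing Implicit Defensive.
Import Order.TTheory GRing.Theory Num.Theory.
Import numFieldNormedType.Exports.
Local Open Scope classical_set_scope.
Local Open Scope ring_scope.

Section RhombusTilings.
Context {R : realType} {m : nat}.
Implicit Types (v : 'I_m -> 'rV[R]_2) (x : 'rV[R]_2) (L : 'rV[R]_2 -> 'rV[R]_m).

Definition edge_vectors v : Prop :=
  (forall i, v i 0 0 ^+ 2 + v i 0 1 ^+ 2 = 1) /\
  (forall i j, i != j -> row_free (col_mx (v i) (v j))).

(* The translate by x of the prototile T_ij is encoded by (x, i, j).  Since the
   edge vectors are pairwise non-collinear and i < j is required in
   [rhombus_tiling], distinct codes denote distinct subsets of the plane. *)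
Definition tile : Type := ('rV[R]_2 * 'I_m * 'I_m)%type.
Implicit Types (tau : tile) (T : set tile).

Definition tile_set v tau : set 'rV[R]_2 :=
  let: (x, i, j) := tau in
  [set y | exists a b : R,
     [/\ 0 <= a <= 1, 0 <= b <= 1 & y = x + (a *: v i + b *: v j)]].

Definition tile_vertex v tau : set 'rV[R]_2 :=
  let: (x, i, j) := tau in
  [set y | exists a b : bool, y = x + (a%:R *: v i + b%:R *: v j)].

Definition segment x (w : 'rV[R]_2) : set 'rV[R]_2 :=
  [set y | exists2 a : R, 0 <= a <= 1 & y = x + a *: w].

Definition tile_edge v tau : set (set 'rV[R]_2) :=
  let: (x, i, j) := tau in
  [set A | exists b : bool,
     A = segment (x + b%:R *: v j) (v i) \/ A = segment (x + b%:R *: v i) (v j)].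

Definition rhombus_tiling v T : Prop :=
  [/\ forall x i j, T (x, i, j) -> (i < j)%N,
      forall y, exists2 tau, T tau & tile_set v tau y,
      forall tau tau', T tau -> T tau' -> tau <> tau' ->
        interior (tile_set v tau) `&` interior (tile_set v tau') = set0
    & forall tau tau', T tau -> T tau' -> tau <> tau' ->
        let A := tile_set v tau `&` tile_set v tau' in
        A !=set0 ->
        (exists y, [/\ tile_vertex v tau y, tile_vertex v tau' y & A = [set y]])
        \/ (tile_edge v tau A /\ tile_edge v tau' A)].

Definition vertex v T : set 'rV[R]_2 :=
  [set y | exists2 tau, T tau & tile_vertex v tau y].

Definition e_ (i : 'I_m) : 'rV[R]_m := delta_mx 0 i.

(* A lift is given by its values on the vertices of the tiling (its values
   elsewhere are irrelevant); tiles sharing an edge then automatically lift to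
   faces sharing the corresponding edge. *)
Definition is_lift v T L : Prop :=
  (exists2 x0, vertex v T x0 & L x0 = 0) /\
  (forall x i j, T (x, i, j) -> forall a b : bool,
     L (x + (a%:R *: v i + b%:R *: v j)) = L x + (a%:R *: e_ i + b%:R *: e_ j)).

Definition lifted T L : set 'rV[R]_m :=
  [set z | exists x i j, T (x, i, j) /\ exists a b : R,
     [/\ 0 <= a <= 1, 0 <= b <= 1 & z = L x + (a *: e_ i + b *: e_ j)]].

Record affine_plane := AffinePlane {
  plane_point : 'rV[R]_m;
  plane_dir : {vspace 'rV[R]_m};
  _ : \dim plane_dir = 2 }.

Definition plane_set (E : affine_plane) : set 'rV[R]_m :=
  [set z : 'rV[R]_m | z - plane_point E \in plane_dir E].

(* E + [0, t]^m *)
Definition thicken (E : affine_plane) (t : R) : set 'rV[R]_m :=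
  [set z | exists y c : 'rV[R]_m, [/\ plane_set E y, forall k, 0 <= c 0 k <= t & z = y + c]].

Definition lifts_into v T (E : affine_plane) (t : R) : Prop :=
  exists2 L, is_lift v T L & lifted T L `<=` thicken E t.

Definition planar v T : Prop :=
  exists t E, 1 <= t /\ lifts_into v T E t.

Definition thickness v T : R :=
  inf [set t | 1 <= t /\ exists E, lifts_into v T E t].

Definition is_slope v T (E : affine_plane) : Prop :=
  lifts_into v T E (thickness v T).

Definition strongly_planar v T : Prop :=
  planar v T /\ thickness v T = 1.

Definition shadow_proj (i j k : 'I_m) (z : 'rV[R]_m) : 'rV[R]_m :=
  \row_l (if l \in [:: i; j; k] then z 0 l else 0).

Definition shadow T L (i j k : 'I_m) : set 'rV[R]_m :=
  shadow_proj i j k @` lifted T L.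

Definition period (A : set 'rV[R]_m) (p : 'rV[R]_m) : Prop :=
  [set z + p | z in A] = A.

Definition prime_period (A : set 'rV[R]_m) (p : 'rV[R]_m) : Prop :=
  [/\ p != 0, period A p &
      ~ exists q (c : nat), [/\ period A q, (1 < c)%N & p = q *+ c]].

Definition subperiod v T (i j k : 'I_m) (p : 'rV[R]_m) : Prop :=
  exists2 L, is_lift v T L & prime_period (shadow T L i j k) p.

(* [S i j k] is the set of prescribed ijk-subperiods; only its values at
   i < j < k matter. *)
Definition has_subperiods v T (S : 'I_m -> 'I_m -> 'I_m -> set 'rV[R]_m) : Prop :=
  exists2 L, is_lift v T L &
    forall (i j k : 'I_m) p, (i < j)%N -> (j < k)%N -> S i j k p ->
      period (shadow T L i j k) p.

Definition enforces_planarity v (S : 'I_m -> 'I_m -> 'I_m -> set 'rV[R]_m) : Prop :=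
  exists t0 : R, forall T, rhombus_tiling v T -> has_subperiods v T S ->
    planar v T /\ thickness v T <= t0.

End RhombusTilings.

Section NFold.
Context {R : realType} (n : nat).

Definition nfold_dim : nat := if odd n then n else n./2.

Definition nfold_dir : {vspace 'rV[R]_nfold_dim} :=
  <<[:: \row_k cos (2 * k%:R * pi / n%:R); \row_k sin (2 * k%:R * pi / n%:R)]>>%VS.

Implicit Types (v : 'I_nfold_dim -> 'rV[R]_2).

Definition nfold_tiling v (T : set tile) : Prop :=
  [/\ rhombus_tiling v T, strongly_planar v T &
      exists2 E, is_slope v T E & plane_dir E = nfold_dir].

(* The union over all n-fold tilings.  The slope may be positioned so that
   integer points lie on the boundary of E + [0, 1]^m; some n-fold tilings with
   such a slope have shadows that lack the periods present otherwise. *)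
Definition nfold_subperiods v (i j k : 'I_nfold_dim) : set 'rV[R]_nfold_dim :=
  [set p | exists2 T, nfold_tiling v T & subperiod v T i j k p].

End NFold.

(* Main.v *)
From mathcomp Require Import all_boot all_order all_algebra zify ring lra.
From mathcomp Require Import all_classical all_reals all_analysis.
Require Import Defs.
Set Implicit Arguments.
Unset Strict Implicit.
Unset Printing Implicit Defensive.
Import Order.TTheory GRing.Theory Num.Theory.
Import numFieldNormedType.Exports.
Local Open Scope classical_set_scope.
Local Open Scope ring_scope.

(** For [k] in [nat] let [r_k] be the vector of the angle [2 * k * pi / n]. As [r_(k+m)]
    is [r_k] or its opposite, the directions of the tiles can be indexed cyclically by the
    natural numbers, with signs; let [z_k] be the corresponding signed coordinates of the
    lifted vertices of a tiling. Since [r_(a-d) + r_(a+d)] is a multiple of [r_a], n-fold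
    tilings have the subperiod [e_(a-d) - e_(a+d)] on the directions [a - d], [a], [a + d]
    whenever these are distinct, and the proof uses only these subperiods.

    They are realized on the tiling dual to a multigrid of lines orthogonal to the [r_k]
    with a generic common offset: a translation of the plane can preserve three of the
    families of lines, and it then preserves the corresponding shadow ([grid_tiling],
    [grid_prime_period], [ap_subperiod]). That the dual rhombi with the prescribed edge
    vectors tile the plane requires these vectors to have the same cyclic order as the
    [r_k], which follows from the existence of one n-fold tiling ([slope_orientation]).

    Consider now any rhombus tiling with these subperiods. A period of the shadow allows
    to trade [z_(a-d)] for [z_(a+d)] at constant [z_a] ([period_swing]). On the other hand
    two edges in direction [a] with the same [z_a] are joined by a ribbon of tiles along
    which the coordinates are monotone ([ribbon_forward]). Together, the sum
    [z_(a-d) + z_(a+d)] is determined by [z_a] up to a bounded error at the edges in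
    direction [a], and it is nearly a monotone function of [z_a] at all vertices
    ([swing_edge_sum], [swing_stair]).

    The functions obtained for [d = 1] and [d = 2] are related, because [z_a] and
    [z_(a+1)] take arbitrary pairs of values. Eliminating the other coordinates shows that
    the increments of the functions for [a] and [d = 1, 2] are quasi-periods of the
    functions for [a - 1] and [a + 1]. Hence these have slopes, the same for all directions
    [a] of one parity, and the product of the two slopes is at most 4, since otherwise the
    finitely many absolute values of coordinates could not have a maximum. The direction
    with the smaller slope yields short quasi-periods, so that the functions are affine up
    to an error that is bounded in terms of the slope only ([web_affine]).

    If both slopes are at most 2, the relations between [z_(a-1)], [z_a] and [z_(a+1)]
    express all coordinates as affine functions of two of them, up to a bounded error,
    which is planarity with a uniform thickness. This applies to odd [m], for which the
    two slopes agree. If [m] is even and one slope is larger than 2, the coordinates of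
    the other parity are governed by the relations for [d = 2], whose slope is the product
    of the two slopes minus 2 and again at most 2, and the remaining coordinates are found
    by dividing the relations for [d = 1] by the large slope ([swings_planar]). *)

(** * Quasi-periods of nearly monotone integer functions *)

(** [qp D E] says that shifting the argument of [f] by [D] shifts its value by at
    most [E], up to the error [c] on both sides; since [qp] is symmetric, the shift is
    bounded from below as well. *)
Section QuasiPeriods.
Variables (R : realType) (f : int -> int) (qp : int -> int -> Prop) (c : int).
Hypothesis c_gt0 : 0 < c.
Hypothesis qp_opp : forall D E, qp D E -> qp (- D) (- E).
Hypothesis qp_unbounded : forall B : int, exists D E, qp D E /\ B <= D.
Hypothesis qpP : forall D E y : int, qp D E -> f (y + D - c) <= f y + E + c.
Hypothesis f_mono : forall y y' : int, y <= y' -> f y <= f y' + c.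

Lemma quasi_period_iter D E (y : int) (k : nat) : qp D E ->
  f (y + k%:Z * (D - c)) <= f y + k%:Z * (E + c).
Proof.
move=> DE; elim: k => [|k IH]; first by rewrite !mul0r !addr0.
have := qpP (y + k%:Z * (D - c)) DE.
rewrite -addn1 PoszD !mulrDl !mul1r !addrA => h.
by apply: (le_trans h); rewrite !lerD2r.
Qed.

(** Two quasi-periods have nearly the same slope: iterating one of them [D' - c] times
    backwards and the other one [D + c] times forwards returns to the same argument. *)
Lemma quasi_slopes_le D E D' E' : qp D E -> qp D' E' ->
  0 < D + c -> 0 < D' - c -> (E - c) * (D' - c) <= (E' + c) * (D + c).
Proof.
move=> DE DE' h h'.
have up := quasi_period_iter 0 (absz (D + c)) DE'.
have lo := quasi_period_iter ((D + c) * (D' - c)) (absz (D' - c)) (qp_opp DE).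
move: up lo; rewrite !gez0_abs ?(ltW h) ?(ltW h')//.
have -> : (D + c) * (D' - c) + (D' - c) * (- D - c) = 0 by ring.
rewrite add0r => up lo.
move: up lo; set a := f 0; set b := f _ => up lo; lia.
Qed.

Lemma quasi_period_ge D E : qp D E -> c <= D -> - (2 * c) <= E.
Proof.
move=> DE D0; have := qpP 0 DE; rewrite add0r.
have : f 0 <= f (D - c) + c by apply: f_mono; lia.
lia.
Qed.

(** By [quasi_slopes_le] the slopes [(E - c) / (D + c)] are bounded above by the slopes
    [(E' + c) / (D' - c)], so that the supremum of the former separates both families. *)
Lemma quasi_slope_exists : exists2 al : R, 0 <= al &
  forall D E, qp D E -> `|E%:~R - al * D%:~R| <= c%:~R * (1 + al).
Proof.
pose S : set R := fun r => exists D E, [/\ qp D E, 0 < D + c &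
  r = (E - c)%:~R / (D + c)%:~R].
have cR : (0 : R) < c%:~R by rewrite ltr0z.
have ubS D' E' : qp D' E' -> 0 < D' - c ->
    ubound S ((E' + c)%:~R / (D' - c)%:~R).
  move=> DE' h' r [D [E [DE h ->]]].
  rewrite ler_pdivrMr ?ltr0z// mulrAC ler_pdivlMr ?ltr0z//.
  by rewrite -!intrM ler_int quasi_slopes_le.
have [D0 [E0 [DE0 D0c]]] := qp_unbounded (c + 1).
have supS : has_sup S.
  split; first by exists ((E0 - c)%:~R / (D0 + c)%:~R), D0, E0; split => //; lia.
  by exists ((E0 + c)%:~R / (D0 - c)%:~R); apply: ubS => //; lia.
have lo D E : qp D E -> 0 < D + c -> (E - c)%:~R <= sup S * (D + c)%:~R.
  move=> DE h; rewrite -ler_pdivrMr ?ltr0z//; apply: sup_upper_bound => //.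
  by exists D, E.
have up D E : qp D E -> 0 < D - c -> sup S * (D - c)%:~R <= (E + c)%:~R.
  move=> DE h; rewrite -ler_pdivlMr ?ltr0z//; apply: ge_sup; first by case: supS.
  exact: ubS.
have al0 : 0 <= sup S.
  rewrite leNgt; apply/negP => al0.
  have [D [E [DE hD]]] := qp_unbounded (c + (Num.ceil (3 * c%:~R / - sup S)) + 1).
  have aS : 0 < - sup S by lra.
  have ce : 3 * c%:~R <= (Num.ceil (3 * c%:~R / - sup S))%:~R * - sup S.
    by rewrite -ler_pdivrMr// ceil_ge.
  have ce0 : 0 <= Num.ceil (3 * c%:~R / - sup S).
    by rewrite -(ler_int R) (le_trans _ (ceil_ge _))// divr_ge0 ?ltW//; lra.
  have E2 : - (2 * c) <= E by apply: (quasi_period_ge DE); lia.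
  have := lo _ _ DE ltac:(lia).
  move: E2 hD; rewrite -!(ler_int R) => E2 hD.
  move: E2 hD ce; set q := Num.ceil _.
  rewrite !(intrD, intrM, mulrNz) => E2 hD ce h.
  have : - sup S * (c%:~R + q%:~R + 1%:~R) <= - sup S * D%:~R by rewrite ler_pM2l.
  have : 0 < - sup S * c%:~R by rewrite mulr_gt0.
  nra.
exists (sup S) => // D E DE.
rewrite ler_norml; apply/andP; split; last first.
  have [h|h] := ltP 0 (D + c).
    by have := lo _ _ DE h; rewrite !(intrD, mulrNz); nra.
  have [h'|h'] := ltP 0 (- D - c).
    have := up _ _ (qp_opp DE) h'; rewrite !(intrD, mulrNz); nra.
  have e : D = - c by lia.
  have := qpP 0 (qp_opp DE); rewrite {1}e opprK addrK => h2.
  have : E%:~R <= c%:~R :> R by rewrite ler_int; lia.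
  rewrite e mulrNz; nra.
have [h|h] := ltP 0 (- D + c).
  by have := lo _ _ (qp_opp DE) h; rewrite !(intrD, mulrNz); nra.
have [h'|h'] := ltP 0 (D - c).
  have := up _ _ DE h'; rewrite !(intrD, mulrNz); nra.
have e : D = c by lia.
have := qpP 0 DE; rewrite {1}e addrK => h2.
have : (- E)%:~R <= c%:~R :> R by rewrite ler_int; lia.
rewrite e mulrNz; nra.
Qed.

(** A family of quasi-periods whose lengths [g y] leave no gap larger than [J] makes [f]
    affine: any shift of the argument is a quasi-period up to an error [J]. *)
Lemma quasi_affine_le (al J : R) (g h : int -> int) : 0 <= al ->
  (forall D E, qp D E -> `|E%:~R - al * D%:~R| <= c%:~R * (1 + al)) ->
  (forall y, qp (g y) (h y)) ->
  (forall y y', y <= y' -> g y <= g y' + c) ->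
  (forall B, (exists y, B <= g y) /\ (exists y, g y <= B)) ->
  (forall y, (g (y + 1))%:~R <= (g y)%:~R + J) ->
  forall u n : int, `|(f (u + n))%:~R - (f u)%:~R - al * n%:~R| <=
    al * (c%:~R + J) + c%:~R * (1 + al) + 2 * c%:~R.
Proof.
move=> al0 slope qpg g_mono g_unb gJ.
have hit t : exists y, t <= g y /\ (g y)%:~R <= t%:~R + J.
  have [[y1 hy1] _] := g_unb t.
  have [_ [y0 hy0]] := g_unb (t - c - 1).
  have y01 : y0 <= y1.
    by rewrite leNgt; apply/negP => /ltW/g_mono; lia.
  have ex : exists k : nat, t <= g (y0 + k%:Z).
    by exists (absz (y1 - y0)); rewrite gez0_abs ?subr_ge0// subrKC.
  case: (ex_minnP ex) => -[|k] kP kmin; first by rewrite addr0 in kP; lia.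
  exists (y0 + k.+1%:Z); split => //.
  have lt_k : g (y0 + k%:Z) < t.
    by rewrite ltNge; apply/negP => /kmin; rewrite ltnn.
  have := gJ (y0 + k%:Z); rewrite -addrA -PoszD addn1 => /le_trans; apply.
  by rewrite lerD2r ler_int ltW.
have half u n : (f (u + n))%:~R - (f u)%:~R - al * n%:~R <=
    al * (c%:~R + J) + c%:~R * (1 + al) + 2 * c%:~R.
  have [y [ty tJ]] := hit (n + c).
  have : f (u + n) <= f (u + g y - c) + c by apply: f_mono; lia.
  have := qpP u (qpg y); set b := f (_ - _) => h1 h2.
  have : f (u + n) <= f u + h y + 2 * c by lia.
  have := slope _ _ (qpg y); rewrite -(ler_int R) ler_norml => /andP[_ h3].
  rewrite !(intrD, intrM); move: tJ; rewrite intrD => tJ h4.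
  have : al * (g y)%:~R <= al * (n%:~R + c%:~R + J) by rewrite ler_wpM2l.
  by rewrite !mulrDr; lra.
move=> u n; rewrite ler_norml half andbT.
have := half (u + n) (- n); rewrite addrK mulrNz; lra.
Qed.
End QuasiPeriods.

(** * Webs of integer functions *)

(** A web abstracts the coordinates [z k p] of the vertices [p] of a tiling in successive
    directions, of which any two consecutive ones can be prescribed independently.
    The sum of the two neighbours of [z k.+1] is, up to [K], a function [sg k.+1] of
    [z k.+1] that is monotone in the staircase sense, and the sum of the neighbours at
    distance two of [z k.+2] is the function [th k.+2] of [z k.+2] at well-chosen vertices.
    The function [th] is either nearly decreasing, or nearly increasing; in the latter case
    a coordinate of largest absolute value must exist among boundedly many ones. *)
Definition web (K : int) (P : Type) (z : nat -> P -> int)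
    (sg th : nat -> int -> int) : Prop :=
  [/\ forall k (x u : int), exists p, [/\ z k.+1 p = x, z k.+2 p = u,
        `|z k.+1 p + z k.+3 p - sg k.+2 u| <= K,
        `|z k p + z k.+2 p - sg k.+1 x| <= K
        & `|z k p + z k.+4 p - th k.+2 u| <= K],
      forall k p u,
        (z k.+1 p <= u -> z k p + z k.+2 p <= sg k.+1 u + K) /\
        (u < z k.+1 p -> sg k.+1 u - K <= z k p + z k.+2 p),
      forall k B, (exists p, B <= z k p + z k.+2 p) /\
                  (exists p, z k p + z k.+2 p <= B)
    & (forall k u u', u <= u' -> th k.+2 u' <= th k.+2 u + K) \/
      ((forall k p u,
          (z k.+2 p <= u -> z k p + z k.+4 p <= th k.+2 u + K) /\
          (u < z k.+2 p -> th k.+2 u - K <= z k p + z k.+4 p)) /\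
       exists N, forall p, exists2 a, (a < N)%N &
          forall k, `|z k p| <= `|z a.+2 p|)].

Section Web.
Variables (R : realType) (K : int) (P : Type) (z : nat -> P -> int).
Variables (sg th : nat -> int -> int).
Hypotheses (K_gt0 : 0 < K) (webP : web K z sg th).

Variables (c jump : int).
Hypotheses (cE : c = 8 * K + 1) (jumpE : jump = 60 * (K + c)).

Let eta k u := th k.+2 u + 2 * u.

Let c_gt0 : 0 < c. Proof. by rewrite cE; lia. Qed.

Lemma web_tile k (x u : int) : exists p, [/\ z k.+1 p = x, z k.+2 p = u,
        `|z k.+1 p + z k.+3 p - sg k.+2 u| <= K,
        `|z k p + z k.+2 p - sg k.+1 x| <= K
        & `|z k p + z k.+4 p - th k.+2 u| <= K].
Proof. by case: webP => + _ _ _; apply. Qed.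

Lemma web_stair k p u :
        (z k.+1 p <= u -> z k p + z k.+2 p <= sg k.+1 u + K) /\
        (u < z k.+1 p -> sg k.+1 u - K <= z k p + z k.+2 p).
Proof. by case: webP => _ + _ _; apply. Qed.

Lemma web_mono b u u' : u <= u' -> sg b.+1 u <= sg b.+1 u' + 2 * K.
Proof.
move=> uu'; have [p [zu _ _ h _]] := web_tile b u 0.
have [+ _] := web_stair b p u'; rewrite zu => /(_ uu'); lia.
Qed.

Lemma web_mono_c b u u' : u <= u' -> sg b.+1 u <= sg b.+1 u' + c.
Proof. by move=> /(@web_mono b); lia. Qed.

Lemma web_unbounded b B :
  (exists u, B <= sg b.+1 u) /\ (exists u, sg b.+1 u <= B).
Proof.
case: webP => _ _ unb _; split.
  have [[p hp] _] := unb b (B + K); have [h _] := web_stair b p (z b.+1 p).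
  by exists (z b.+1 p); have := h (lexx _); lia.
have [_ [p hp]] := unb b (B - K).
have [_ h] := web_stair b p (z b.+1 p - 1).
by exists (z b.+1 p - 1); have := h ltac:(lia); lia.
Qed.

(** The vertex of the web with coordinates [x] and [u] has its next coordinate near
    [sg k.+2 u - x] and its previous one near [sg k.+1 x - u], and [th] gives the sum of
    the outer two coordinates. This expresses [sg k.+3] at [sg k.+2 u - x] through
    [sg k.+1] at [x]; comparing two values of [u] yields quasi-periods of both. *)
Lemma web_interlace k (x u : int) :
  eta k u - sg k.+1 x <= sg k.+3 (sg k.+2 u - x + K) + 3 * K /\
  sg k.+3 (sg k.+2 u - x - K - 1) <= eta k u - sg k.+1 x + 3 * K.
Proof.
have [p [zx zu h1 h2 h3]] := web_tile k x u; rewrite /eta.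
have [hu _] := web_stair k.+2 p (sg k.+2 u - x + K).
have [_ hl] := web_stair k.+2 p (sg k.+2 u - x - K - 1).
have := hu ltac:(lia); have := hl ltac:(lia).
move: (sg k.+3 _) => A; move: (sg k.+3 _) => B.
rewrite zu zx in h1 h2 *; lia.
Qed.

Definition web_pair b (D E : int) := exists k u u', [/\ b = k.+1 \/ b = k.+3,
  D = sg k.+2 u - sg k.+2 u' & E = eta k u - eta k u'].

Lemma web_pairE k u u' : web_pair k.+1 (sg k.+2 u - sg k.+2 u') (eta k u - eta k u') /\
  web_pair k.+3 (sg k.+2 u - sg k.+2 u') (eta k u - eta k u').
Proof. by split; exists k, u, u'; split => //; [left|right]. Qed.

Lemma web_pair_opp b D E : web_pair b D E -> web_pair b (- D) (- E).
Proof. by move=> [k [u [u' [h -> ->]]]]; exists k, u', u; split; rewrite ?opprB. Qed.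

Lemma web_pair_unbounded b B : exists D E, web_pair b.+1 D E /\ B <= D.
Proof.
have [_ [u' hu']] := web_unbounded b.+1 0.
have [[u hu] _] := web_unbounded b.+1 B.
have [h _] := web_pairE b u u'.
exists (sg b.+2 u - sg b.+2 u'), (eta b u - eta b u'); split => //; lia.
Qed.

Lemma web_quasi_period b D E y :
  web_pair b.+1 D E -> sg b.+1 (y + D - c) <= sg b.+1 y + E + c.
Proof.
have weak A B : sg b.+1 (y + A - 2 * K - 1) <= sg b.+1 y + B + 6 * K ->
    sg b.+1 (y + A - c) <= sg b.+1 y + B + c.
  move=> h; apply: le_trans (@web_mono b _ (y + A - 2 * K - 1) _) _.
    by lia.
  by lia.
move=> h; case: h weak => k [u [u' [[->|->] -> ->]]] weak; apply: weak.
  have [_] := web_interlace k (y + (sg k.+2 u - sg k.+2 u') - 2 * K - 1) u.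
  have [+ _] := web_interlace k y u'.
  have -> : sg k.+2 u - (y + (sg k.+2 u - sg k.+2 u') - 2 * K - 1) - K - 1 =
    sg k.+2 u' - y + K by lia.
  by move: (sg k.+3 _) (sg k.+1 (_ - 1)) => A B; lia.
have [_] := web_interlace k (sg k.+2 u' + K - y) u.
have [+ _] := web_interlace k (sg k.+2 u' + K - y) u'.
have -> : sg k.+2 u' - (sg k.+2 u' + K - y) + K = y by lia.
have -> : sg k.+2 u - (sg k.+2 u' + K - y) - K - 1 =
  y + (sg k.+2 u - sg k.+2 u') - 2 * K - 1 by lia.
by move: (sg k.+3 (_ - 1)) (sg k.+1 _) => A B; lia.
Qed.

Definition web_slope (al : nat -> R) := (forall b, 0 <= al b.+1) /\
  forall b D E, web_pair b.+1 D E -> `|E%:~R - al b.+1 * D%:~R| <= c%:~R * (1 + al b.+1).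

Lemma web_slope_exists : exists al, web_slope al.
Proof.
have ex b : exists al : R, 0 <= al /\
    forall D E, web_pair b.+1 D E -> `|E%:~R - al * D%:~R| <= c%:~R * (1 + al).
  have [al al0 h] := @quasi_slope_exists R (sg b.+1) (web_pair b.+1) c c_gt0
    (@web_pair_opp b.+1) (@web_pair_unbounded b) (@web_quasi_period b)
    (@web_mono_c b).
  by exists al.
have [al h] := choice ex; exists (fun b => al b.-1).
by split=> b; [exact: (h b).1|exact: (h b).2].
Qed.

Variables (al : nat -> R).
Hypothesis alP : web_slope al.
Let al_ge0 b : 0 <= al b.+1. Proof. exact: alP.1. Qed.

Let cR : (0 : R) < c%:~R. Proof. by rewrite ltr0z. Qed.

Lemma web_pair_large b (B : R) : exists D E, web_pair b.+1 D E /\ B <= D%:~R.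
Proof.
have [D [E [h hD]]] := web_pair_unbounded b (Num.ceil B).
exists D, E; split => //; apply: le_trans (ceil_ge _) _.
by rewrite ler_int.
Qed.

(** Both [sg b.+1] and [sg b.+3] have the pairs [web_pair] coming from [sg b.+2] as
    quasi-periods, and these pairs are unbounded. *)
Lemma web_slope_alt b : al b.+3 = al b.+1.
Proof.
pose d := `|al b.+3 - al b.+1|.
have [d0|d0] := ltP 0 d; last first.
  by apply/eqP; rewrite -subr_eq0 -normr_eq0 eq_le d0 normr_ge0.
pose B := c%:~R * (2 + al b.+1 + al b.+3).
have B0 : 0 <= B by rewrite /B mulr_ge0 ?(ltW cR)//; have := al_ge0 b; have := al_ge0 b.+2; lra.
have [_ [u' hu']] := web_unbounded b.+1 0.
have [[u hu] _] := web_unbounded b.+1 (Num.ceil ((B + 1) / d)).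
have [h1 h3] := web_pairE b u u'.
have {}h1 := alP.2 _ _ _ h1; have {}h3 := alP.2 _ _ _ h3.
set D := sg _ u - _ in h1 h3; set E := eta _ _ - _ in h1 h3.
have hD : (B + 1) / d <= D%:~R.
  by apply: le_trans (ceil_ge _) _; rewrite ler_int -[leLHS]subr0 lerB.
have D0 : 0 <= D%:~R :> R.
  by apply: le_trans hD; rewrite divr_ge0 ?ltW//; lra.
have : d * D%:~R <= B.
  have -> : d * D%:~R = `|(al b.+3 - al b.+1) * D%:~R|.
    by rewrite normrM (ger0_norm D0).
  move: h1 h3; rewrite !ler_norml /B => /andP[a1 a2] /andP[a3 a4].
  by apply/andP; split; lra.
by rewrite ler_pdivrMr// in hD; lra.
Qed.

(** A quasi-period makes [sg] grow in both directions at the rate [(E - c) / (D + c)]. *)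
Lemma web_growth b D E : web_pair b.+1 D E -> 0 < D + c ->
  exists2 B : int, 0 <= B & forall u, 0 <= u ->
    (E - c) * u <= (D + c) * (sg b.+1 u - sg b.+1 0) + B /\
    (E - c) * u <= (D + c) * (sg b.+1 0 - sg b.+1 (- u)) + B.
Proof.
move=> DE M0; set M := D + c.
exists (M * (c + `|E - c|)); first by apply: mulr_ge0; [exact: ltW|move: c_gt0; lia].
move=> u u0.
have it y k := @quasi_period_iter (sg b.+1) (web_pair b.+1) c
  (@web_quasi_period b) _ _ y k (web_pair_opp DE).
pose n := (u %/ M)%Z; pose r := (u %% M)%Z.
have ue : u = n * M + r by exact: divz_eq.
have r0 : 0 <= r by apply: modz_ge0; lia.
have rM : r < M by rewrite -[ltRHS]gtz0_abs// ltz_mod//; lia.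
have n0 : 0 <= n by rewrite divz_ge0.
have rE : (E - c) * r <= M * `|E - c| by nia.
have i1 := it (n * M) (absz n); have i2 := it 0 (absz n).
rewrite gez0_abs// in i1 i2.
have e1 : n * M + n * (- D - c) = 0 by rewrite /M; lia.
rewrite e1 in i1.
have e2 : 0 + n * (- D - c) = - (n * M) by rewrite /M; lia.
rewrite e2 in i2.
have j1 : sg b.+1 (n * M) <= sg b.+1 u + c by apply: web_mono_c; lia.
have j2 : sg b.+1 (- u) <= sg b.+1 (- (n * M)) + c by apply: web_mono_c; lia.
have e3 : (E - c) * u = M * (n * (E - c)) + (E - c) * r by rewrite ue; ring.
have fin A : n * (E - c) <= A + c ->
    M * (n * (E - c)) + (E - c) * r <= M * A + M * (c + `|E - c|).
  move=> /(ler_wpM2l (ltW M0)); rewrite [M * (A + c)]mulrDr => h.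
  by rewrite [M * (c + _)]mulrDr addrA; apply: lerD.
have e4 : n * (- E + c) = - (n * (E - c)) by ring.
rewrite e3; split.
  apply: fin; move: i1 j1; rewrite e4; move: (n * (E - c)) => W.
  by move: (sg _ 0) (sg _ (n * M)) (sg _ u) => s0 s1 s2; lia.
apply: fin; move: i2 j2; rewrite e4; move: (n * (E - c)) => W.
by move: (sg _ 0) (sg _ (- (n * M))) (sg _ (- u)) => s0 s1 s2; lia.
Qed.

(** If the product of the two alternating slopes exceeds 4, then [th u] exceeds [2 * u]
    by an arbitrary constant for large [u], and symmetrically for small [u]. *)
Lemma web_steep k (C0 : int) : 4 < al k.+2 * al k.+3 ->
  exists2 B : int, 0 <= B & forall u, B <= u ->
    2 * u + C0 < th k.+2 u /\ th k.+2 (- u) < - (2 * u) - C0.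
Proof.
set a := al k.+2; set be := al k.+3 => ab4.
have a0 : 0 <= a by exact: al_ge0.
have b0 : 0 <= be by exact: al_ge0.
have [D [E [DE hD]]] := web_pair_large k.+1
  ((c%:~R * (be * (2 + a) + 4) + 1) / (be * a - 4)).
have gap : 4 * (D%:~R + c%:~R) + 1 <= be * (E%:~R - c%:~R).
  rewrite ler_pdivrMr in hD; last by lra.
  have := alP.2 _ _ _ DE; rewrite ler_norml -/a => /andP[h _].
  have : be * (a * D%:~R - c%:~R * (1 + a)) <= be * E%:~R.
    by rewrite ler_wpM2l//; lra.
  lra.
have Dc0 : 0 < D + c.
  rewrite -(ltr_int R) intrD; apply: ltr_wpDl => //.
  apply: le_trans hD; rewrite divr_ge0 ?subr_ge0 ?addr_ge0 ?mulr_ge0 ?ltW//; nra.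
have [B B0 hB] := web_growth DE Dc0.
pose X : R := (D + c)%:~R * (`|th k.+2 0|%:~R + C0%:~R + c%:~R * (1 + be)) + be * B%:~R.
exists `|Num.ceil X + 1| => // u hu.
have u0 : 0 <= u by apply: le_trans hu.
have Xu : X < u%:~R.
  have : X <= (Num.ceil X)%:~R by exact: ceil_ge.
  have : Num.ceil X < u by lia.
  by rewrite -(ltr_int R) => h1 h2; exact: le_lt_trans h1.
have DcR : (0 : R) < (D + c)%:~R by rewrite ltr0z.
have core (d e t : int) : (E - c) * u <= (D + c) * d + B ->
    web_pair k.+3 d e -> e <= t + `|th k.+2 0| + 2 * u -> 2 * u + C0 < t.
  move=> h1 h2 h3; rewrite ltNge; apply/negP => h4.
  have := alP.2 _ _ _ h2; rewrite -/be ler_norml => /andP[h5 _].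
  have {}h1 : (E - c)%:~R * u%:~R <= (D + c)%:~R * d%:~R + B%:~R :> R.
    by rewrite -!intrM -intrD ler_int.
  have h6 : be * ((E - c)%:~R * u%:~R) <= be * ((D + c)%:~R * d%:~R + B%:~R).
    by rewrite ler_wpM2l.
  have h7 : e%:~R <= 4 * u%:~R + C0%:~R + `|th k.+2 0|%:~R :> R.
    have : e <= 4 * u + C0 + `|th k.+2 0| by move: h3 h4; clear; lia.
    by rewrite -(ler_int R) !intrD intrM.
  have h8 : (D + c)%:~R * (be * d%:~R) <=
      (D + c)%:~R * (4 * u%:~R + C0%:~R + `|th k.+2 0|%:~R + c%:~R * (1 + be)).
    by rewrite ler_pM2l//; lra.
  have h9 : (4 * (D%:~R + c%:~R) + 1) * u%:~R <= be * (E%:~R - c%:~R) * u%:~R.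
    by rewrite ler_wpM2r// ler0z.
  move: h6 h8 Xu; rewrite /X !mulrDr !(intrD, mulrNz); lra.
have [g1 g2] := hB u u0; split.
  apply: core g1 (web_pairE k u 0).2 _; rewrite /eta; lia.
have : 2 * u + C0 < - th k.+2 (- u).
  apply: core g2 (web_pairE k 0 (- u)).2 _; rewrite /eta; lia.
lia.
Qed.

Lemma web_slope_prodE i : al i.+2 * al i.+3 = al 2%N * al 3%N.
Proof. by elim: i => // i <-; rewrite (web_slope_alt i.+1) mulrC. Qed.

(** A steep web contradicts the last clause of [web]: a nearly decreasing [th] cannot
    grow, while if [th u] exceeds [2 * u], then of the coordinates at distance two from the
    one of largest absolute value, one is still larger in absolute value. *)
Lemma web_slope_prod k : al k.+1 * al k.+2 <= 4.
Proof.
suff h : al 2%N * al 3%N <= 4 by rewrite -(web_slope_alt k) mulrC web_slope_prodE.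
rewrite leNgt; apply/negP => steep.
have steepN i : 4 < al i.+2 * al i.+3 by rewrite web_slope_prodE.
case: webP => _ _ unb [dec|[stair [N hN]]].
  have [B B0 hB] := @web_steep 0 (`|th 2%N 0| + K) steep.
  have := (hB B (lexx _)).1; have := dec 0%N 0 B B0; lia.
have [B hB] : exists B : int, 0 <= B /\ forall a, (a < N)%N -> forall u, B <= u ->
    2 * u + (K + 2) < th a.+2 u /\ th a.+2 (- u) < - (2 * u) - (K + 2).
  elim: (N) => [|n [B [B0 IH]]]; first by exists 0.
  have [B' B'0 hB'] := @web_steep n (K + 2) (steepN n).
  exists (B + B'); split=> [|a]; first lia.
  rewrite ltnS leq_eqVlt => /orP[/eqP ->|an] u hu; first by apply: hB'; lia.
  by apply: IH => //; lia.
have [[p hp] _] := unb 0%N (2 * B + 4).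
have [a aN hmax] := hN p.
have h0 := hmax 0%N; have h2 := hmax 2%N; have l := hmax a; have r := hmax a.+4.
have [B0 {}hB] := hB; have [st1 _] := stair a p (z a.+2 p).
have [_ st2] := stair a p (z a.+2 p - 1).
have [z0|z0] := lerP 0 (z a.+2 p).
  have := st2 ltac:(lia).
  have := (hB a aN (z a.+2 p - 1) ltac:(lia)).1; lia.
have := st1 (lexx _); have := (hB a aN (- z a.+2 p) ltac:(lia)).2.
rewrite opprK; lia.
Qed.

(** On the side of the smaller slope, which is at most 2, a quasi-period of bounded length
    exists: one whose first component is at least [2 * c] and whose second component is
    bounded. For decreasing [th] the first argument at which [sg] has climbed enough will
    do; for increasing [th] the average growth over long intervals bounds some increment. *)
Lemma web_short_pair k : al k.+3 <= al k.+2 -> exists u u',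
  2 * c <= sg k.+2 u - sg k.+2 u' /\ eta k u - eta k u' <= jump.
Proof.
set be := al k.+3; set a := al k.+2 => ba.
have b0 : 0 <= be by exact: al_ge0.
have a0 : 0 <= a by exact: al_ge0.
have ab4 : a * be <= 4 by exact: web_slope_prod.
have b2 : be <= 2 by nra.
have cb : 0 <= c%:~R * (2 - be) by rewrite mulr_ge0 ?(ltW cR)// subr_ge0.
have slope u u' : (eta k u - eta k u')%:~R <=
    be * (sg k.+2 u - sg k.+2 u')%:~R + 3 * c%:~R.
  have [_ h] := web_pairE k u u'.
  have := alP.2 _ _ _ h; rewrite -/be ler_norml => /andP[_]; move: cb; lra.
have short u u' : sg k.+2 u - sg k.+2 u' < 2 * c -> eta k u - eta k u' <= 7 * c.
  move=> h; rewrite -(ler_int R); apply: le_trans (slope u u') _.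
  have : (sg k.+2 u - sg k.+2 u')%:~R <= 2 * c%:~R :> R.
    by rewrite -[2]/(2%:~R) -intrM ler_int ltW.
  rewrite intrM; nra.
case: webP => _ _ _ [dec|[stair _]].
  have [[v hv] _] := web_unbounded k.+1 (sg k.+2 0 + 4 * c).
  have ex : exists n : nat, 2 * c <= sg k.+2 n%:Z - sg k.+2 0.
    have [v0|v0] := lerP 0 v; first by exists (absz v); rewrite gez0_abs//; lia.
    have := @web_mono_c k.+1 v 0 (ltW v0); lia.
  case: (ex_minnP ex) => -[|n] hn nmin; first by rewrite subrr in hn; lia.
  exists n.+1%:Z, 0; split => //.
  have lt_n : sg k.+2 n%:Z - sg k.+2 0 < 2 * c.
    by rewrite ltNge; apply/negP => /nmin; rewrite ltnn.
  have := short _ _ lt_n; have := dec k n%:Z n.+1%:Z ltac:(lia).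
  by rewrite /eta jumpE; lia.
have [L LE] : exists L, L = 7 * c + K + 1 by eexists.
have th_mono u u' : u <= u' -> th k.+2 u <= th k.+2 u' + 2 * K.
  move=> uu'; have [p [_ zu _ _ h]] := web_tile k 0 u.
  have [+ _] := stair k p u'; rewrite zu => /(_ uu'); lia.
have long u : 2 * c <= sg k.+2 (u + L) - sg k.+2 u.
  rewrite leNgt; apply/negP => /short.
  have := th_mono u (u + L) ltac:(lia); rewrite /eta; lia.
have [u hu] : exists u, be * (sg k.+2 (u + L) - sg k.+2 u)%:~R <= (4 * L + 1)%:~R.
  apply/not_existsP => h.
  have sum (n : nat) : n%:R * (4 * L + 1)%:~R <= be * (sg k.+2 (n%:Z * L) - sg k.+2 0)%:~R.
    elim: n => [|n IH]; first by rewrite !mul0r subrr mulr0.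
    have /negP := h (n%:Z * L); rewrite -ltNge => hn.
    rewrite -addn1 PoszD natrD !mulrDl !mul1r.
    move: hn IH; rewrite !(intrD, mulrNz) => hn IH; lra.
  have [D [E [DE hD]]] := web_pair_large k.+1
    (c%:~R * (4 * L + 1)%:~R + be * L%:~R * c%:~R * (2 + a) + c%:~R + 1).
  have LR : (0 : R) <= L%:~R by rewrite ler0z; lia.
  have M0 : 0 < D - c.
    rewrite -(ltr_int R) intrD mulrNz subr_gt0; apply: lt_le_trans hD.
    have : 0 <= be * L%:~R * c%:~R * (2 + a) by rewrite !mulr_ge0 ?(ltW cR)// addr_ge0.
    have : 0 <= c%:~R * (4 * L + 1)%:~R :> R.
      by rewrite mulr_ge0 ?ltW// ltr0z; lia.
    lra.
  have := @quasi_period_iter (sg k.+2) (web_pair k.+2) c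
    (@web_quasi_period k.+1) _ _ 0 (absz L) DE.
  have L0 : 0 <= L by move: LE c_gt0 K_gt0; clear; lia.
  rewrite (gez0_abs L0) add0r => it.
  have := sum (absz (D - c)); rewrite natr_absz (gtr0_norm M0) (gez0_abs (ltW M0)).
  rewrite [(D - c) * L]mulrC => h1.
  have := alP.2 _ _ _ DE; rewrite -/a ler_norml => /andP[_ h2].
  have h3 : (sg k.+2 (L * (D - c)) - sg k.+2 0)%:~R <= L%:~R * (E%:~R + c%:~R) :> R.
    by rewrite -intrD -intrM ler_int; move: it; clear; lia.
  have h4 : be * (sg k.+2 (L * (D - c)) - sg k.+2 0)%:~R <=
      be * (L%:~R * (a * D%:~R + c%:~R * (1 + a) + c%:~R)).
    rewrite ler_wpM2l//; apply: le_trans h3 _; rewrite ler_wpM2l//; lra.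
  have h5 : a * be * (L%:~R * D%:~R) <= 4 * (L%:~R * D%:~R).
    rewrite ler_wpM2r// mulr_ge0//.
    by rewrite ler0z; move: M0 c_gt0; clear; lia.
  move: cR h1 h4 hD h5; rewrite !(intrD, intrM, mulrNz); lra.
exists (u + L), u; split; first exact: long.
rewrite -(ler_int R); apply: le_trans (slope _ _) _.
have : (4 * L + 1)%:~R + 3 * c%:~R <= jump%:~R :> R.
  by rewrite -[3]/(3%:~R) -intrM -intrD ler_int jumpE; lia.
lra.
Qed.

(** Being monotone, a function with a short quasi-period has bounded jumps. *)
Lemma web_jump_le k u : al k.+3 <= al k.+2 ->
  sg k.+1 (u + 1) <= sg k.+1 u + jump + 2 * c.
Proof.
move=> /web_short_pair[v [v' [hD hE]]].
have [h _] := web_pairE k v v'.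
have := web_quasi_period u h; set w := u + _ - _.
have : sg k.+1 (u + 1) <= sg k.+1 w + c by apply: web_mono_c; rewrite /w; lia.
lia.
Qed.

(** The differences of [sg b.+2] are lengths of quasi-periods of [sg b.+1], so bounded
    jumps of the former make the latter affine. *)
Lemma web_affine_step b (J : R) : (forall u, (sg b.+2 (u + 1))%:~R <= (sg b.+2 u)%:~R + J) ->
  forall u n : int, `|(sg b.+1 (u + n))%:~R - (sg b.+1 u)%:~R - al b.+1 * n%:~R| <=
    al b.+1 * (c%:~R + J) + c%:~R * (1 + al b.+1) + 2 * c%:~R.
Proof.
move=> hJ.
apply: (@quasi_affine_le R (sg b.+1) (web_pair b.+1) c _ _ _ _ _
  (fun y => sg b.+2 y - sg b.+2 0) (fun y => eta b y - eta b 0)) => //.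
- exact: web_quasi_period.
- exact: web_mono_c.
- exact: alP.2.
- by move=> y; case: (web_pairE b y 0).
- by move=> y y' /(@web_mono_c b.+1); lia.
- move=> B; have [[y hy] [y' hy']] := web_unbounded b.+1 (B + sg b.+2 0).
  by split; [exists y|exists y']; lia.
- by move=> y; have := hJ y; rewrite !intrD; lra.
Qed.

Definition web_steep_error : R := jump%:~R + 6 * c%:~R.
Local Notation C2 := web_steep_error.

Lemma web_affine_steep b : al b.+2 <= al b.+1 -> forall u n : int,
  `|(sg b.+1 (u + n))%:~R - (sg b.+1 u)%:~R - al b.+1 * n%:~R| <= C2 * (1 + al b.+1).
Proof.
move=> hal u n.
have hJ v : (sg b.+2 (v + 1))%:~R <= (sg b.+2 v)%:~R + (jump + 2 * c)%:~R :> R.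
  rewrite -intrD ler_int addrA; apply: (@web_jump_le b.+1).
  by rewrite (@web_slope_alt b.+1) (@web_slope_alt b).
apply: le_trans (@web_affine_step b _ hJ u n) _.
rewrite /web_steep_error !(intrD, intrM) !mulrDr !mulrDl.
have : 0 <= jump%:~R :> R by rewrite ler0z jumpE; lia.
have : 0 <= c%:~R * al b.+1 by rewrite mulr_ge0 ?(ltW cR).
by move: cR; lra.
Qed.

Definition web_error : R := 4 * (C2 + 1) + 4 * c%:~R.

(** The function with the larger slope is affine by [web_affine_steep]; this bounds
    its jumps by a multiple of its slope, and the bound 4 on the product of the two slopes
    turns them into a uniform error for the other function. *)
Lemma web_affine_all b u n :
  `|(sg b.+1 (u + n))%:~R - (sg b.+1 u)%:~R - al b.+1 * n%:~R| <=
  web_error * (1 + al b.+1).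
Proof.
have C20 : 0 <= C2.
  by rewrite /web_steep_error addr_ge0 ?mulr_ge0 ?ler0z ?(ltW c_gt0)//; lia.
have a0 := al_ge0 b; have a1 := al_ge0 b.+1; have pr := web_slope_prod b.
have [hal|hal] := lerP (al b.+2) (al b.+1).
  apply: le_trans (web_affine_steep hal u n) _; rewrite ler_wpM2r//; first lra.
  by move: cR C20; rewrite /web_error; lra.
have hJ v : (sg b.+2 (v + 1))%:~R <= (sg b.+2 v)%:~R + (C2 + 1) * (1 + al b.+2) :> R.
  have := @web_affine_steep b.+1 _ v 1; rewrite (@web_slope_alt b) ltW// => /(_ isT).
  by rewrite ler_norml => /andP[_]; lra.
apply: le_trans (@web_affine_step b _ hJ u n) _.
have : al b.+1 * ((C2 + 1) * (1 + al b.+2)) <= (C2 + 1) * (al b.+1 + 4).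
  by rewrite mulrCA ler_pM2l; lra.
have : 0 <= c%:~R * al b.+1 by rewrite mulr_ge0 ?(ltW cR).
have : 0 <= C2 * al b.+1 by rewrite mulr_ge0.
move: cR C20 a0; rewrite /web_error. lra.
Qed.
End Web.

(** The error constant depends on [K] only, not on the web; this is what makes the final
    thickness bound uniform. *)
Theorem web_affine (R : realType) (K : int) : 0 < K -> exists2 C : R, 0 < C &
  forall (P : Type) (z : nat -> P -> int) sg th, web K z sg th ->
  exists al : nat -> R,
  [/\ forall b, 0 <= al b.+1, forall b, al b.+3 = al b.+1,
      forall b, al b.+1 * al b.+2 <= 4,
      forall b u n, `|(sg b.+1 (u + n))%:~R - (sg b.+1 u)%:~R - al b.+1 * n%:~R| <=
        C * (1 + al b.+1)
    & forall b u u',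
       `|(th b.+2 u + 2 * u - (th b.+2 u' + 2 * u'))%:~R -
         al b.+3 * (sg b.+2 u - sg b.+2 u')%:~R| <= C * (1 + al b.+3)].
Proof.
move=> K0; exists (web_error R (8 * K + 1) (60 * (K + (8 * K + 1)))).
  rewrite /web_error /web_steep_error.
  have : 0 < K%:~R :> R by rewrite ltr0z.
  by rewrite !(intrD, intrM); lra.
move=> P z sg th webP; have [al alP] := web_slope_exists R K0 webP erefl erefl.
exists al; split.
- exact: alP.1.
- by have := web_slope_alt K0 webP erefl erefl alP.
- by have := web_slope_prod K0 webP erefl erefl alP.
- by have := web_affine_all K0 webP erefl erefl alP.
move=> b u u'; have [_ h] := @web_pairE sg th b u u'.
apply: le_trans (alP.2 _ _ _ h) _; rewrite ler_wpM2r//.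
  by rewrite addr_ge0// alP.1.
have : 0 < K%:~R :> R by rewrite ltr0z.
by rewrite /web_error /web_steep_error !(intrD, intrM); lra.
Qed.

(** * Real induction and signed areas *)

Section RealInduction.
Variables (R : realType) (P : R -> Prop) (b : R).
Hypothesis P0 : P 0.
Hypothesis P_right : forall t, 0 <= t -> t < b -> P t ->
  exists2 e, 0 < e & forall u, t <= u -> u <= t + e -> P u.
Hypothesis P_left : forall t, 0 < t -> t <= b ->
  (forall u, 0 <= u -> u < t -> P u) -> P t.

(** The supremum of the initial segments on which [P] holds can be passed. This replaces
    connectedness and compactness of segments. *)
Lemma real_induction t : 0 <= t -> t <= b -> P t.
Proof.
move=> t0 tb; apply: contrapT => nPt.
pose S : set R := fun s => 0 <= s /\ forall u, 0 <= u -> u <= s -> P u.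
have S0 : S 0 by split=> // u u0 u0'; have -> : u = 0 by apply/le_anti/andP.
have ubS : ubound S t.
  by move=> s [s0 hs]; rewrite leNgt; apply/negP => /ltW/(hs t t0).
have supS : has_sup S by split; [exists 0|exists t].
have s0 : 0 <= sup S by exact: sup_upper_bound.
have st : sup S <= t by apply: ge_sup => //; exists 0.
have below u : 0 <= u -> u < sup S -> P u.
  move=> u0 us; have [s [_ hs] lt_us] := sup_gt (ex_intro _ 0 S0) us.
  by apply: hs => //; exact: ltW.
have Ps : P (sup S).
  have [s00|s00] := ltP 0 (sup S); first by apply: P_left => //; exact: le_trans tb.
  by have -> : sup S = 0 by apply/le_anti/andP.
have lt_st : sup S < t.
  by rewrite lt_neqAle st andbT; apply/eqP => e; rewrite e in Ps.
have [e e0 he] := P_right s0 (lt_le_trans lt_st tb) Ps.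
have : S (sup S + e).
  split=> [|u u0 ue]; first by rewrite addr_ge0// ltW.
  by have [us|us] := ltP u (sup S); [exact: below|exact: he].
move=> /(sup_upper_bound supS); lra.
Qed.
End RealInduction.

Section PlaneVectors.
Variables (R : realType) (eps : R).
Hypothesis eps_neq0 : eps != 0.
Implicit Types (x y w : 'rV[R]_2).

(** The factor [eps] allows either orientation of the plane: the edge vectors of a tiling
    need only be ordered like the roots of unity up to a reflection. *)
Definition area x y : R := eps * (x 0 0 * y 0 1 - x 0 1 * y 0 0).

Lemma vec2P x y : x 0 0 = y 0 0 -> x 0 1 = y 0 1 -> x = y.
Proof.
move=> h0 h1; apply/rowP => -[[|[|//]] hi].
  by rewrite (_ : Ordinal hi = 0)//; exact: val_inj.
by rewrite (_ : Ordinal hi = 1)//; exact: val_inj.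
Qed.

Lemma areaC x y : area x y = - area y x.
Proof. by rewrite /area; ring. Qed.
Lemma areaxx x : area x x = 0.
Proof. by rewrite /area; ring. Qed.
Lemma areaDr x y w : area x (y + w) = area x y + area x w.
Proof. by rewrite /area !mxE; ring. Qed.
Lemma areaDl x y w : area (x + y) w = area x w + area y w.
Proof. by rewrite /area !mxE; ring. Qed.
Lemma areaZr a x y : area x (a *: y) = a * area x y.
Proof. by rewrite /area !mxE; ring. Qed.
Lemma areaZl a x y : area (a *: x) y = a * area x y.
Proof. by rewrite /area !mxE; ring. Qed.
Lemma areaNr x y : area x (- y) = - area x y.
Proof. by rewrite /area !mxE; ring. Qed.
Lemma areaNl x y : area (- x) y = - area x y.
Proof. by rewrite /area !mxE; ring. Qed.
Definition areaE := (areaDr, areaDl, areaZr, areaZl, areaNr, areaNl, areaxx).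

Lemma area_comb x y a b : area x (a *: x + b *: y) = b * area x y.
Proof. by rewrite !areaE; ring. Qed.

Lemma area_decomp x y w : area x y != 0 ->
  w = (area w y / area x y) *: x + (area x w / area x y) *: y.
Proof.
by move=> h; apply: vec2P; rewrite !mxE; move: h; rewrite /area mulf_eq0 (negPf eps_neq0) => h;
  field; rewrite h.
Qed.

Lemma area_coord x y a b a' b' : area x y != 0 ->
  a *: x + b *: y = a' *: x + b' *: y -> a = a' /\ b = b'.
Proof.
move=> h e; have := congr1 (area x) e; have := congr1 (area ^~ y) e.
rewrite !areaE !mulr0 !add0r !addr0 => h1 h2.
by split; exact: (mulIf h).
Qed.

Lemma area_row_free x y : row_free (col_mx x y) -> area x y != 0.
Proof.
move=> free; apply/eqP => h.
have {}h : x 0 0 * y 0 1 = x 0 1 * y 0 0.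
  by move/eqP: h; rewrite mulf_eq0 (negPf eps_neq0) subr_eq0 => /eqP.
have dep a b : a *: x + b *: y = 0 -> a = 0 /\ b = 0.
  move=> e.
  have : row_mx a%:M b%:M *m col_mx x y = 0 *m col_mx x y.
    by rewrite mul_row_col !mul_scalar_mx mul0mx.
  move/(row_free_inj free)/eqP; rewrite -row_mx0 => /eqP/eq_row_mx[ha hb].
  split; [move/matrixP/(_ 0 0): ha|move/matrixP/(_ 0 0): hb];
    by rewrite !mxE eqxx mulr1n.
have [y1 x1] := dep (y 0 1) (- x 0 1) ltac:(by apply: vec2P; rewrite !mxE; lra).
have [y0 x0] := dep (y 0 0) (- x 0 0) ltac:(by apply: vec2P; rewrite !mxE; lra).
have [] := dep 1 0.
  apply: vec2P; rewrite !mxE; lra.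
by move/eqP; rewrite oner_eq0.
Qed.
End PlaneVectors.

(** * Tiles seen from their corners *)

(** An index together with a sign; the sign [true] denotes the opposite vector. *)
Definition sidx (m : nat) : Type := ('I_m * bool)%type.
Definition sneg m (s : sidx m) : sidx m := (s.1, ~~ s.2).

Section SignedFaces.
Variables (R : realType) (m : nat) (v : 'I_m -> 'rV[R]_2).
Implicit Types (s t : sidx m) (X y : 'rV[R]_2) (T : set (@tile R m)).

Definition sgb (b : bool) : R := if b then -1 else 1.
Definition svec s : 'rV[R]_2 := sgb s.2 *: v s.1.
Local Notation sv := svec.
Definition es s : 'rV[R]_m := sgb s.2 *: e_ s.1.

Lemma sgb_neg b : sgb (~~ b) = - sgb b.
Proof. by case: b; rewrite /= ?opprK. Qed.
Lemma sgb_sqr b : sgb b * sgb b = 1.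
Proof. by case: b; rewrite /sgb; ring. Qed.
Lemma sv_neg s : sv (sneg s) = - sv s.
Proof. by rewrite /svec sgb_neg scaleNr. Qed.
Lemma es_neg s : es (sneg s) = - es s.
Proof. by rewrite /es sgb_neg scaleNr. Qed.
Lemma sv_pos i : sv (i, false) = v i. Proof. by rewrite /svec scale1r. Qed.
Lemma es_pos i : es (i, false) = e_ i. Proof. by rewrite /es scale1r. Qed.
Lemma snegK s : sneg (sneg s) = s.
Proof. by case: s => i b; rewrite /sneg /= negbK. Qed.

(** A tile read from the corner [X] along the signed vectors [s] and [t] is coded by its
    lower corner [X + (corner s + corner t)]. *)
Definition corner s : 'rV[R]_2 := if s.2 then sv s else 0.

(** Every tile is represented from each of its four corners and with both orders of the
    two directions, so that statements about edges need no distinction of cases. *)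
Definition rep (tau : tile) s t X : Prop :=
  tau = (X + (corner s + corner t), s.1, t.1) \/
  tau = (X + (corner s + corner t), t.1, s.1).

Definition sface T s t X : Prop := exists2 tau, T tau & rep tau s t X.
Definition sedge T s X : Prop := exists t, sface T s t X.

Definition on_face s t X y : Prop := exists a b : R,
  [/\ 0 <= a <= 1, 0 <= b <= 1 & y = X + (a *: sv s + b *: sv t)].

Lemma rep_sym tau s t X : rep tau s t X -> rep tau t s X.
Proof. by rewrite /rep [corner t + _]addrC => -[]; [right|left]. Qed.

Lemma corner_flip s : sv s + corner (sneg s) = corner s.
Proof. by case: s => i [] /=; rewrite /corner ?addr0// sv_neg subrr. Qed.

Lemma rep_flip tau s t X : rep tau s t X -> rep tau (sneg s) t (X + sv s).
Proof.
by rewrite /rep -addrA [sv s + (_ + _)]addrA corner_flip.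
Qed.

Lemma rep_pos x i j : rep (x, i, j) (i, false) (j, false) x.
Proof. by left; rewrite /corner /= !addr0. Qed.

(** Exchanging the directions and moving along one of them generate all representations
    of a tile. *)
Lemma rep_ind (tau : tile) (Q : sidx m -> sidx m -> 'rV[R]_2 -> Prop) :
  (forall s t X, Q s t X -> Q t s X) ->
  (forall s t X, Q s t X -> Q (sneg s) t (X + sv s)) ->
  (let: (x, i, j) := tau in Q (i, false) (j, false) x) ->
  forall s t X, rep tau s t X -> Q s t X.
Proof.
move: tau => [[x i] j] sym flip base s t X h.
have sgn (b b' : bool) k l Y : Q (k, false) (l, false) (Y + (corner (k, b) + corner (l, b'))) ->
    Q (k, b) (l, b') Y.
  have one b0 k0 t0 Y0 : Q (k0, false) t0 (Y0 + corner (k0, b0)) -> Q (k0, b0) t0 Y0.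
    case: b0; rewrite /corner /= ?addr0// => /flip.
    by rewrite /sneg /= -addrA -[sv (k0, true)]/(sv (sneg (k0, false))) sv_neg addNr addr0.
  by rewrite addrA addrAC => /one/sym/one/sym.
case: s t h => [k b] [l b'] [] /= [e -> ->] in base *; apply: sgn; rewrite -e//.
exact: sym.
Qed.

Lemma rep_set tau s t X : rep tau s t X ->
  forall y, tile_set v tau y <-> on_face s t X y.
Proof.
move: s t X; apply: rep_ind => [s t X h y|s t X h y|].
- rewrite h; split=> -[a [b [ha hb ->]]]; exists b, a; split=> //;
    by rewrite [_ *: sv t + _]addrC.
- rewrite h; split=> -[a [b [ha hb ->]]]; exists (1 - a), b.
    by split=> //; [lra|rewrite sv_neg; apply/rowP => l; rewrite !mxE; ring].
  by split=> //; [lra|rewrite sv_neg; apply/rowP => l; rewrite !mxE; ring].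
by move: tau => [[x i] j] y; rewrite /on_face !sv_pos.
Qed.

Lemma natrB_bool (b : bool) : (~~ b)%:R = 1 - b%:R :> R.
Proof. by case: b; rewrite ?subrr ?subr0. Qed.

Lemma rep_vertex tau s t X : rep tau s t X -> forall y, tile_vertex v tau y <->
  exists p q : bool, y = X + (p%:R *: sv s + q%:R *: sv t).
Proof.
move: s t X; apply: rep_ind => [s t X h y|s t X h y|].
- by rewrite h; split=> -[p [q ->]]; exists q, p; rewrite [_ *: sv t + _]addrC.
- rewrite h; split=> -[p [q ->]]; exists (~~ p), q; rewrite natrB_bool sv_neg;
    by apply/rowP => l; rewrite !mxE; ring.
by move: tau => [[x i] j] y; rewrite !sv_pos.
Qed.

Lemma rep_edge tau A : tile_edge v tau A -> exists i t X,
  rep tau (i, false) t X /\ A = segment X (v i).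
Proof.
move: tau => [[x i] j] [b [->|->]].
  case: b; rewrite ?scale1r ?scale0r ?addr0.
    exists i, (j, true), (x + v j); split => //.
    by rewrite -(sv_pos j); apply/rep_sym/(@rep_flip _ (j, false))/rep_sym/rep_pos.
  by exists i, (j, false), x; split => //; exact: rep_pos.
case: b; rewrite ?scale1r ?scale0r ?addr0.
  exists j, (i, true), (x + v i); split => //.
  by rewrite -(sv_pos i); apply/rep_sym/(@rep_flip _ (i, false))/rep_pos.
by exists j, (i, false), x; split => //; apply/rep_sym/rep_pos.
Qed.

Lemma sface_sym T s t X : sface T s t X -> sface T t s X.
Proof. by move=> [tau Tt h]; exists tau => //; exact: rep_sym. Qed.
Lemma sface_flip T s t X : sface T s t X -> sface T (sneg s) t (X + sv s).
Proof. by move=> [tau Tt h]; exists tau => //; exact: rep_flip. Qed.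
Lemma sface_flip_r T s t X : sface T s t X -> sface T s (sneg t) (X + sv t).
Proof. by move=> /sface_sym/sface_flip/sface_sym. Qed.

Lemma sedge_flip T s X : sedge T s X -> sedge T (sneg s) (X + sv s).
Proof. by move=> [t h]; exists t; exact: sface_flip. Qed.
Lemma sface_edge T s t X : sface T s t X -> sedge T s X /\ sedge T s (X + sv t).
Proof. by move=> h; split; [exists t|exists (sneg t); exact: sface_flip_r]. Qed.

Lemma sedge_vertex T s X : sedge T s X -> vertex v T X /\ vertex v T (X + sv s).
Proof.
move=> [t [tau Tt h]]; split; exists tau => //; apply/(rep_vertex h).
  by exists false, false; rewrite !scale0r !addr0.
by exists true, false; rewrite scale0r addr0 scale1r.
Qed.

Lemma vertex_sface T X : vertex v T X -> exists s t, sface T s t X.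
Proof.
move=> [[[x i] j] Tt [a [b ->]]].
have h := rep_pos x i j.
case: a b => [] [];
  rewrite ?scale1r ?scale0r ?addr0 ?add0r -?(sv_pos i) -?(sv_pos j) ?addrA.
- by do 2 eexists; exists (x, i, j) => //; apply/rep_flip/rep_sym/rep_flip/h.
- by do 2 eexists; exists (x, i, j) => //; apply/rep_flip/h.
- by do 2 eexists; exists (x, i, j) => //; apply/rep_flip/rep_sym/h.
by exists (i, false), (j, false), (x, i, j).
Qed.

Variable L : 'rV[R]_2 -> 'rV[R]_m.

Definition commutes_with_faces T := forall x i j, T (x, i, j) -> forall a b : bool,
  L (x + (a%:R *: v i + b%:R *: v j)) = L x + (a%:R *: e_ i + b%:R *: e_ j).

Lemma rep_lift T tau : commutes_with_faces T -> T tau -> forall s t X, rep tau s t X ->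
  forall p q : bool, L (X + (p%:R *: sv s + q%:R *: sv t)) = L X + (p%:R *: es s + q%:R *: es t).
Proof.
move=> liftL Tt; apply: rep_ind => [s t X h p q|s t X h p q|].
- by rewrite addrC [p%:R *: _ + _]addrC addrC h; congr (_ + _); rewrite addrC.
- have := h (~~ p) q; rewrite natrB_bool sv_neg es_neg.
  have := h true false; rewrite !scale0r !scale1r !addr0 => -> e.
  transitivity (L (X + ((1 - p%:R) *: sv s + q%:R *: sv t))).
    by congr L; apply/rowP => l; rewrite !mxE; ring.
  by rewrite e; apply/rowP => l; rewrite !mxE; ring.
by move: tau Tt => [[x i] j] Tt p q; rewrite !sv_pos !es_pos; exact: liftL.
Qed.

Lemma sface_lift T s t X : commutes_with_faces T -> sface T s t X ->
  [/\ L (X + sv s) = L X + es s, L (X + sv t) = L X + es t &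
      L (X + sv s + sv t) = L X + es s + es t].
Proof.
move=> liftL [tau Tt /(rep_lift liftL Tt) h]; split.
- by have := h true false; rewrite !scale1r !scale0r !addr0.
- by have := h false true; rewrite !scale1r !scale0r !add0r.
- by have := h true true; rewrite !scale1r !addrA.
Qed.
End SignedFaces.

(** * Local finiteness *)

Lemma infinite_pigeonhole (F : finType) (g : nat -> F) :
  exists c, forall N, exists2 n, (N <= n)%N & g n = c.
Proof.
apply: contrapT => /forallNP h.
have bad c : exists N, forall n, (N <= n)%N -> g n <> c.
  have /existsNP[N hN] := h c; exists N => n Nn e.
  by apply: hN; exists n.
have [b hb] := choice bad.
by apply: (hb (g (\max_c b c)) (\max_c b c)) => //; exact: leq_bigmax.
Qed.

Section LocalFiniteness.
Variables (R : realType) (m : nat) (v : 'I_m -> 'rV[R]_2) (eps : R).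
Hypotheses (hv : edge_vectors v) (eps_neq0 : eps != 0).
Local Notation ar := (area eps).
Implicit Types (s t : sidx m) (X y w : 'rV[R]_2).

Lemma area_v_neq0 i j : i != j -> ar (v i) (v j) != 0.
Proof. by move=> ij; apply: (area_row_free eps_neq0); exact: (hv.2 _ _ ij). Qed.

Lemma sgb_neq0 b : sgb R b != 0.
Proof. by case: b; rewrite /= ?oppr_eq0 oner_neq0. Qed.

Lemma area_sv_neq0 s t : s.1 != t.1 -> ar (svec v s) (svec v t) != 0.
Proof.
by move=> st; rewrite /svec !areaE; do 2 (apply: mulf_neq0; first exact: sgb_neq0);
  exact: area_v_neq0.
Qed.

Definition coA i j w := ar w (v j) / ar (v i) (v j).
Definition coB i j w := ar (v i) w / ar (v i) (v j).

Lemma coAD i j y w u : coA i j (y + u *: w) = coA i j y + u * coA i j w.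
Proof. by rewrite /coA !areaE; ring. Qed.
Lemma coBD i j y w u : coB i j (y + u *: w) = coB i j y + u * coB i j w.
Proof. by rewrite /coB !areaE; ring. Qed.

Lemma coE i j w : i != j -> w = coA i j w *: v i + coB i j w *: v j.
Proof. by move=> ij; apply: area_decomp => //; exact: area_v_neq0. Qed.

Lemma co_uniq i j a b : i != j ->
  coA i j (a *: v i + b *: v j) = a /\ coB i j (a *: v i + b *: v j) = b.
Proof.
move=> ij; have h := area_v_neq0 ij.
by rewrite /coA /coB !areaE !mulr0 addr0 add0r !mulfK.
Qed.

Lemma tile_setP x i j y : i != j -> tile_set v (x, i, j) y <->
  (0 <= coA i j (y - x) <= 1) /\ (0 <= coB i j (y - x) <= 1).
Proof.
move=> ij; split=> [[a [b [ha hb ->]]]|[ha hb]].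
  by rewrite addrC addKr; have [-> ->] := co_uniq a b ij.
exists (coA i j (y - x)), (coB i j (y - x)); split => //.
by rewrite -coE// addrC subrK.
Qed.

Lemma limit_ge0 (a W : R) :
  (forall e, 0 < e -> exists u, [/\ 0 < u, u <= e & 0 <= a + u * W]) -> 0 <= a.
Proof.
move=> h; rewrite leNgt; apply/negP => a0.
have W1 : 0 < `|W| + 1 by rewrite ltr_wpDl.
have [|u [u0 ue ua]] := h (- a / 2 / (`|W| + 1)).
  by rewrite !divr_gt0// oppr_gt0.
rewrite ler_pdivlMr// in ue.
have : u * W <= u * (`|W| + 1).
  by rewrite ler_pM2l//; apply: le_trans (ler_norm _) _; rewrite lerDl.
lra.
Qed.

Lemma tile_set_closed x i j y w : i != j ->
  (forall e, 0 < e -> exists u, [/\ 0 < u, u <= e & tile_set v (x, i, j) (y + u *: w)]) ->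
  tile_set v (x, i, j) y.
Proof.
move=> ij h.
have {}h e : 0 < e -> exists u, [/\ 0 < u, u <= e,
    0 <= coA i j (y - x) + u * coA i j w <= 1 &
    0 <= coB i j (y - x) + u * coB i j w <= 1].
  move=> /h[u [u0 ue /(tile_setP _ _ ij)]].
  by rewrite addrAC coAD coBD => -[ha hb]; exists u.
apply/tile_setP => //; split; apply/andP; split.
- apply: (@limit_ge0 _ (coA i j w)) => e /h[u [u0 ue /andP[? ?] _]]; by exists u.
- rewrite -subr_ge0; apply: (@limit_ge0 _ (- coA i j w)) => e /h[u [u0 ue /andP[? ?] _]].
  by exists u; split => //; lra.
- apply: (@limit_ge0 _ (coB i j w)) => e /h[u [u0 ue _ /andP[? ?]]]; by exists u.
- rewrite -subr_ge0; apply: (@limit_ge0 _ (- coB i j w)) => e /h[u [u0 ue _ /andP[? ?]]].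
  by exists u; split => //; lra.
Qed.

Lemma tile_set_convex x i j y w u : i != j -> 0 < u ->
  tile_set v (x, i, j) y -> tile_set v (x, i, j) (y + u *: w) ->
  forall u', 0 <= u' -> u' <= u -> tile_set v (x, i, j) (y + u' *: w).
Proof.
move=> ij u0 /(tile_setP _ _ ij)[h1 h2] /(tile_setP _ _ ij).
rewrite addrAC coAD coBD => -[h3 h4] u' u'0 u'u.
apply/tile_setP => //; rewrite addrAC coAD coBD.
have [k [k0 k1 ->]] : exists k, [/\ 0 <= k, k <= 1 & u' = k * u].
  exists (u' / u); split; first by rewrite divr_ge0// ltW.
    by rewrite ler_pdivrMr// mul1r.
  by rewrite divfK// gt_eqF.
by split; nra.
Qed.

Variable T : set (@tile R m).
Hypothesis T_lt : forall x i j, T (x, i, j) -> (i < j)%N.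
Hypothesis T_sep : forall x i j a b, T (x, i, j) ->
  T (x + (a *: v i + b *: v j), i, j) -> -1 < a < 1 -> -1 < b < 1 ->
  a = 0 /\ b = 0.

Definition covered y := exists2 tau, T tau & tile_set v tau y.

Lemma T_neq x i j : T (x, i, j) -> i != j.
Proof. by move=> /T_lt h; rewrite neq_ltn h. Qed.

Lemma coA_bound w : exists N : nat, forall i j,
  `|coA i j w| + 2 <= N%:R /\ `|coB i j w| + 2 <= N%:R.
Proof.
pose S := \sum_i \sum_j (`|coA i j w| + `|coB i j w|).
exists (Num.bound (S + 2)) => i j.
have S0 : 0 <= S by rewrite /S !sumr_ge0// => k _; rewrite sumr_ge0// => l _; rewrite addr_ge0.
have le_S : `|coA i j w| + `|coB i j w| <= S.
  rewrite /S (bigD1 i)//= (bigD1 j)//= -addrA lerDl.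
  by rewrite addr_ge0// sumr_ge0// => k _; rewrite ?sumr_ge0// => *; rewrite addr_ge0.
have hb : S + 2 <= (Num.bound (S + 2))%:R by apply/ltW/archi_boundP; lra.
have := normr_ge0 (coA i j w); have := normr_ge0 (coB i j w); split; lra.
Qed.

(** If covered points accumulate at [y] in the direction [w], then one tile contains a
    whole initial segment: by separation only finitely many tiles of each type meet a
    neighbourhood of [y], so one tile occurs infinitely often, and tiles are closed and
    convex. *)
Lemma covered_initial y w :
  (forall e, 0 < e -> exists u, [/\ 0 < u, u <= e & covered (y + u *: w)]) ->
  exists tau u, [/\ T tau, 0 < u &
    forall u', 0 <= u' -> u' <= u -> tile_set v tau (y + u' *: w)].
Proof.
move=> h.
have h1 (n : nat) : exists ut : R * tile, [/\ 0 < ut.1, ut.1 <= n.+1%:R^-1, T ut.2 &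
    tile_set v ut.2 (y + ut.1 *: w)].
  have [|u [u0 un [tau Tt ht]]] := h n.+1%:R^-1; first by rewrite invr_gt0 ltr0n.
  by exists (u, tau).
have [f hf] := choice h1; have [N hN] := coA_bound w.
pose bx n := (f n).2.1.1; pose ix n := (f n).2.1.2; pose jx n := (f n).2.2.
pose A n := coA (ix n) (jx n) (bx n - y); pose B n := coB (ix n) (jx n) (bx n - y).
have fE n : (f n).2 = (bx n, ix n, jx n) by rewrite /bx /ix /jx -!surjective_pairing.
have Tn n : T (bx n, ix n, jx n) by have [_ _ + _] := hf n; rewrite {1}fE.
have ijn n : ix n != jx n by exact: T_neq (Tn n).
have AB n : (- N%:R <= A n <= N%:R) /\ (- N%:R <= B n <= N%:R).
  have [u0 un _] := hf n.
  rewrite {1}fE.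
  move=> /(tile_setP _ _ (ijn n)).
  have -> : y + (f n).1 *: w - bx n = - (1 : R) *: (bx n - y) + (f n).1 *: w.
    by rewrite scaleN1r opprB addrAC.
  rewrite -[- (1 : R) *: _]add0r !coAD !coBD -/(A n) -/(B n).
  have -> : coA (ix n) (jx n) 0 = 0 by rewrite /coA /area !mxE; ring.
  have -> : coB (ix n) (jx n) 0 = 0 by rewrite /coB /area !mxE; ring.
  have u1 : (f n).1 <= 1.
    by apply: le_trans un _; rewrite invf_le1 ?ltr0n// ler1n.
  have hu (z : R) : `|(f n).1 * z| <= `|z|.
    by rewrite normrM ger0_norm ?(ltW u0)// ler_piMl.
  have [hA hB] := hN (ix n) (jx n).
  have := hu (coA (ix n) (jx n) w); have := hu (coB (ix n) (jx n) w).
  rewrite !ler_norml => /andP[b1 b2] /andP[a1 a2] [/andP[c1 c2] /andP[d1 d2]].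
  by split; apply/andP; split; lra.
(* Tiles of the same type whose rounded positions agree coincide, by separation. *)
pose code (z : R) : 'I_(2 * N).+1 := inord (absz (Num.floor z + N%:Z)).
have codeP (z z' : R) : - N%:R <= z <= N%:R -> - N%:R <= z' <= N%:R -> code z = code z' ->
    -1 < z' - z < 1.
  have rng (q : R) : - N%:R <= q <= N%:R -> - N%:Z <= Num.floor q <= N%:Z.
    move=> /andP[q1 q2]; apply/andP; split.
      by rewrite floor_ge_int mulrNz.
    by rewrite -(ler_int R); apply: le_trans (floor_le _) _.
  move=> /[dup]/rng/andP[r1 r2] _ /[dup]/rng/andP[r3 r4] _ /(congr1 val).
  rewrite /code /= !inordK; try by rewrite ltnS; lia.
  move=> e; have {}e : Num.floor z = Num.floor z' by lia.
  have := floor_le z; have := floorD1_gt z; have := floor_le z'; have := floorD1_gt z'.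
  by rewrite e !intrD; lra.
have [c hc] := infinite_pigeonhole (fun n => (ix n, jx n, code (A n), code (B n))).
have [n0 _ e0] := hc 0%N.
exists (bx n0, ix n0, jx n0), (f n0).1.
have same n : (ix n, jx n, code (A n), code (B n)) = c -> (f n).2 = (bx n0, ix n0, jx n0).
  rewrite -e0 => -[ei ej eA eB].
  rewrite {1}fE.
  rewrite ei ej; congr (_, _, _).
  have [An Bn] := AB n; have [A0 B0] := AB n0.
  have dA := codeP _ _ A0 An (esym eA); have dB := codeP _ _ B0 Bn (esym eB).
  have e : bx n = bx n0 + ((A n - A n0) *: v (ix n0) + (B n - B n0) *: v (jx n0)).
    have En := coE (bx n - y) (ijn n); have E0 := coE (bx n0 - y) (ijn n0).
    rewrite -/(A n) -/(B n) ei ej in En; rewrite -/(A n0) -/(B n0) in E0.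
    rewrite !scalerBl addrACA -opprD -En -E0.
    by apply/rowP => l; rewrite !mxE; ring.
  have := Tn n; rewrite ei ej e => Tn'.
  have [-> ->] := T_sep (Tn n0) Tn' dA dB.
  by rewrite !scale0r !addr0.
have y_in : tile_set v (bx n0, ix n0, jx n0) y.
  apply: (@tile_set_closed _ _ _ _ w) => // e he.
  have [n n_big en] := hc (Num.bound e^-1); have [u0 un _ hn] := hf n.
  exists (f n).1; split => //; last by rewrite -(same n en).
  apply: le_trans un _; rewrite invf_ple ?posrE ?ltr0n//.
  have ei : 0 <= e^-1 by rewrite invr_ge0 ltW.
  apply: le_trans (ltW (archi_boundP ei)) _.
  by rewrite ler_nat; lia.
have [u0 _ T0 h0] := hf n0; rewrite (same _ e0) in T0 h0; split => //.
exact: tile_set_convex.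
Qed.
End LocalFiniteness.

(** * Faces around the points of a tiling *)

Section Tilings.
Variables (R : realType) (m : nat) (v : 'I_m -> 'rV[R]_2) (eps : R).
Hypotheses (hv : edge_vectors v) (eps_neq0 : eps != 0).
Local Notation ar := (area eps).
Local Notation sv := (svec v).
Implicit Types (s t : sidx m) (X y w : 'rV[R]_2).
Variable T : set (@tile R m).
Hypothesis hT : rhombus_tiling v T.

Lemma tiling_lt x i j : T (x, i, j) -> (i < j)%N.
Proof. by case: hT => h _ _ _; exact: h. Qed.

Lemma rep_neq tau s t X : T tau -> rep v tau s t X -> s.1 != t.1.
Proof.
by move=> Tt [] e; rewrite e in Tt; have := tiling_lt Tt; rewrite neq_ltn => ->//; rewrite orbT.
Qed.

Lemma sface_neq s t X : sface v T s t X -> s.1 != t.1.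
Proof. by move=> [tau]; exact: rep_neq. Qed.

Lemma sface_area s t X : sface v T s t X -> ar (sv s) (sv t) != 0.
Proof. by move=> /sface_neq; exact: area_sv_neq0. Qed.

Lemma sv_coord tau s t X a b a' b' : T tau -> rep v tau s t X ->
  X + (a *: sv s + b *: sv t) = X + (a' *: sv s + b' *: sv t) -> a = a' /\ b = b'.
Proof.
move=> Tt /(rep_neq Tt) st /addrI; apply: (@area_coord _ eps).
exact: area_sv_neq0.
Qed.

Lemma segment_inj X X' i i' : segment X (v i) = segment X' (v i') -> X = X' /\ i = i'.
Proof.
move=> e.
have [a a01 Xa] : segment X' (v i') X.
  by rewrite -e; exists 0; rewrite ?lexx ?ler01// scale0r addr0.
have [b b01 Xb] : segment X' (v i') (X + v i).
  by rewrite -e; exists 1; rewrite ?lexx ?ler01// scale1r.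
have vi : v i = (b - a) *: v i'.
  apply: (addrI X); rewrite Xb {1}Xa scalerBl -addrA; congr (_ + _).
  by rewrite addrC subrK.
have ii' : i = i'.
  apply/eqP; apply/negPn/negP => /(area_v_neq0 hv eps_neq0).
  by rewrite vi !areaE mulr0 eqxx.
split=> //; subst i'.
have h : area 1 (v i) (v i) = 0 by rewrite areaxx.
have ba : b - a = 1.
  have [n1 _] := hv; have := n1 i.
  have : v i != 0.
    apply/eqP => v0; have := n1 i; rewrite v0 !mxE expr0n /= addr0.
    by move/eqP; rewrite eq_sym oner_eq0.
  move: vi; rewrite -{1}[v i]scale1r => /eqP; rewrite -subr_eq0 -scalerBl scaler_eq0.
  by move=> /orP[|->//]; rewrite subr_eq0 => /eqP.
have a0 : a = 0 by lra.
by rewrite Xa a0 scale0r addr0.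
Qed.

(** The edge-to-edge condition, in terms of representations from a corner. *)
Lemma tiles_meet tau tau' y : T tau -> T tau' -> tile_set v tau y -> tile_set v tau' y ->
  [\/ tau = tau', tile_vertex v tau y /\ tile_vertex v tau' y |
   exists i t t' X, [/\ rep v tau (i, false) t X, rep v tau' (i, false) t' X &
     segment X (v i) y]].
Proof.
move=> Tt Tt' yt yt'.
have [e|ne] := pselect (tau = tau'); first exact: Or31.
case: hT => _ _ _ h; have := h tau tau' Tt Tt' ne; cbv zeta.
set A := tile_set v tau `&` tile_set v tau' => {}h.
have Ay : A y by split.
case: h; first by exists y.
  by move=> [z [h1 h2 h3]]; rewrite h3 in Ay; apply: Or32; rewrite Ay.
move=> [/rep_edge[i [t [X [h e]]]] /rep_edge[i' [t' [X' [h' e']]]]].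
have [eX ei] := segment_inj (etrans (esym e) e'); subst X' i'.
by apply: Or33; exists i, t, t', X; split => //; rewrite -e.
Qed.

Lemma corner_diff s s' : s.1 = s'.1 ->
  corner v s = corner v s' + (s.2 (+) s'.2)%:R *: sv s.
Proof.
case: s s' => i b [i' b'] /= ->; rewrite /corner /=.
case: b b' => [] [] /=; rewrite ?scale0r ?scale1r ?addr0 ?add0r//.
by rewrite /svec /= scaleN1r scale1r addNr.
Qed.

Lemma rep_cases tau s t X s' t' X' : rep v tau s t X -> rep v tau s' t' X' ->
  exists p q : bool, X' = X + (p%:R *: sv s + q%:R *: sv t) /\
   ((s' = (if p then sneg s else s) /\ t' = (if q then sneg t else t)) \/
    (t' = (if p then sneg s else s) /\ s' = (if q then sneg t else t))).
Proof.
move=> h h'.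
wlog st : s' t' h' / s.1 = s'.1 /\ t.1 = t'.1.
  move=> W.
  have [[e1 e2]|[e1 e2]] : (s.1 = s'.1 /\ t.1 = t'.1) \/ (s.1 = t'.1 /\ t.1 = s'.1).
    by case: h' h => -> [] [_ e1 e2]; [left|right|right|left].
  - exact: (W s' t').
  - have [p [q [e H]]] := W t' s' (rep_sym h') (conj e1 e2).
    by exists p, q; split => //; case: H; [right|left].
have eq : X + (corner v s + corner v t) = X' + (corner v s' + corner v t').
  by case: h' h => -> [] [].
case: st => e1 e2.
have eX : X' = X + ((s.2 (+) s'.2)%:R *: sv s + (t.2 (+) t'.2)%:R *: sv t).
  move: eq; rewrite (corner_diff e1) (corner_diff e2) => eq.
  apply: (addIr (corner v s' + corner v t')); rewrite -eq.
  by apply/rowP => l; rewrite !mxE; ring.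
exists (s.2 (+) s'.2), (t.2 (+) t'.2); split => //; left.
case: s s' t t' e1 e2 {h h' eq eX} => i b [i' b'] [j c] [j' c'] /= -> ->.
by split; [case: b b' => [] []|case: c c' => [] []].
Qed.

Definition interior_face s t X y := exists a b : R,
  [/\ 0 < a < 1, 0 < b < 1 & y = X + (a *: sv s + b *: sv t)].

Lemma rep_interior tau s t X s' t' X' y : rep v tau s t X -> rep v tau s' t' X' ->
  interior_face s t X y -> interior_face s' t' X' y.
Proof.
move=> h h' [a [b [ha hb ->]]].
have [p [q [-> H]]] := rep_cases h h'.
pose a' := if p then 1 - a else a; pose b' := if q then 1 - b else b.
have ha' : 0 < a' < 1 by rewrite /a'; case: (p) => //; lra.
have hb' : 0 < b' < 1 by rewrite /b'; case: (q) => //; lra.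
have E : a *: sv s + b *: sv t = p%:R *: sv s + q%:R *: sv t +
    (a' *: sv (if p then sneg s else s) + b' *: sv (if q then sneg t else t)).
  rewrite /a' /b'; clear H ha' hb' a' b'; case: p; case: q; rewrite /= ?sv_neg;
    by apply/rowP => l; rewrite !mxE; ring.
case: H => -[-> ->]; [exists a', b'|exists b', a']; split => //; rewrite E addrA //.
by rewrite [b' *: _ + _]addrC.
Qed.

Lemma interior_meet tau tau' s t X y : T tau -> T tau' -> rep v tau s t X ->
  interior_face s t X y -> tile_set v tau' y -> tau = tau'.
Proof.
move=> Tt Tt' h hi yt'.
have yt : tile_set v tau y.
  apply/(rep_set h); case: hi => a [b [ha hb e]].
  by exists a, b; split => //; lra.
case: (tiles_meet Tt Tt' yt yt') => //.
  move=> [/(rep_vertex h)[p [q yE]] _].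
  case: hi => a [b [ha hb e]]; rewrite e in yE.
  have [ap _] := sv_coord Tt h yE.
  by exfalso; move: ha; rewrite ap; case: (p) => /=; lra.
move=> [i [u [u' [Y [r _ [c _ yE]]]]]].
have [a [b [ha hb]]] := rep_interior h r hi.
have -> : y = Y + (c *: sv (i, false) + 0 *: sv u) by rewrite scale0r addr0 sv_pos.
by move=> /(sv_coord Tt r)[_ b0]; rewrite -b0 ltxx in hb.
Qed.

Lemma tiling_sep x i j a b : T (x, i, j) ->
  T (x + (a *: v i + b *: v j), i, j) -> -1 < a < 1 -> -1 < b < 1 -> a = 0 /\ b = 0.
Proof.
move=> T1 T2 ha hb; have ij : i != j by rewrite neq_ltn (tiling_lt T1).
pose a1 := (1 + a) / 2; pose b1 := (1 + b) / 2.
pose y := x + (a1 *: v i + b1 *: v j).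
have e : (x, i, j) = (x + (a *: v i + b *: v j), i, j) :> tile.
  apply: (@interior_meet _ _ (i, false) (j, false) x y) => //.
  - exact: rep_pos.
  - by exists a1, b1; rewrite !sv_pos; split => //; rewrite /a1 /b1; lra.
  exists ((1 - a) / 2), ((1 - b) / 2); split; [lra|lra|].
  by rewrite /y /a1 /b1; apply/rowP => l; rewrite !mxE; field.
have {}e : x = x + (a *: v i + b *: v j) by case: e.
have {}e : 0 *: v i + 0 *: v j = a *: v i + b *: v j.
  by apply: (addrI x); rewrite -e !scale0r !addr0.
have [<- <-] // := @area_coord _ eps _ _ _ _ _ _ (area_v_neq0 hv eps_neq0 ij) e.
Qed.

(** In each direction from each point, a tile contains an initial segment. *)
Lemma sector y w : exists s t X e, [/\ sface v T s t X, 0 < e &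
  forall u, 0 <= u -> u <= e -> on_face v s t X (y + u *: w)].
Proof.
have [|tau [e [Tt e0 h]]] := @covered_initial _ _ v eps hv eps_neq0 T tiling_lt tiling_sep y w.
  move=> e e0; exists e; split => //.
  by case: hT => _ cov _ _; exact: cov.
case: tau Tt h => [[x i] j] Tt h.
exists (i, false), (j, false), x, e; split => //.
  by exists (x, i, j) => //; exact: rep_pos.
by move=> u u0 ue; apply/(rep_set (rep_pos v x i j)); exact: h.
Qed.

(** The tile met when leaving the midpoint of the edge towards the positive side shares
    this edge, by the edge-to-edge condition. *)
Lemma next_face s X : sedge v T s X -> exists2 t, 0 < ar (sv s) (sv t) & sface v T s t X.
Proof.
move=> [t0 h0]; have a0 := sface_area h0; have [tau Tt r] := h0.
pose w := ar (sv s) (sv t0) *: sv t0.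
have w0 : 0 < ar (sv s) w by rewrite areaZr -expr2 exprn_even_gt0.
clearbody w.
pose y := X + (1 / 2) *: sv s.
have [s' [t' [X' [e [h' e0 he]]]]] := sector y w.
have [tau' Tt' r'] := h'.
suff [u ru] : exists u, rep v tau' s u X.
  exists u; last by exists tau'.
  have /(rep_set r') /(rep_set ru)[a [b [ha hb]]] := he e (ltW e0) (lexx _).
  rewrite /y -addrA => /addrI/(congr1 (ar (sv s))).
  rewrite !area_comb => E.
  have b0 : 0 <= b by case/andP: hb.
  rewrite ltNge; apply/negP => le0.
  have : 0 < e * ar (sv s) w by rewrite mulr_gt0.
  by rewrite E; nra.
have yt : tile_set v tau y.
  apply/(rep_set r); exists (1 / 2), 0; split; [lra|lra|].
  by rewrite scale0r addr0.
have yt' : tile_set v tau' y.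
  by apply/(rep_set r'); have := he 0 (lexx _) (ltW e0); rewrite scale0r addr0.
have yE : y = X + ((1 / 2) *: sv s + 0 *: sv t0) by rewrite scale0r addr0.
case: (tiles_meet Tt Tt' yt yt').
- by move=> <-; exists t0.
- move=> [/(rep_vertex r)[p [q e1]] _]; rewrite yE in e1.
  by have [H _] := sv_coord Tt r e1; exfalso; move: H; case: p {e1} => /=; lra.
move=> [i [u [u' [Y [r1 r2 [c c01 yc]]]]]].
have [p [q [YE H]]] := rep_cases r r1.
have sgn p0 s0 : sv (if p0 then sneg s0 else s0) = (if p0 then -1 else 1) *: sv s0.
  by case: p0; rewrite ?sv_neg ?scale1r ?scaleN1r.
rewrite -(sv_pos v i) in yc.
case: H => -[H1 H2].
  have : X + (1 / 2 *: sv s + 0 *: sv t0) =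
      X + ((p%:R + c * (if p then -1 else 1)) *: sv s + q%:R *: sv t0).
    rewrite -yE yc YE H1 sgn; by apply/rowP => l; rewrite !mxE; ring.
  move=> e1; have [hp hq] := sv_coord Tt r e1; exists u'.
  have q0 : q = false by case: (q) hq => //= /eqP; rewrite eq_sym oner_eq0.
  rewrite q0 scale0r addr0 in YE.
  move: r2; rewrite H1 YE; case: (p) => /=; last by rewrite scale0r addr0.
  rewrite scale1r => /rep_flip; by rewrite snegK sv_neg addrK.
have : X + (1 / 2 *: sv s + 0 *: sv t0) =
    X + (p%:R *: sv s + (q%:R + c * (if q then -1 else 1)) *: sv t0).
  by rewrite -yE yc YE H2 sgn; apply/rowP => l; rewrite !mxE; ring.
by move=> e1; have [H _] := sv_coord Tt r e1; exfalso; move: H; case: (p) => /=; lra.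
Qed.

(** Vertices are connected by edges: along the segment from one vertex to another, the
    property passes from tile to tile, since tiles sharing a point share a vertex. *)
Lemma vertex_induction (D : 'rV[R]_2 -> Prop) x0 : vertex v T x0 -> D x0 ->
  (forall s X, sedge v T s X -> D X -> D (X + sv s)) ->
  forall y, vertex v T y -> D y.
Proof.
move=> vx0 Dx0 step y vy.
have corners tau s t X : T tau -> rep v tau s t X -> D X ->
    forall s' t' X', rep v tau s' t' X' -> D X'.
  move=> Tt r DX s' t' X' /(rep_cases r)[p [q [-> _]]].
  have sf : sface v T s t X by exists tau.
  have [e1 _] := sface_edge sf; have [e2 e3] := sface_edge (sface_sym sf).
  case: p q => [] []; rewrite ?scale0r ?scale1r ?addr0 ?add0r ?addrA//; last 2 first.
  - exact: step.
  - exact: step.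
  by apply: (step t _ e3); exact: step.
have share tau tau' y0 : T tau -> T tau' -> tile_set v tau y0 -> tile_set v tau' y0 ->
    (forall s t X, rep v tau s t X -> D X) -> forall s t X, rep v tau' s t X -> D X.
  move=> Tt Tt' yt yt' Dt s t X r'.
  case: (tiles_meet Tt Tt' yt yt') => [e|[v1 v2]|[i [u [u' [Y [r1 r2 _]]]]]].
  - by rewrite -e in r'; exact: (Dt s t).
  - have corner_rep tau0 : tile_vertex v tau0 y0 -> exists s0 t0, rep v tau0 s0 t0 y0.
      move=> h; have : vertex v [set tau0] y0 by exists tau0.
      by move=> /vertex_sface[s0 [t0 [_ -> h0]]]; exists s0, t0.
    have [s1 [t1 r1]] := corner_rep _ v1; have [s2 [t2 r2]] := corner_rep _ v2.
    exact: (corners _ _ _ _ Tt' r2 (Dt _ _ _ r1) _ _ _ r').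
  exact: (corners _ _ _ _ Tt' r2 (Dt _ _ _ r1) _ _ _ r').
pose P u := forall tau, T tau -> tile_set v tau (x0 + u *: (y - x0)) ->
  forall s t X, rep v tau s t X -> D X.
have here X s t : rep v _ s t X -> on_face v s t X X.
  by move=> _; exists 0, 0; split; rewrite ?lexx ?ler01// !scale0r !addr0.
suff P1 : P 1.
  have [s [t [tau Tt r]]] := vertex_sface vy.
  apply: (P1 tau Tt _ _ _ _ r); rewrite scale1r addrC subrK.
  by apply/(rep_set r); exact: here r.
apply: (@real_induction R P 1) => //.
- have [s [t [tau Tt r]]] := vertex_sface vx0.
  move=> tau' Tt'; rewrite scale0r addr0 => h'.
  apply: (share tau tau' x0) => //; first by apply/(rep_set r); exact: here r.
  exact: (corners _ _ _ _ Tt r).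
- move=> u u0 u1 Pu.
  have [s [t [X [e [[tau Tt r] e0 he]]]]] := sector (x0 + u *: (y - x0)) (y - x0).
  have D0 : forall s t X, rep v tau s t X -> D X.
    apply: Pu => //; apply/(rep_set r).
    by have := he 0 (lexx _) (ltW e0); rewrite scale0r addr0.
  exists e => // u' uu' u'e tau' Tt' h'.
  apply: (share tau tau' _ Tt Tt' _ h' D0); apply/(rep_set r).
  have := he (u' - u) ltac:(lra) ltac:(lra).
  by rewrite -addrA -scalerDl subrKC.
move=> u u0 u1 Pu.
have [s [t [X [e [[tau Tt r] e0 he]]]]] := sector (x0 + u *: (y - x0)) (- (y - x0)).
have [d [d0 de du]] : exists d, [/\ 0 < d, d <= e & d <= u].
  by exists (Num.min e u); rewrite lt_min e0 u0 !ge_min !lexx orbT.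
have D0 : forall s t X, rep v tau s t X -> D X.
  apply: (Pu (u - d)) => //; [lra|lra|].
  apply/(rep_set r); have := he d (ltW d0) de.
  by rewrite scalerN -scaleNr -addrA -scalerDl.
move=> tau' Tt' h'.
apply: (share tau tau' _ Tt Tt' _ h' D0); apply/(rep_set r).
by have := he 0 (lexx _) (ltW e0); rewrite scale0r addr0.
Qed.
End Tilings.

(** * Monotonicity of the lift and ribbons *)

Section Ribbons.
Variables (R : realType) (m : nat) (v : 'I_m -> 'rV[R]_2) (eps : R).
Hypotheses (hv : edge_vectors v) (eps_neq0 : eps != 0).
Local Notation ar := (area eps).
Local Notation sv := (svec v).
Local Notation es := (@es R m).
Implicit Types (s t : sidx m) (X y w : 'rV[R]_2).
Variable T : set (@tile R m).
Hypothesis hT : rhombus_tiling v T.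
Variable L : 'rV[R]_2 -> 'rV[R]_m.
Hypothesis hL : is_lift v T L.

Definition signed_coord s (f : 'rV[R]_m) : R := sgb R s.2 * f 0 s.1.

Lemma signed_coordD s f g : signed_coord s (f + g) = signed_coord s f + signed_coord s g.
Proof. by rewrite /signed_coord mxE mulrDr. Qed.
Lemma signed_coordZ s a f : signed_coord s (a *: f) = a * signed_coord s f.
Proof. by rewrite /signed_coord mxE mulrCA. Qed.
Lemma signed_coord_comb s f a g b h : signed_coord s (f + (a *: g + b *: h)) = signed_coord s f +
  (a * signed_coord s g + b * signed_coord s h).
Proof. by rewrite !signed_coordD !signed_coordZ. Qed.
Lemma signed_coord_neg s f : signed_coord (sneg s) f = - signed_coord s f.
Proof. by rewrite /signed_coord sgb_neg mulNr. Qed.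

Lemma signed_coord_es s t : signed_coord s (es t) =
  if s.1 == t.1 then (if s.2 == t.2 then 1 else -1) else 0.
Proof.
case: s t => i b [j c]; rewrite /signed_coord /es /e_ !mxE /=.
case: eqP => // _; last by rewrite mulr0n !mulr0.
by case: b c => [] []; rewrite /sgb /=; ring.
Qed.

Lemma signed_coord_es_other s t : s.1 != t.1 -> signed_coord s (es t) = 0.
Proof. by rewrite signed_coord_es => /negPf ->. Qed.
Lemma signed_coord_es_same s : signed_coord s (es s) = 1.
Proof. by rewrite signed_coord_es !eqxx. Qed.

Lemma lift_faces : commutes_with_faces v L T.
Proof. exact: hL.2. Qed.

(** The lift extended affinely to each tile; [lf] is the graph of the resulting map. *)
Definition lfrep s t X y f := exists a b : R, [/\ 0 <= a <= 1, 0 <= b <= 1,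
  y = X + (a *: sv s + b *: sv t) & f = L X + (a *: es s + b *: es t)].

Definition lf y f := exists s t X, sface v T s t X /\ lfrep s t X y f.

Lemma lfrep_change tau s t X s' t' X' y f : T tau -> rep v tau s t X ->
  rep v tau s' t' X' -> lfrep s t X y f -> lfrep s' t' X' y f.
Proof.
move=> Tt r r'.
have [p [q [eX H]]] := rep_cases r r'.
have := rep_lift lift_faces Tt r p q; rewrite -eX => LX'.
move=> [a [b [ha hb yE fE]]].
pose a' := if p then 1 - a else a; pose b' := if q then 1 - b else b.
have ha' : 0 <= a' <= 1 by rewrite /a'; case: (p) => //; lra.
have hb' : 0 <= b' <= 1 by rewrite /b'; case: (q) => //; lra.
have E (V : lmodType R) (S1 S2 : V) : a *: S1 + b *: S2 =
    p%:R *: S1 + q%:R *: S2 +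
    (a' *: (if p then - S1 else S1) + b' *: (if q then - S2 else S2)).
  have aux (k : R) (S : V) (p0 : bool) : p0%:R *: S +
      (if p0 then 1 - k else k) *: (if p0 then - S else S) = k *: S.
    case: p0; rewrite /= ?scale0r ?add0r// scale1r scalerN scalerBl scale1r opprB.
    by rewrite addrC subrK.
  by rewrite addrACA /a' /b' !aux.
have sgnv p0 s0 : (if p0 then - sv s0 else sv s0) = sv (if p0 then sneg s0 else s0).
  by case: p0; rewrite ?sv_neg.
have sgne p0 s0 : (if p0 then - es s0 else es s0) = es (if p0 then sneg s0 else s0).
  by case: p0; rewrite ?es_neg.
have Ey := E _ (sv s) (sv t); have Ef := E _ (es s) (es t).
rewrite !sgnv in Ey; rewrite !sgne in Ef.
case: H => -[-> ->]; [exists a', b'|exists b', a']; split => //.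
- by rewrite yE Ey addrA eX.
- by rewrite fE Ef addrA LX'.
- by rewrite yE Ey addrA eX [b' *: _ + _]addrC.
- by rewrite fE Ef addrA LX' [b' *: _ + _]addrC.
Qed.

Lemma lfrep_val tau s t X a b y f : T tau -> rep v tau s t X ->
  y = X + (a *: sv s + b *: sv t) -> lfrep s t X y f ->
  f = L X + (a *: es s + b *: es t).
Proof.
move=> Tt r -> [a' [b' [_ _ e ->]]].
by have [-> ->] := sv_coord hv eps_neq0 hT Tt r e.
Qed.

Lemma lf_fun y f f' : lf y f -> lf y f' -> f = f'.
Proof.
move=> [s [t [X [[tau Tt r] h]]]] [s' [t' [X' [[tau' Tt' r'] h']]]].
have yt : tile_set v tau y.
  by apply/(rep_set r); case: h => a [b [? ? ? ?]]; exists a, b.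
have yt' : tile_set v tau' y.
  by apply/(rep_set r'); case: h' => a [b [? ? ? ?]]; exists a, b.
case: (tiles_meet hv eps_neq0 hT Tt Tt' yt yt') => [e|[]|].
- rewrite -e in r'; have := lfrep_change Tt r' r h'.
  case: h => a [b [_ _ yE ->]] h2.
  by rewrite (lfrep_val Tt r yE h2).
- move=> /(rep_vertex r)[p [q yE]] /(rep_vertex r')[p' [q' yE']].
  rewrite (lfrep_val Tt r yE h) (lfrep_val Tt' r' yE' h').
  by rewrite -(rep_lift lift_faces Tt r) -(rep_lift lift_faces Tt' r') -yE -yE'.
move=> [i [u [u' [Y [r1 r2 [c _ yE]]]]]].
rewrite -(sv_pos v) in yE.
have yE1 t0 : y = Y + (c *: sv (i, false) + 0 *: sv t0) by rewrite scale0r addr0.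
rewrite (lfrep_val Tt r1 (yE1 u) (lfrep_change Tt r r1 h)).
rewrite (lfrep_val Tt' r2 (yE1 u') (lfrep_change Tt' r' r2 h')).
by rewrite !scale0r.
Qed.

Lemma on_face_lf s t X y : sface v T s t X -> on_face v s t X y ->
  exists f, lfrep s t X y f /\ lf y f.
Proof.
move=> h [a [b [ha hb e]]]; exists (L X + (a *: es s + b *: es t)).
have H : lfrep s t X y (L X + (a *: es s + b *: es t)) by exists a, b.
by split => //; exists s, t, X.
Qed.

(** Inside one tile, a move by [d] along the direction [s] changes the [s]-coordinate of
    the lift by [d] if [s] is a direction of this tile, and by 0 otherwise. *)
Lemma line_in_face s s' t' X y1 y2 f1 f2 d : sface v T s' t' X ->
  lfrep s' t' X y1 f1 -> lfrep s' t' X y2 f2 -> y2 = y1 + d *: sv s ->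
  signed_coord s f2 = signed_coord s f1 + (if (s.1 == s'.1) || (s.1 == t'.1) then d else 0).
Proof.
move=> sf [a1 [b1 [_ _ -> ->]]] [a2 [b2 [_ _ -> ->]]] e.
have ne := sface_neq hT sf; have [tau Tt r] := sf.
have key : (a2 - a1) *: sv s' + (b2 - b1) *: sv t' = d *: sv s.
  apply: (addrI (X + (a1 *: sv s' + b1 *: sv t'))); rewrite -e.
  by apply/rowP => l; rewrite !mxE; ring.
rewrite !signed_coord_comb.
have sgn t0 : s.1 = t0.1 -> d *: sv s = (d * signed_coord s (es t0)) *: sv t0 /\ signed_coord s
  (es t0) ^+ 2 = 1.
  case: (s) t0 => i b [j c] /= ->; rewrite signed_coord_es eqxx /svec /=.
  by case: b c => [] []; split; rewrite /sgb /= ?scalerA; try congr (_ *: _); ring.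
have coord a b : (a2 - a1) *: sv s' + (b2 - b1) *: sv t' = a *: sv s' + b *: sv t' ->
    a2 - a1 = a /\ b2 - b1 = b.
  by apply: (@area_coord _ eps); exact: (area_sv_neq0 hv eps_neq0).
have [e1|n1] := eqVneq s.1 s'.1.
  have n2 : s.1 != t'.1 by rewrite e1.
  have [es1 q1] := sgn _ e1.
  have [|ha hb] := @coord (d * signed_coord s (es s')) 0; first by rewrite key es1 scale0r addr0.
  rewrite (signed_coord_es_other n2) /=.
  have -> : a2 = a1 + d * signed_coord s (es s') by lra.
  rewrite mulrDl -mulrA -expr2 q1; ring.
have [e1|n2] := eqVneq s.1 t'.1.
  have [es1 q1] := sgn _ e1.
  have [|ha hb] := @coord 0 (d * signed_coord s (es t')); first by rewrite key es1 scale0r add0r.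
  rewrite (signed_coord_es_other n1) /=.
  have -> : b2 = b1 + d * signed_coord s (es t') by lra.
  rewrite mulrDl -mulrA -expr2 q1; ring.
by rewrite (signed_coord_es_other n1) (signed_coord_es_other n2) /= !mulr0 !addr0.
Qed.

(** By [line_in_face] the [s]-coordinate does not decrease on small steps in the direction
    [s], and real induction extends this to the whole line. *)
Lemma signed_coord_monotone s y f d f' : lf y f -> 0 <= d -> lf (y + d *: sv s) f' ->
  signed_coord s f <= signed_coord s f'.
Proof.
move=> hf d0 hf'; pose P u := forall g, lf (y + u *: sv s) g ->
  signed_coord s f <= signed_coord s g.
suff : P d by apply.
apply: (@real_induction R P d) => // [g|u u0 ud Pu|u u0 ud Pu].
- by rewrite scale0r addr0 => /(lf_fun hf) ->.
- have [s' [t' [X [e [sf e0 he]]]]] := sector hv eps_neq0 hT (y + u *: sv s) (sv s).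
  have := he 0 (lexx _) (ltW e0); rewrite scale0r addr0.
  move=> /(on_face_lf sf)[g [rg /Pu hg]].
  exists e => // u' uu' u'e g' hg'.
  have /(on_face_lf sf)[g1 [rg1 hg1]] := he (u' - u) ltac:(lra) ltac:(lra).
  have E : y + u *: sv s + (u' - u) *: sv s = y + u' *: sv s.
    by rewrite -addrA -scalerDl subrKC.
  rewrite E in hg1; rewrite (lf_fun hg' hg1).
  rewrite (line_in_face sf rg rg1 erefl).
  by apply: le_trans hg _; case: ifP => _; lra.
have [s' [t' [X [e [sf e0 he]]]]] := sector hv eps_neq0 hT (y + u *: sv s) (- sv s).
have [k [k0 ke ku]] : exists k, [/\ 0 < k, k <= e & k <= u].
  by exists (Num.min e u); rewrite lt_min e0 u0 !ge_min !lexx orbT.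
have E : y + u *: sv s + k *: (- sv s) = y + (u - k) *: sv s.
  by rewrite scalerN -scaleNr -addrA -scalerDl.
have /(on_face_lf sf)[g [rg hg]] := he k (ltW k0) ke.
have := hg; rewrite {1}E => /(Pu (u - k) ltac:(lra) ltac:(lra)) fg g' hg'.
have := he 0 (lexx _) (ltW e0); rewrite scale0r addr0.
move=> /(on_face_lf sf)[g1 [rg1 /(lf_fun hg') ->]].
have E2 : y + u *: sv s = y + u *: sv s + k *: - sv s + k *: sv s.
  by rewrite scalerN addrNK.
rewrite (line_in_face sf rg rg1 E2).
by apply: le_trans fg _; case: ifP => _; lra.
Qed.

Lemma lift_int X : vertex v T X -> forall i, exists k : int, L X 0 i = k%:~R.
Proof.
have [x0 vx0 L0] := hL.1.
move: X; apply: (vertex_induction hv eps_neq0 hT vx0).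
  by move=> i; exists 0; rewrite L0 mxE.
move=> s X [t sf] IH i; have [k hk] := IH i.
have [-> _ _] := sface_lift lift_faces sf.
exists (k + (if s.1 == i then (if s.2 then -1 else 1) else 0)).
rewrite /e_ !mxE hk intrD /= [i == _]eq_sym.
by case: eqP => _; case: (s.2); rewrite /sgb /= ?mulr1 ?mulr0 ?mulN1r.
Qed.

Lemma signed_coord_int s X : vertex v T X -> exists k : int, signed_coord s (L X) = k%:~R.
Proof.
move=> /lift_int/(_ s.1)[k hk]; exists ((if s.2 then -1 else 1) * k).
by rewrite /signed_coord hk intrM; case: (s.2).
Qed.

(** The coordinate is stationary only in tiles without the direction [s], where it is an
    integer. *)
Lemma signed_coord_strict s y f d f' : lf y f -> 0 <= d -> lf (y + d *: sv s) f' ->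
  signed_coord s f = signed_coord s f' -> (forall k : int, signed_coord s f <> k%:~R) -> d = 0.
Proof.
move=> hf d0 hf' eqz nint; apply/eqP; rewrite eq_le d0 andbT leNgt; apply/negP => d1.
have [s' [t' [X [e [sf e0 he]]]]] := sector hv eps_neq0 hT y (sv s).
have := he 0 (lexx _) (ltW e0); rewrite scale0r addr0.
move=> /(on_face_lf sf)[g [rg hg]].
have [k [k0 ke kd]] : exists k, [/\ 0 < k, k <= e & k <= d].
  by exists (Num.min e d); rewrite lt_min e0 d1 !ge_min !lexx orbT.
have /(on_face_lf sf)[g1 [rg1 hg1]] := he k (ltW k0) ke.
have E : y + d *: sv s = y + k *: sv s + (d - k) *: sv s.
  by rewrite -addrA -scalerDl subrKC.
rewrite E in hf'; have := signed_coord_monotone hg1 _ hf'; move=> /(_ ltac:(lra)).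
rewrite (line_in_face sf rg rg1 erefl) -(lf_fun hf hg).
case: ifP => [_|]; first by rewrite eqz; lra.
move=> /negbT; rewrite negb_or => /andP[n1 n2] _.
have vX : vertex v T X.
  by have [e1 _] := sface_edge sf; have [] := sedge_vertex e1.
have [z hz] := signed_coord_int s vX; apply: (nint z); rewrite -hz (lf_fun hf hg).
case: rg => a [b [_ _ _ ->]].
by rewrite signed_coord_comb (signed_coord_es_other n1) (signed_coord_es_other n2) !mulr0 !addr0.
Qed.

(** A ribbon is a chain of adjacent tiles that all have the direction [s], crossed from
    edge to edge towards the positive side. *)
Inductive ribbon s : 'rV[R]_2 -> 'rV[R]_2 -> Prop :=
| ribbon_refl X : ribbon s X X
| ribbon_step X t Y : 0 < ar (sv s) (sv t) -> sface v T s t X ->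
    ribbon s (X + sv t) Y -> ribbon s X Y.

Lemma area_lower_bound : exists2 d, 0 < d &
  forall s t, s.1 != t.1 -> d <= `|ar (sv s) (sv t)|.
Proof.
pose S := \sum_i \sum_j `|ar (v i) (v j)|^-1.
have S0 : 0 <= S.
  by rewrite /S sumr_ge0// => k _; rewrite sumr_ge0// => l _; rewrite invr_ge0.
exists (1 + S)^-1 => [|s t st]; first by rewrite invr_gt0 ltr_pwDl.
have h := area_v_neq0 hv eps_neq0 st.
have -> : `|ar (sv s) (sv t)| = `|ar (v s.1) (v t.1)|.
  rewrite /svec areaZl areaZr !normrM.
  have n1 b : `|sgb R b| = 1 by case: b; rewrite /sgb ?normrN1 ?normr1.
  by rewrite !n1 !mul1r.
rewrite invf_ple ?posrE ?normr_gt0 ?ltr_pwDl//.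
rewrite /S (bigD1 s.1)//= (bigD1 t.1)//= addrCA -addrA lerDl.
rewrite !addr_ge0//; do ?[apply: sumr_ge0 => *]; by rewrite ?invr_ge0.
Qed.

(** Two [s]-edges at the same level of the lift lie on one ribbon. Follow the ribbon from
    [X] until it reaches the line parallel to [s] through [Y], which happens because areas
    have a positive minimum. The midpoints of both edges then lie on this line at the same
    half-integer level, where the lift is strictly monotone, hence they coincide. *)
Lemma ribbon_forward s X Y : sedge v T s X -> sedge v T s Y ->
  signed_coord s (L X) = signed_coord s (L Y) -> ar (sv s) X <= ar (sv s) Y -> ribbon s X Y.
Proof.
move=> eX eY zXY leXY; have [d d0 hd] := area_lower_bound.
have [N hN] : exists N : nat, ar (sv s) Y - ar (sv s) X < N%:R * d.
  exists (Num.bound ((ar (sv s) Y - ar (sv s) X) / d)).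
  by rewrite -ltr_pdivrMr//; apply: archi_boundP; rewrite divr_ge0 ?subr_ge0// ltW.
elim: N X eX zXY leXY hN => [|N IH] X eX zXY leXY hN; first by rewrite mul0r in hN; lra.
have [t st_gt0 sf] := next_face hv eps_neq0 hT eX.
have ne := sface_neq hT sf.
have [le1|lt1] := lerP (ar (sv s) (X + sv t)) (ar (sv s) Y).
  apply: (ribbon_step st_gt0 sf); apply: IH => //.
  - by have [] := sface_edge sf.
  - have [_ -> _] := sface_lift lift_faces sf.
    by rewrite signed_coordD (signed_coord_es_other ne) addr0.
  have := hd s t ne; rewrite gtr0_norm// => h.
  move: hN; rewrite areaDr -addn1 natrD mulrDl mul1r; lra.
pose la := (ar (sv s) Y - ar (sv s) X) / ar (sv s) (sv t).
have la0 : 0 <= la by rewrite divr_ge0 ?subr_ge0// ltW.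
have la1 : la < 1 by rewrite ltr_pdivrMr// mul1r; rewrite areaDr in lt1; lra.
pose A := Y + (1 / 2) *: sv s; pose B := X + ((1 / 2) *: sv s + la *: sv t).
have [t' sf'] := eY.
have hfB : lf B (L X + ((1 / 2) *: es s + la *: es t)).
  by exists s, t, X; split => //; exists (1 / 2), la; split => //; lra.
have hfA : lf A (L Y + (1 / 2) *: es s).
  exists s, t', Y; split => //; exists (1 / 2), 0; split; [lra|lra| |];
    by rewrite scale0r addr0.
have zA : signed_coord s (L Y + (1 / 2) *: es s) = signed_coord s (L Y) + 1 / 2.
  by rewrite signed_coordD signed_coordZ signed_coord_es_same mulr1.
have zB : signed_coord s (L X + ((1 / 2) *: es s + la *: es t)) = signed_coord s (L Y) + 1 / 2.
  by rewrite signed_coord_comb signed_coord_es_same (signed_coord_es_other ne) mulr1 mulr0 addr0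
    zXY.
have nint k : signed_coord s (L Y) + 1 / 2 <> k%:~R.
  have [vY _] := sedge_vertex eY; have [z ->] := signed_coord_int s vY => h.
  have : (2 * z + 1)%:~R = (2 * k)%:~R :> R by rewrite intrD !intrM -h; field.
  by move/intr_inj; lia.
have [u hu] : exists u, A = B + u *: sv s.
  exists (ar (A - B) (sv t) / ar (sv s) (sv t)).
  have {1}-> : A = B + (A - B) by rewrite subrKC.
  congr (_ + _); rewrite {1}(area_decomp eps_neq0 (A - B) (lt0r_neq0 st_gt0)).
  suff -> : ar (sv s) (A - B) = 0 by rewrite mul0r scale0r addr0.
  rewrite areaDr areaNr /A /B [in X in _ - X]areaDr area_comb [ar _ (Y + _)]areaDr.
  have -> : ar (sv s) (1 / 2 *: sv s) = 0 by rewrite areaZr areaxx mulr0.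
  by rewrite /la divfK ?lt0r_neq0//; lra.
have u0 : u = 0.
  have [u0|u0] := lerP 0 u.
    by apply: (signed_coord_strict hfB u0 (f' := L Y + (1 / 2) *: es s) (s := s));
      rewrite -?hu ?zA ?zB.
  have : - u = 0.
    apply: (signed_coord_strict hfA _ (f' := L X + ((1 / 2) *: es s + la *: es t)) (s := s));
      rewrite ?zA ?zB//; first by rewrite oppr_ge0 ltW.
    by rewrite hu -addrA -scalerDl subrr scale0r addr0.
  by move/eqP; rewrite oppr_eq0 => /eqP.
rewrite u0 scale0r addr0 in hu.
have [la00|la_gt0] := leP la 0; last first.
  exfalso; have [tau Tt r] := sf; have [tau' Tt' r'] := sf'.
  have hi : interior_face v s t X A.
    by rewrite hu; exists (1 / 2), la; split => //; [lra|apply/andP].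
  have AE : A = Y + ((1 / 2) *: sv s + 0 *: sv t') by rewrite scale0r addr0.
  have At' : tile_set v tau' A.
    by apply/(rep_set r'); exists (1 / 2), 0; split => //; lra.
  have ett' := interior_meet hv eps_neq0 hT Tt Tt' r hi At'; subst tau'.
  have [a [b [_ hb]]] := rep_interior r r' hi.
  rewrite AE => /(sv_coord hv eps_neq0 hT Tt' r')[_ b0].
  by rewrite -b0 ltxx in hb.
have la_eq0 : la = 0 by apply/le_anti/andP.
suff -> : X = Y by exact: ribbon_refl.
by move: hu; rewrite /A /B la_eq0 scale0r addr0 => /addIr.
Qed.

Lemma ribbon_total s X Y : sedge v T s X -> sedge v T s Y ->
  signed_coord s (L X) = signed_coord s (L Y) -> ribbon s X Y \/ ribbon s Y X.
Proof.
move=> eX eY e; have [h|/ltW h] := lerP (ar (sv s) X) (ar (sv s) Y).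
  by left; exact: ribbon_forward.
by right; exact: ribbon_forward.
Qed.

(** Every step [t] of a ribbon has positive area with [s], so it never is the opposite of
    a direction [r] on this side. *)
Lemma ribbon_mono s X Y : ribbon s X Y -> forall r, 0 < ar (sv s) (sv r) ->
  signed_coord r (L X) <= signed_coord r (L Y).
Proof.
elim=> [Z|Z t Y' st sf _ IH] r hr //.
apply: le_trans (IH r hr).
have [_ -> _] := sface_lift lift_faces sf; rewrite signed_coordD lerDl signed_coord_es.
case: ifP => // /eqP e1; case: ifP => // /eqP e2.
have e : r = sneg t.
  by case: r t e1 e2 {hr st sf IH} => i b [j c] /= -> ; rewrite /sneg /=; case: b c => [] [].
by move: hr; rewrite e sv_neg areaNr; lra.
Qed.

Lemma ribbon_anti s X Y : ribbon s X Y -> forall r, ar (sv s) (sv r) < 0 ->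
  signed_coord r (L Y) <= signed_coord r (L X).
Proof.
move=> h r hr; have := ribbon_mono h (r := sneg r).
by rewrite sv_neg areaNr oppr_gt0 !signed_coord_neg lerN2; apply.
Qed.
End Ribbons.

(** * Sums of coordinates along a triple of directions *)

(** Hypotheses about areas slow the linear integer arithmetic down. *)
Ltac int_lia :=
  repeat match goal with
  | H : is_true (~~ (fst _ == _)) |- _ => clear H
  | H : is_true (_ < area _ _ _) |- _ => clear H
  | H : is_true (area _ _ _ < _) |- _ => clear H
  | H : is_true (area _ _ _ != _) |- _ => clear H
  end; lia.

Section Triples.
Variables (R : realType) (m : nat) (v : 'I_m -> 'rV[R]_2) (eps : R).
Hypotheses (hv : edge_vectors v) (eps_neq0 : eps != 0).
Local Notation ar := (area eps).
Local Notation sv := (svec v).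
Local Notation es := (@es R m).
Implicit Types (r s t : sidx m) (X Y y w : 'rV[R]_2).
Variable T : set (@tile R m).
Hypothesis hT : rhombus_tiling v T.
Variable L : 'rV[R]_2 -> 'rV[R]_m.
Hypothesis hL : is_lift v T L.
Local Notation vertex := (vertex v T).
Local Notation sedge := (sedge v T).
Local Notation sface := (sface v T).
Local Notation ribbon := (ribbon v eps T).

Definition level s X : int := Num.floor (signed_coord s (L X)).

Lemma levelE s X : vertex X -> signed_coord s (L X) = (level s X)%:~R.
Proof. by move=> /(signed_coord_int hv eps_neq0 hT hL s)[k hk]; rewrite /level hk intrKfloor. Qed.

Lemma level_neg s X : vertex X -> level (sneg s) X = - level s X.
Proof.
by move=> vX; apply: (@intr_inj R); rewrite mulrNz -!levelE// signed_coord_neg.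
Qed.

Definition incr r s : int :=
  if r.1 == s.1 then (if r.2 == s.2 then 1 else -1) else 0.

Lemma level_step r s X : sedge s X -> level r (X + sv s) = level r X + incr r s.
Proof.
move=> e; have [v1 v2] := sedge_vertex e; have [t sf] := e.
apply: (@intr_inj R); rewrite intrD -!levelE//.
have [-> _ _] := sface_lift (lift_faces hL) sf.
rewrite signed_coordD signed_coord_es /incr; case: ifP => // _; by case: ifP.
Qed.

Lemma incr_same s : incr s s = 1. Proof. by rewrite /incr !eqxx. Qed.
Lemma incr_neg r s : incr r (sneg s) = - incr r s.
Proof.
rewrite /incr /sneg /=; case: eqP => // _.
by case: (r.2) (s.2) => [] [].
Qed.
Lemma incr_other r s : r.1 != s.1 -> incr r s = 0.
Proof. by rewrite /incr => /negPf ->. Qed.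

Lemma sidx_cases r s : r.1 = s.1 -> r = s \/ r = sneg s.
Proof.
case: r s => i b [j c] /= ->; rewrite /sneg /=.
by case: b c => [] []; [left|right|right|left].
Qed.

Lemma area_neq_idx s t : ar (sv s) (sv t) != 0 -> s.1 != t.1.
Proof.
move=> h; apply/negP => /eqP/sidx_cases[e|e]; move: h; rewrite e.
  by rewrite areaxx eqxx.
by rewrite sv_neg areaNl areaxx oppr0 eqxx.
Qed.

Lemma sedge_neg s X : sedge (sneg s) X -> sedge s (X - sv s).
Proof. by move=> /sedge_flip; rewrite snegK sv_neg. Qed.

(** Edges at the same level lie on one ribbon, along which all coordinates on the same
    side of [s] vary in the same sense. *)
Lemma edges_cmp s X Y : sedge s X -> sedge s Y -> level s X = level s Y ->
  ((forall r, 0 < ar (sv s) (sv r) -> level r X <= level r Y) /\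
   (forall r, ar (sv s) (sv r) < 0 -> level r Y <= level r X)) \/
  ((forall r, 0 < ar (sv s) (sv r) -> level r Y <= level r X) /\
   (forall r, ar (sv s) (sv r) < 0 -> level r X <= level r Y)).
Proof.
move=> eX eY e; have [vX _] := sedge_vertex eX; have [vY _] := sedge_vertex eY.
have : signed_coord s (L X) = signed_coord s (L Y) by rewrite !levelE// e.
move=> /(ribbon_total hv eps_neq0 hT hL eX eY)[] h; [left|right];
  split => r hr; rewrite -(ler_int R) -!levelE//.
- exact: ribbon_mono h r hr.
- exact: ribbon_anti h r hr.
- exact: ribbon_mono h r hr.
- exact: ribbon_anti h r hr.
Qed.

(** Along a ribbon the coordinate [r] changes by unit steps, each in a tile that has the
    directions [s] and [r]. *)
Lemma ribbon_crossing s r X Y (A : int) : sedge s X -> ribbon s X Y ->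
  s.1 != r.1 -> A < level r X -> level r Y <= A ->
  exists Z, [/\ sface s r Z, level r Z = A & level s Z = level s X].
Proof.
move=> + h ne; elim: h => [Z _|Z t Y' st sf rib IH eZ AZ YA]; first lia.
have [e1 e2] := sface_edge (sface_sym sf); have [eZ' e3] := sface_edge sf.
have zs' : level s (Z + sv t) = level s Z.
  by rewrite level_step// incr_other ?addr0//; exact: sface_neq sf.
have [h|h] := ltP A (level r (Z + sv t)).
  by have [W [h1 h2 h3]] := IH e3 h YA; exists W; rewrite h3 zs'.
have := level_step r e1; rewrite /incr.
case: eqP => [e4|_]; last by move=> H; exfalso; lia.
case: (sidx_cases e4) => e5; first by have -> : (r.2 == t.2) = true by [rewrite e5 eqxx];
  move=> H; exfalso; lia.
have -> : (r.2 == t.2) = false by rewrite e5 /=; case: (t.2).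
move=> H; exists (Z + sv t); split => //; last lia.
by rewrite e5; exact: sface_flip_r.
Qed.

Lemma edge_at_level s (u : int) X Y : vertex X -> vertex Y -> level s X <= u -> u < level s Y ->
  exists2 Z, sedge s Z & level s Z = u.
Proof.
move=> vX vY hX hY; apply: contrapT => none.
suff : level s Y <= u by lia.
move: Y vY {hY}; apply: (vertex_induction hv eps_neq0 hT vX hX) => t Z e hZ.
rewrite level_step// /incr; case: eqP => [e1|]; last lia.
case: (sidx_cases e1) => e2.
  2: by have -> : (s.2 == t.2) = false by [rewrite e2 /=; case: (t.2)]; lia.
rewrite e2 eqxx; rewrite e2 in hZ *; rewrite lezD1 lt_neqAle hZ andbT.
by apply/eqP => h; apply: none; exists Z; rewrite // e2.
Qed.

(** What a period [e_i - e_k] of the shadow on three directions means for the vertices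
    and for the edges in the middle direction: the coordinates [i] and [k] can be traded
    for each other while the coordinate [j] stays fixed. *)
Definition swing i j k := (forall X (n : int), vertex X -> exists X',
    [/\ vertex X', level i X' = level i X + n, level j X' = level j X & level k X' = level k X -
      n]) /\
  (forall X (n : int), sedge j X -> exists X',
    [/\ sedge j X', level i X' = level i X + n, level j X' = level j X & level k X' = level k X -
      n]).

Lemma swing_rev i j k : swing i j k -> swing k j i.
Proof.
move=> [h1 h2]; split=> X n; [move=> /(h1 X (- n))|move=> /(h2 X (- n))];
  by rewrite opprK => -[X' [a b c d]]; exists X'.
Qed.

Lemma swing_neg i j k : swing i j k -> swing (sneg i) (sneg j) (sneg k).
Proof.
move=> [h1 h2]; split=> X n hX.
  have [X' [vX' a b c]] := h1 X (- n) hX; exists X'.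
  by rewrite !level_neg// a b c; split => //; int_lia.
have [vX _] := sedge_vertex hX; have eX := sedge_neg hX.
have [X' [eX' a b c]] := h2 _ (- n) eX; exists (X' + sv j).
have [vX' vX2'] := sedge_vertex eX'.
have sub r : level r (X - sv j) = level r X - incr r j.
  by have := level_step r eX; rewrite subrK => ->; rewrite addrK.
rewrite !level_neg// !level_step// a b c !sub; split; [exact: sedge_flip|int_lia|lia|int_lia].
Qed.

(** Trade [i] for [k] at [Y] until the coordinate [i] falls just below that of [X]. By
    [edges_cmp] the coordinate [k] then cannot fall below that of [X], since [i] and [k]
    lie on opposite sides of [j]. *)
Lemma swing_edge_sum i j k X Y : swing i j k ->
  0 < ar (sv i) (sv j) -> 0 < ar (sv j) (sv k) ->
  sedge j X -> sedge j Y -> level j X = level j Y ->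
  level i X + level k X <= level i Y + level k Y + 1.
Proof.
move=> [_ sw] ij jk eX eY e.
have ji : ar (sv j) (sv i) < 0 by rewrite areaC oppr_lt0.
have [Z [eZ zi1 zj1 zk1]] := sw Y (level i X - 1 - level i Y) eY.
case: (@edges_cmp j X Z) => //; first by rewrite e zj1.
  by move=> [/(_ k jk) h _]; int_lia.
by move=> [_ /(_ i ji)]; int_lia.
Qed.

(** Swinging the edge [Y] makes the coordinate [i] take values on both sides of [A] on one
    ribbon, which then contains a tile with directions [i] and [j] at this level. *)
Lemma swing_corner i j k Y (A : int) : swing i j k ->
  ar (sv i) (sv j) != 0 -> sedge j Y ->
  exists Q, [/\ sface i j Q, level i Q = A & level j Q = level j Y].
Proof.
move=> [_ sw] ij eY; have ne : j.1 != i.1 by rewrite eq_sym; exact: area_neq_idx.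
have [Y1 [e1 a1 b1 _]] := sw Y (A - level i Y) eY.
have [Y2 [e2 a2 b2 _]] := sw Y (A + 1 - level i Y) eY.
have [v1 _] := sedge_vertex e1; have [v2 _] := sedge_vertex e2.
have zc12 : signed_coord j (L Y2) = signed_coord j (L Y1) by rewrite !levelE// b1 b2.
have rib := ribbon_total hv eps_neq0 hT hL e2 e1 zc12.
move: ij; rewrite neq_lt => /orP[ij|ij].
  have ji : 0 < ar (sv j) (sv i) by rewrite areaC oppr_gt0.
  case: rib => rib.
    have := ribbon_mono hL rib ji; rewrite !levelE// ler_int; int_lia.
  have h1 : - A - 1 < level (sneg i) Y1 by rewrite level_neg//; int_lia.
  have h2 : level (sneg i) Y2 <= - A - 1 by rewrite level_neg//; int_lia.
  have [Q [sQ Qi Qj]] := ribbon_crossing e1 rib (r := sneg i) ne h1 h2.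
  have eQ : sedge (sneg i) Q by have [] := sface_edge (sface_sym sQ).
  have [vQ _] := sedge_vertex eQ.
  have sQ' := sface_flip_r sQ; rewrite snegK in sQ'.
  exists (Q + sv (sneg i)); split; first exact: sface_sym.
    rewrite level_step// incr_neg incr_same; rewrite level_neg// in Qi; int_lia.
  by rewrite level_step// incr_other// Qj b1; int_lia.
have ji : ar (sv j) (sv i) < 0 by rewrite areaC oppr_lt0.
case: rib => rib; last first.
  have := ribbon_anti hL rib ji; rewrite !levelE// ler_int; int_lia.
have [Q [h1 h2 h3]] := @ribbon_crossing j i Y2 Y1 A e2 rib ne ltac:(int_lia) ltac:(int_lia).
by exists Q; split => //; [exact: sface_sym|rewrite h3].
Qed.

(** Suppose that a vertex at most as high as [Y] has a larger sum, and swing it so that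
    its coordinates [i] and [k] both exceed those of [Y] by the thresholds [A] and [B].
    The set of the vertices with coordinates [i >= A], [k >= B] and [j <= u] is then closed
    under all edges: an edge leaving it would be comparable to an edge of a tile given by
    [swing_corner] and contradict its coordinates. By connectedness it contains [Y]. *)
Lemma swing_stair i j k X Y : swing i j k ->
  0 < ar (sv i) (sv j) -> 0 < ar (sv j) (sv k) -> 0 < ar (sv i) (sv k) ->
  vertex X -> sedge j Y -> level j X <= level j Y ->
  level i X + level k X <= level i Y + level k Y + 2.
Proof.
move=> sw ij jk ik vX eY hj; rewrite leNgt; apply/negP => hs.
have [A AE] : exists A, A = level i Y + 1 by eexists.
have [B BE] : exists B, B = level k Y + 2 by eexists.
have [u uE] : exists u, u = level j Y by eexists.
have ne_ij : i.1 != j.1 by apply: area_neq_idx; rewrite gt_eqF.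
have ne_jk : j.1 != k.1 by apply: area_neq_idx; rewrite gt_eqF.
have ne_ik : i.1 != k.1 by apply: area_neq_idx; rewrite gt_eqF.
have ne_ji : j.1 != i.1 by rewrite eq_sym.
have ne_kj : k.1 != j.1 by rewrite eq_sym.
have ne_ki : k.1 != i.1 by rewrite eq_sym.
have ki : ar (sv k) (sv i) < 0 by rewrite areaC oppr_lt0.
have kj : ar (sv k) (sv j) < 0 by rewrite areaC oppr_lt0.
have [X' [vX' xi xj xk]] := sw.1 X (A - level i X) vX.
suff DY Z : vertex Z -> [/\ A <= level i Z, B <= level k Z & level j Z <= u].
  by have [vY _] := sedge_vertex eY; have [+ _ _] := DY Y vY; int_lia.
have DX' : [/\ A <= level i X', B <= level k X' & level j X' <= u].
  by split; [int_lia|int_lia|rewrite xj uE].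
move: Z; apply: (vertex_induction hv eps_neq0 hT vX' DX') => s Z eZ [Ai Bk uj].
have [vZ vZ'] := sedge_vertex eZ.
have [P PE] : exists P, P = Z + sv s by eexists.
have eP : sedge (sneg s) P by rewrite PE; exact: sedge_flip.
have stepE r : level r P = level r Z + incr r s by rewrite PE; exact: level_step.
have sumY W : sedge j W -> level j W = u -> level i W + level k W <= level i Y + level k Y + 1.
  by move=> eW e; apply: (swing_edge_sum sw) => //; rewrite e.
rewrite -PE !stepE.
have [si|si] := eqVneq i.1 s.1.
  have e1 : incr j s = 0 by apply: incr_other; rewrite -si eq_sym.
  have e2 : incr k s = 0 by apply: incr_other; rewrite -si eq_sym.
  rewrite e1 e2 !addr0; split => //.
  case: (sidx_cases si) => e3; first by rewrite -e3 incr_same (le_trans Ai)// lerDl.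
  have e4 : incr i s = -1 by rewrite -[s]snegK -e3 incr_neg incr_same.
  rewrite e4; rewrite leNgt; apply/negP => hA; rewrite -e3 in eP.
  have [Q [sQ Qi Qj]] := swing_corner (A - 1) sw (lt0r_neq0 ij) eY.
  rewrite -uE in Qj.
  have [eQ eQ'] := sface_edge sQ; have [eQj _] := sface_edge (sface_sym sQ).
  have := sumY Q eQj Qj; have := level_step j eQj; have := level_step k eQj.
  have := level_step i eQj; rewrite incr_same !incr_other// => q1 q2 q3 q4.
  have p1 := stepE i; have p2 := stepE j; have p3 := stepE k.
  rewrite e4 in p1; rewrite e1 in p2; rewrite e2 in p3.
  case: (@edges_cmp i P (Q + sv j) eP eQ'); first by int_lia.
    by move=> [/(_ k ik) h _]; int_lia.
  by move=> [/(_ j ij) h _]; int_lia.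
have [sk|sk] := eqVneq k.1 s.1.
  have e1 : incr j s = 0 by apply: incr_other; rewrite -sk.
  have e2 : incr i s = 0 by apply: incr_other; rewrite -sk.
  rewrite e1 e2 !addr0; split => //.
  case: (sidx_cases sk) => e3; first by rewrite -e3 incr_same (le_trans Bk)// lerDl.
  have e4 : incr k s = -1 by rewrite -[s]snegK -e3 incr_neg incr_same.
  rewrite e4; rewrite leNgt; apply/negP => hB; rewrite -e3 in eP.
  have [Q [sQ Qk Qj]] : exists Q, [/\ sface k j Q, level k Q = B - 1 & level j Q = u].
    have nkj : ar (sv k) (sv j) != 0 by rewrite lt_eqF.
    have [W [sW Wk Wj]] := swing_corner (B - 1) (swing_rev sw) nkj eY.
    by exists W; rewrite uE.
  have [eQ eQ'] := sface_edge sQ; have [eQj _] := sface_edge (sface_sym sQ).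
  have := sumY Q eQj Qj; have := level_step j eQj; have := level_step k eQj.
  have := level_step i eQj; rewrite incr_same !incr_other// => q1 q2 q3 q4.
  have p1 := stepE i; have p2 := stepE j; have p3 := stepE k.
  rewrite e2 in p1; rewrite e1 in p2; rewrite e4 in p3.
  case: (@edges_cmp k P (Q + sv j) eP eQ'); first by int_lia.
    by move=> [_ /(_ j kj) h]; int_lia.
  by move=> [_ /(_ i ki) h]; int_lia.
have [sj|sj] := eqVneq j.1 s.1; last first.
  by rewrite !incr_other// !addr0.
have e1 : incr i s = 0 by apply: incr_other; rewrite -sj.
have e2 : incr k s = 0 by apply: incr_other; rewrite -sj eq_sym.
rewrite e1 e2 !addr0; split => //.
case: (sidx_cases sj) => e3; last first.
  by rewrite -[s]snegK -e3 incr_neg incr_same (le_trans _ uj)// gerDl.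
rewrite -e3 incr_same leNgt; apply/negP => hu; rewrite -e3 in eZ.
by have := sumY Z eZ; int_lia.
Qed.

Lemma edge_at_upper j Y : sedge j Y -> sedge (sneg j) (Y + sv j) /\
  level (sneg j) (Y + sv j) = - level j Y - 1 /\
  forall r, r.1 != j.1 -> level r (Y + sv j) = level r Y.
Proof.
move=> eY; have [_ vY'] := sedge_vertex eY; split; first exact: sedge_flip.
split=> [|r h]; first by rewrite level_neg// level_step// incr_same; int_lia.
by rewrite level_step// incr_other// addr0.
Qed.

(** This is [swing_stair] for the opposite directions. *)
Lemma swing_stair_lower i j k X Y : swing i j k ->
  0 < ar (sv i) (sv j) -> 0 < ar (sv j) (sv k) -> 0 < ar (sv i) (sv k) ->
  vertex X -> sedge j Y -> level j Y < level j X ->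
  level i Y + level k Y <= level i X + level k X + 2.
Proof.
move=> sw ij jk ik vX eY hj; have [e [ej er]] := edge_at_upper eY.
have [_ vY'] := sedge_vertex eY.
have := @swing_stair (sneg i) (sneg j) (sneg k) X _ (swing_neg sw) _ _ _ vX e.
rewrite !sv_neg !areaNl !areaNr !opprK ej !level_neg// => /(_ ij jk ik ltac:(int_lia)).
rewrite !er; first int_lia.
- by rewrite eq_sym area_neq_idx// gt_eqF.
- by rewrite area_neq_idx// gt_eqF.
Qed.

Lemma swing_negmid i j k : swing i j k -> swing k (sneg j) i.
Proof.
move=> /swing_neg[h1 h2]; split=> X n.
  move=> vX; have [X' [vX' a b c]] := h1 X n vX.
  by exists X'; rewrite !level_neg// in a b c *; split => //; int_lia.
move=> eX; have [X' [eX' a b c]] := h2 X n eX.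
have [vX _] := sedge_vertex eX; have [vX' _] := sedge_vertex eX'.
by exists X'; rewrite !level_neg// in a b c *; split => //; int_lia.
Qed.

(** If [i] and [k] are more than a half-turn apart, then [k], [- j], [i] satisfy the
    hypotheses of [swing_stair], and the monotonicity is reversed. *)
Lemma swing_stair_obtuse i j k X Y : swing i j k ->
  0 < ar (sv i) (sv j) -> 0 < ar (sv j) (sv k) -> ar (sv i) (sv k) < 0 ->
  vertex X -> sedge j Y ->
  (level j X <= level j Y -> level i Y + level k Y <= level i X + level k X + 2) /\
  (level j Y < level j X -> level i X + level k X <= level i Y + level k Y + 2).
Proof.
move=> sw ij jk ik vX eY; have [e [ej er]] := edge_at_upper eY.
have [vY vY'] := sedge_vertex eY.
have ki : 0 < ar (sv k) (sv i) by rewrite areaC oppr_gt0.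
have sw' := swing_negmid sw.
have kj : 0 < ar (sv k) (sv (sneg j)) by rewrite sv_neg areaNr areaC opprK.
have ji : 0 < ar (sv (sneg j)) (sv i) by rewrite sv_neg areaNl areaC opprK.
have ni : i.1 != j.1 by rewrite area_neq_idx// gt_eqF.
have nk : k.1 != j.1 by rewrite eq_sym area_neq_idx// gt_eqF.
split=> h.
  have := swing_stair_lower sw' kj ji ki vX e; rewrite ej level_neg// !er//.
  move=> /(_ ltac:(int_lia)); int_lia.
have := swing_stair sw' kj ji ki vX e; rewrite ej level_neg// !er//.
move=> /(_ ltac:(int_lia)); int_lia.
Qed.
End Triples.

(** * From shadow periods to swings *)

Section ShadowPeriods.
Variables (R : realType) (m : nat) (v : 'I_m -> 'rV[R]_2) (eps : R).
Hypotheses (hv : edge_vectors v) (eps_neq0 : eps != 0).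
Local Notation sv := (svec v).
Local Notation es := (@es R m).
Implicit Types (r s t : sidx m) (X Y y w : 'rV[R]_2).
Variable T : set (@tile R m).
Hypothesis hT : rhombus_tiling v T.
Variable L : 'rV[R]_2 -> 'rV[R]_m.
Hypothesis hL : is_lift v T L.
Local Notation vertex := (vertex v T).
Local Notation sedge := (sedge v T).
Local Notation sface := (sface v T).
Local Notation level := (level L).

Lemma es_coord_other s l : s.1 != l -> es s 0 l = 0.
Proof. by move=> h; rewrite /es /e_ !mxE [l == _]eq_sym (negPf h) andbF mulr0. Qed.

Lemma scaled_coord a s l : (a *: es s) 0 l = a * es s 0 l.
Proof. by rewrite mxE. Qed.

Lemma add3_coord (f g h : 'rV[R]_m) l : (f + (g + h)) 0 l = f 0 l + (g 0 l + h 0 l).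
Proof. by rewrite mxE [X in _ + X]mxE. Qed.

Lemma sub_coord (f g : 'rV[R]_m) l : (f - g) 0 l = f 0 l - g 0 l.
Proof. by rewrite !mxE. Qed.

Lemma signed_coord_eq s (f g : 'rV[R]_m) : f 0 s.1 = g 0 s.1 -> signed_coord s f = signed_coord s g.
Proof. by rewrite /signed_coord => ->. Qed.

Lemma coord_signed s (f : 'rV[R]_m) : f 0 s.1 = sgb R s.2 * signed_coord s f.
Proof. by rewrite /signed_coord mulrA sgb_sqr mul1r. Qed.

Lemma es_coord_same s : es s 0 s.1 = sgb R s.2.
Proof. by rewrite coord_signed signed_coord_es_same mulr1. Qed.

Lemma lifted_rep z : lifted T L z <-> exists tau s t X y,
  [/\ T tau, rep v tau s t X & lfrep v L s t X y z].
Proof.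
split=> [[x [i [j [Tt [a [b [ha hb e]]]]]]]|].
  exists (x, i, j), (i, false), (j, false), x, (x + (a *: sv (i, false) + b *: sv (j, false))).
  split=> //; first exact: rep_pos.
  by exists a, b; rewrite !es_pos.
move=> [[[x i] j] [s [t [X [y [Tt r h]]]]]].
have [a [b [ha hb _ e]]] :=
  lfrep_change hL Tt r (rep_pos v x i j) h.
by exists x, i, j; split => //; exists a, b; rewrite !es_pos in e.
Qed.

Lemma round_coefficient (S : pred 'I_m) s (a : R) : 0 <= a <= 1 ->
  (S s.1 -> exists n : int, a = n%:~R) ->
  exists p : bool, forall l, S l -> a * es s 0 l = p%:R * es s 0 l.
Proof.
move=> ha hS; exists (a == 1) => l Sl.
have [e|ne] := eqVneq s.1 l; last by rewrite es_coord_other// !mulr0.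
suff {1}-> : a = (a == 1)%:R :> R by [].
rewrite -e in Sl; have [n an] := hS Sl.
have : n = 0 \/ n = 1.
  have /andP[n0 n1] : 0 <= n <= 1 by rewrite -!(ler_int R) -an.
  by clear -n0 n1; lia.
rewrite an; case=> -> /=; last by rewrite eqxx.
by rewrite eq_sym oner_eq0.
Qed.

Lemma int_coefficient s t X (z : 'rV[R]_m) a b : s.1 != t.1 -> vertex X ->
  z = L X + (a *: es s + b *: es t) -> (exists n : int, z 0 s.1 = n%:~R) ->
  exists n : int, a = n%:~R.
Proof.
move=> st vX -> [n].
have [k hk] := lift_int hv eps_neq0 hT hL vX s.1.
rewrite add3_coord hk !scaled_coord es_coord_same [es t _ _]es_coord_other 1?eq_sym//.
rewrite mulr0 addr0 => h; exists ((if s.2 then -1 else 1) * (n - k)).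
rewrite intrM intrD mulrNz -h [_%:~R + _]addrC addrK.
by case: (s.2); rewrite /sgb /= ?mulrNz; ring.
Qed.

(** A point of the lifted surface whose coordinates in [S] are integers can be moved to a
    vertex of its face without changing these coordinates. *)
Lemma round_vertex (S : pred 'I_m) z : lifted T L z ->
  (forall l, S l -> exists n : int, z 0 l = n%:~R) ->
  exists2 X, vertex X & forall l, S l -> L X 0 l = z 0 l.
Proof.
move=> /lifted_rep[tau [s [t [X [y [Tt r [a [b [ha hb _ e]]]]]]]]] hS.
have st := rep_neq hT Tt r; have ts : t.1 != s.1 by rewrite eq_sym.
have sf : sface s t X by exists tau.
have [ex _] := sface_edge sf; have [vx _] := sedge_vertex ex.
have [p hp] := @round_coefficient S s a ha
  (fun Ss => int_coefficient st vx e (hS _ Ss)).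
have e' : z = L X + (b *: es t + a *: es s) by rewrite e [a *: _ + _]addrC.
have [q hq] := @round_coefficient S t b hb
  (fun Sj => int_coefficient ts vx e' (hS _ Sj)).
exists (X + (p%:R *: sv s + q%:R *: sv t)).
  by exists tau => //; apply/(rep_vertex r); exists p, q.
move=> l Sl; rewrite (rep_lift (lift_faces hL) Tt r) e.
by rewrite !add3_coord !scaled_coord hp// hq.
Qed.

Lemma rep_along x i j s : s.1 = i \/ s.1 = j ->
  exists t X, rep v (x, i, j) s t X.
Proof.
have pos := rep_pos v x i j; case: s => k b /= [->|->].
  case: b; last by exists (j, false), x.
  by exists (j, false), (x + sv (i, false)); exact: rep_flip pos.
case: b; last by exists (i, false), x; exact: rep_sym.
by exists (i, false), (x + sv (j, false)); exact: (rep_flip (rep_sym pos)).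
Qed.

(** The analogue of [round_vertex] for midpoints of edges: the half-integer coordinate [j]
    forces the face to have the direction [j]. *)
Lemma round_edge (S : pred 'I_m) j z (n : int) : lifted T L z ->
  signed_coord j z = n%:~R + 1 / 2 -> ~~ S j.1 ->
  (forall l, S l -> exists n : int, z 0 l = n%:~R) ->
  exists X, [/\ sedge j X, signed_coord j (L X) = n%:~R & forall l, S l -> L X 0 l = z 0 l].
Proof.
move=> /lifted_rep[tau [s [t [X [y [Tt r h]]]]]] zj Sj hS.
have halfN (k l : int) : k%:~R <> l%:~R + 1 / 2 :> R.
  move=> e; have : (2 * k)%:~R = (2 * l + 1)%:~R :> R.
    by rewrite intrD !intrM e; field.
  by move/intr_inj; clear; lia.
have [t' [X' r']] : exists t' X', rep v tau j t' X'.
  suff : j.1 = s.1 \/ j.1 = t.1.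
    move=> H; case: tau Tt r => [[x i] k] Tt r; apply: rep_along.
    case: H => ->; case: r => [[_ -> ->]|[_ -> ->]]; by [left|right].
  have [->|n1] := eqVneq j.1 s.1; first by left.
  have [->|n2] := eqVneq j.1 t.1; first by right.
  have sf : sface s t X by exists tau.
  have [ex _] := sface_edge sf; have [vx _] := sedge_vertex ex.
  have [k hk] := signed_coord_int hv eps_neq0 hT hL j vx.
  case: h => a [b [_ _ _ e]]; move: zj.
  by rewrite e signed_coord_comb !signed_coord_es_other// !mulr0 !addr0 hk => /halfN.
have [a [b [ha hb _ e]]] := lfrep_change hL Tt r r' h.
have jt := rep_neq hT Tt r'; have tj : t'.1 != j.1 by rewrite eq_sym.
have sf : sface j t' X' by exists tau.
have [ex ex'] := sface_edge sf; have [vx _] := sedge_vertex ex.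
have [k hk] := signed_coord_int hv eps_neq0 hT hL j vx.
have aE : k%:~R + a = n%:~R + 1 / 2.
  by rewrite -zj e signed_coord_comb signed_coord_es_same signed_coord_es_other// mulr0 mulr1
    addr0 hk.
have kn : k = n.
  have h1 : (k - n)%:~R < 1%:~R :> R by rewrite intrD mulrNz; lra.
  have h2 : (-1)%:~R < (k - n)%:~R :> R by rewrite intrD !mulrNz; lra.
  by move: h1 h2; rewrite !ltr_int; clear; lia.
have e' : z = L X' + (b *: es t' + a *: es j) by rewrite e [a *: _ + _]addrC.
have [q hq] := @round_coefficient S t' b hb
  (fun Sj => int_coefficient tj vx e' (hS _ Sj)).
exists (X' + q%:R *: sv t'); split.
- by case: (q); rewrite ?scale1r ?scale0r ?addr0.
- have := rep_lift (lift_faces hL) Tt r' false q; rewrite scale0r add0r => ->.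
  by rewrite signed_coord_comb signed_coord_es_same [signed_coord j (es
    t')]signed_coord_es_other// mul0r mulr0 !addr0 hk kn.
move=> l Sl; have := rep_lift (lift_faces hL) Tt r' false q.
rewrite scale0r add0r => ->; rewrite e !add3_coord !scaled_coord -hq//.
by rewrite es_coord_other ?mulr0//; apply: contraNneq Sj => ->.
Qed.

Lemma shadow_shift (i j k : 'I_m) (p z : 'rV[R]_m) (n : int) :
  period (shadow T L i j k) p -> lifted T L z ->
  exists2 z', lifted T L z' &
    forall l, l \in [:: i; j; k] -> z' 0 l = z 0 l + n%:~R * p 0 l.
Proof.
move=> per; have fwd z0 : lifted T L z0 -> exists2 z', lifted T L z' &
    forall l, l \in [:: i; j; k] -> z' 0 l = z0 0 l + p 0 l.
  move=> hz; have : shadow T L i j k (shadow_proj i j k z0 + p).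
    by rewrite -per; exists (shadow_proj i j k z0) => //; exists z0.
  move=> [z' hz' e]; exists z' => // l hl.
  by move/rowP/(_ l): e; rewrite !mxE hl.
have bwd z0 : lifted T L z0 -> exists2 z', lifted T L z' &
    forall l, l \in [:: i; j; k] -> z' 0 l = z0 0 l - p 0 l.
  move=> hz; have : shadow T L i j k (shadow_proj i j k z0) by exists z0.
  rewrite -{1}per => -[_ [z' hz' <-] e]; exists z' => // l hl.
  by move/rowP/(_ l): e; rewrite !mxE hl => <-; rewrite addrK.
case: n => n.
  elim: n z => [|n IH] z hz; first by exists z => // l _; rewrite mul0r addr0.
  have [z1 hz1 h1] := IH z hz; have [z2 hz2 h2] := fwd z1 hz1; exists z2 => // l hl.
  by rewrite h2// h1// intS intrD; ring.
elim: n z => [|n IH] z hz.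
  by have [z1 hz1 h1] := bwd z hz; exists z1 => // l hl; rewrite h1// NegzE mulrNz mulN1r.
have [z1 hz1 h1] := IH z hz; have [z2 hz2 h2] := bwd z1 hz1; exists z2 => // l hl.
have -> : Negz n.+1 = Negz n - 1 by rewrite !NegzE; clear; lia.
by rewrite h2// h1// intrD mulrNz; ring.
Qed.

(** Lift a vertex, or the midpoint of a [j]-edge, shift its shadow by a multiple of the
    period, and round the resulting point of the surface back to a vertex or an edge. *)
Lemma period_swing i j k (i' j' k' : 'I_m) :
  i.1 != j.1 -> j.1 != k.1 -> i.1 != k.1 ->
  [:: i'; j'; k'] =i [:: i.1; j.1; k.1] ->
  period (shadow T L i' j' k') (es i - es k) -> swing v T L i j k.
Proof.
move=> ij jk ik idx per.
have ji : j.1 != i.1 by rewrite eq_sym.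
have ki : k.1 != i.1 by rewrite eq_sym.
have kj : k.1 != j.1 by rewrite eq_sym.
have inI r : r \in [:: i; j; k] -> r.1 \in [:: i'; j'; k'].
  by rewrite idx !inE => /orP[/eqP ->|/orP[/eqP ->|/eqP ->]]; rewrite eqxx ?orbT.
have Ii : i \in [:: i; j; k] by rewrite !inE eqxx.
have Ij : j \in [:: i; j; k] by rewrite !inE eqxx orbT.
have Ik : k \in [:: i; j; k] by rewrite !inE eqxx !orbT.
have zcp r (z z' : 'rV[R]_m) (n : int) : r \in [:: i; j; k] ->
    (forall l, l \in [:: i'; j'; k'] -> z' 0 l = z 0 l + n%:~R * (es i - es k) 0 l) ->
    signed_coord r z' = signed_coord r z + n%:~R * signed_coord r (es i - es k).
  by move=> /inI hr h; rewrite /signed_coord h//; ring.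
have zpi : signed_coord i (es i - es k) = 1.
  by rewrite signed_coordD -es_neg signed_coord_es_same signed_coord_es_other//= addr0.
have zpj : signed_coord j (es i - es k) = 0.
  by rewrite signed_coordD -es_neg !signed_coord_es_other//= addr0.
have zpk : signed_coord k (es i - es k) = -1.
  by rewrite signed_coordD -es_neg signed_coord_es_other// add0r -[k in signed_coord k]snegK
    signed_coord_neg signed_coord_es_same.
have intp (f : 'rV[R]_m) l (n : int) : (exists a : int, f 0 l = a%:~R) ->
    exists a : int, f 0 l + n%:~R * (es i - es k) 0 l = a%:~R.
  move=> [a ->].
  have es_int q : exists b : int, es q 0 l = b%:~R.
    have [e|ne] := eqVneq q.1 l; last by exists 0; rewrite es_coord_other.
    by exists (if q.2 then -1 else 1); rewrite -e es_coord_same; case: (q.2).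
  have [b hb] := es_int i; have [c hc] := es_int k; exists (a + n * (b - c)).
  by rewrite sub_coord hb hc !(intrD, intrM, mulrNz).
split=> X n hX.
  have [ s0 [t0 sf]] := vertex_sface hX.
  have lX : lifted T L (L X).
    have [tau Tt r] := sf; apply/lifted_rep; exists tau, s0, t0, X, X; split => //.
    by exists 0, 0; rewrite !scale0r !addr0 lexx ler01.
  have [z' lz' hz'] := shadow_shift n per lX.
  have [l hl|X' vX' hX'] := @round_vertex (mem [:: i'; j'; k']) z' lz'.
    by rewrite hz'//; apply: intp; exact: (lift_int hv eps_neq0 hT hL hX).
  have moved r : r \in [:: i; j; k] ->
      (level r X')%:~R = (level r X)%:~R + n%:~R * signed_coord r (es i - es k).
    move=> hr; rewrite -!(levelE hv eps_neq0 hT hL)// -(zcp _ _ _ _ hr hz').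
    by apply: signed_coord_eq; apply: hX'; exact: inI.
  exists X'; split => //; apply: (@intr_inj R); rewrite moved//.
  - by rewrite zpi mulr1 intrD.
  - by rewrite zpj mulr0 addr0.
  - by rewrite zpk mulrN1 intrD mulrNz.
have [vX _] := sedge_vertex hX; have [t0 [tau Tt rp]] := hX.
have jt := rep_neq hT Tt rp.
pose z := L X + ((1 / 2) *: es j + 0 *: es t0).
have lz : lifted T L z.
  apply/lifted_rep; exists tau, j, t0, X, (X + ((1 / 2) *: sv j + 0 *: sv t0)).
  by split => //; exists (1 / 2), 0; split => //; lra.
have [z' lz' hz'] := shadow_shift n per lz.
have zE (l : 'I_m) : l != j.1 -> z 0 l = L X 0 l.
  by move=> hl; rewrite add3_coord !scaled_coord es_coord_other 1?eq_sym// mulr0 mul0r !addr0.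
have zcr q : q.1 != j.1 -> signed_coord q z = (level q X)%:~R.
  by move=> hq; rewrite -(levelE hv eps_neq0 hT hL)//; apply: signed_coord_eq; exact: zE.
have zcj : signed_coord j z = (level j X)%:~R + 1 / 2.
  by rewrite -(levelE hv eps_neq0 hT hL)// signed_coord_comb signed_coord_es_same mulr1 mul0r addr0.
pose S := [pred l | (l == i.1) || (l == k.1)].
have SI l : S l -> l \in [:: i'; j'; k'] /\ l != j.1.
  move=> /orP[/eqP ->|/eqP ->]; split => //; by [exact: inI|].
have [||l /SI[hl lj]|X' [eX' zX' hX']] := @round_edge S j z' (level j X) lz'.
- by rewrite (zcp _ _ _ _ Ij hz') zpj mulr0 addr0.
- by rewrite /= negb_or ji jk.
- by rewrite hz'//; apply: intp; rewrite zE//; exact: (lift_int hv eps_neq0 hT hL vX).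
have [vX' _] := sedge_vertex eX'.
have moved r : r \in [:: i; j; k] -> S r.1 ->
    (level r X')%:~R = (level r X)%:~R + n%:~R * signed_coord r (es i - es k).
  move=> hr Sr; have [_ rj] := SI _ Sr; rewrite -(zcr r rj) -(zcp _ _ _ _ hr hz').
  by rewrite -(levelE hv eps_neq0 hT hL)//; apply: signed_coord_eq; exact: hX'.
exists X'; split => //; apply: (@intr_inj R).
- by rewrite moved//= ?eqxx// zpi mulr1 intrD.
- by rewrite -(levelE hv eps_neq0 hT hL).
- by rewrite moved//= ?eqxx ?orbT// zpk mulrN1 intrD mulrNz.
Qed.
End ShadowPeriods.

(** * A dual sign lemma *)

Section DualDirection.
Variables (R : realType) (m : nat) (v u : 'I_m -> 'rV[R]_2) (eps : R).
Local Notation ar := (area eps).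
Local Notation det := (area 1).
Local Notation sv := (svec v).
Local Notation su := (svec u).
Implicit Types (s t : sidx m) (x y d : 'rV[R]_2).

Definition dot x y : R := x 0 0 * y 0 0 + x 0 1 * y 0 1.
Definition rot d : 'rV[R]_2 := \row_i (if i == 0 then - d 0 1 else d 0 0).

Lemma det_rot x d : det x (rot d) = dot x d.
Proof. by rewrite /area /dot /rot !mxE /=; ring. Qed.
Lemma dotDr x y d : dot x (y + d) = dot x y + dot x d.
Proof. by rewrite /dot !mxE; ring. Qed.
Lemma dotZr x a d : dot x (a *: d) = a * dot x d.
Proof. by rewrite /dot !mxE; ring. Qed.
Lemma dotNr x d : dot x (- d) = - dot x d.
Proof. by rewrite /dot !mxE; ring. Qed.
Lemma det_dot x y d : det x y * dot d d = det x d * dot y d - dot x d * det y d.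
Proof. by rewrite /area /dot; ring. Qed.

Lemma area_signed (w : 'I_m -> 'rV[R]_2) e s t : area e (svec w s) (svec w t) =
  sgb R s.2 * sgb R t.2 * area e (w s.1) (w t.1).
Proof. by rewrite /svec areaZl areaZr mulrA. Qed.

Hypothesis compat : forall i j, i != j -> 0 < ar (v i) (v j) * det (u i) (u j).
Hypothesis two_idx : forall i : 'I_m, exists j, i != j.

Lemma compat_signed s t : s.1 != t.1 -> 0 < ar (sv s) (sv t) * det (su s) (su t).
Proof.
move=> st; have := compat st; rewrite !area_signed.
by case: s t {st} => i [] [j []] /=; rewrite /sgb; lra.
Qed.

Lemma compat_gt0 s t : s.1 != t.1 -> (0 < ar (sv s) (sv t)) = (0 < det (su s) (su t)).
Proof.
move=> /compat_signed h; apply/idP/idP => h1; first by rewrite pmulr_rgt0 in h.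
by rewrite pmulr_lgt0 in h.
Qed.

Lemma det_su_neq0 s t : s.1 != t.1 -> det (su s) (su t) != 0.
Proof. by move=> /compat_signed h; apply: contraTneq h => ->; rewrite mulr0 ltxx. Qed.

(** If the vectors [v] and [u] are in the same cyclic order, then for each direction [d]
    some [eta] has, against the [v]'s, the signs that [d] has against the [u]'s. If [d] is
    parallel to some [u l0], take the corresponding multiple of [v l0]. Otherwise, among the
    signed vectors on the positive side of [d], take the difference of the two extremal
    ones in the cyclic order. *)
Lemma dual_direction d : d != 0 -> exists eta,
  forall s, (0 < det (su s) d -> 0 < ar (sv s) eta) /\
            (det (su s) d = 0 -> ar (sv s) eta = 0).
Proof.
move=> d0.
have [[l0 hl0]|none] := pselect (exists l0 : 'I_m, det (u l0) d = 0).
  have [l1 l01] := two_idx l0.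
  have h01 : det (u l0) (u l1) != 0.
    by have := @det_su_neq0 (l0, false) (l1, false) l01; rewrite !sv_pos.
  have [c dE] : exists c, d = c *: u l0.
    exists (det d (u l1) / det (u l0) (u l1)).
    by rewrite {1}(area_decomp (oner_neq0 R) d h01) hl0 mul0r scale0r addr0.
  have c0 : c != 0 by apply: contra_neq d0 => c0; rewrite dE c0 scale0r.
  exists (c *: v l0) => s; rewrite dE -(sv_pos u l0) -(sv_pos v l0).
  rewrite [area 1 _ (c *: _)]areaZr [area eps _ (c *: _)]areaZr.
  have [e|ne] := eqVneq s.1 l0.
    have z w : area 1 (svec w s) (svec w (l0, false)) = 0 by
      rewrite /svec /= e areaZl areaZr areaxx !mulr0.
    have z' : ar (sv s) (sv (l0, false)) = 0.
      by rewrite /svec /= e areaZl areaZr areaxx !mulr0.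
    by rewrite z z' !mulr0 ltxx.
  have h := @compat_signed s (l0, false) ne.
  split=> [h1|/eqP].
    have h2 : 0 < (c * ar (sv s) (sv (l0, false))) * (c * det (su s) (su (l0, false))).
      have -> : (c * ar (sv s) (sv (l0, false))) * (c * det (su s) (su (l0, false))) =
        c ^+ 2 * (ar (sv s) (sv (l0, false)) * det (su s) (su (l0, false))) by ring.
      by rewrite mulr_gt0// exprn_even_gt0.
    by rewrite pmulr_lgt0 in h2.
  by rewrite mulf_eq0 (negPf c0) /= (negPf (@det_su_neq0 s (l0, false) ne)).
have nz s : det (su s) d != 0.
  apply/negP => /eqP h; apply: none; exists s.1; apply/eqP.
  move/eqP: h; rewrite {1}/svec areaZl mulf_eq0.
  by rewrite (negPf (sgb_neq0 R s.2)).
have halves l : exists b, 0 < det (su (l, b)) d.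
  have := nz (l, false); rewrite neq_lt => /orP[h|h]; last by exists false.
  by exists true; rewrite -[su (l, true)]/(su (sneg (l, false))) sv_neg areaNl oppr_gt0.
have dd : 0 < dot d d.
  rewrite lt_neqAle; apply/andP; split; last by rewrite /dot addr_ge0// -expr2 sqr_ge0.
  apply: contra_neq d0 => h; move/esym/eqP: h; rewrite /dot -!expr2 paddr_eq0 ?sqr_ge0//.
  by rewrite !sqrf_eq0 => /andP[/eqP h0 /eqP h1]; apply: vec2P; rewrite mxE.
(* The cotangent of the angle from [d], which orders a half-plane. *)
pose g s := dot (su s) d / det (su s) d.
have gP s t : 0 < det (su s) d -> 0 < det (su t) d -> g s <= g t ->
    0 <= det (su s) (su t).
  move=> hs ht; rewrite /g ler_pdivrMr// mulrAC ler_pdivlMr// => h.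
  rewrite -(pmulr_lge0 _ dd) det_dot subr_ge0; lra.
have [[i _]|empty] := pselect (exists i : 'I_m, True); last first.
  by exists 0 => s; exfalso; apply: empty; exists s.1.
have [b hb] := halves i.
pose H := [pred s : 'I_m * bool | 0 < det (su s) d].
have Hi : H (i, b) by [].
have [smax Hmax gmax] := arg_maxP g Hi; have [smin Hmin gmin] := arg_minP g Hi.
exists (sv smax - sv smin) => s; split=> [hs|/eqP]; last by rewrite (negPf (nz s)).
have h1 : 0 <= det (su s) (su smax) by apply: gP => //; exact: gmax.
have h2 : 0 <= det (su smin) (su s) by apply: gP => //; exact: gmin.
have eq_idx t : 0 < det (su t) d -> s.1 = t.1 -> sv s = sv t.
  move=> ht e; case: (sidx_cases e) => [->//|e2]; move: hs.
  by rewrite e2 sv_neg areaNl oppr_gt0 ltNge ltW.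
have a1 : 0 <= ar (sv s) (sv smax) /\ (s.1 != smax.1 -> 0 < ar (sv s) (sv smax)).
  have [e|ne] := eqVneq s.1 smax.1; first by rewrite (eq_idx _ Hmax e) areaxx.
  have h : 0 < ar (sv s) (sv smax) by rewrite compat_gt0// lt_neqAle h1 eq_sym det_su_neq0.
  by split=> [|_ //]; exact: ltW.
have a2 : 0 <= ar (sv smin) (sv s) /\ (s.1 != smin.1 -> 0 < ar (sv smin) (sv s)).
  have [e|ne] := eqVneq s.1 smin.1; first by rewrite (eq_idx _ Hmin e) areaxx.
  have ne' : smin.1 != s.1 by rewrite eq_sym.
  have h : 0 < ar (sv smin) (sv s) by rewrite compat_gt0// lt_neqAle h2 eq_sym det_su_neq0.
  by split=> [|_ //]; exact: ltW.
rewrite areaDr areaNr [ar (sv s) (sv smin)]areaC opprK.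
case: a1 a2 => a1 a1' [a2 a2'].
have [e1|n1] := eqVneq s.1 smax.1; last by have := a1' n1; lra.
have [e2|n2] := eqVneq s.1 smin.1; last by have := a2' n2; lra.
exfalso; have [l sl] := two_idx s.1; have [bl hl] := halves l.
have k1 : 0 <= det (su (l, bl)) (su smax) by apply: gP => //; exact: gmax.
have k2 : 0 <= det (su smin) (su (l, bl)) by apply: gP => //; exact: gmin.
have same : su smin = su smax.
  have e : smin.1 = smax.1 by rewrite -e1.
  case: (sidx_cases e) => [->//|e3]; move: (Hmin : 0 < det (su smin) d).
  rewrite e3 sv_neg areaNl oppr_gt0 ltNge => /negP[]; exact/ltW/Hmax.
have ne : smax.1 != (l, bl).1 by rewrite /= -e1.
have := det_su_neq0 ne; rewrite -same; rewrite -same areaC in k1.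
move=> /negP[]; apply/eqP; lra.
Qed.
End DualDirection.

(** * Covering the plane by continuation *)

(** Intervals are uncountable. *)
Lemma avoid_countable (R : realType) (I : countType) (B : I -> R -> Prop) (a b : R) :
  (forall i s s', B i s -> B i s' -> s = s') -> a < b ->
  exists s, [/\ a < s, s < b & forall i, ~ B i s].
Proof.
move=> uniqB ab; apply: contrapT => none.
have bad s : exists i : option I, a < s -> s < b -> if i is Some i0 then B i0 s else False.
  have [[sa sb]|out] := pselect (a < s /\ s < b); last first.
    by exists None => sa sb; apply: out.
  apply: contrapT => h; apply: none; exists s; split => // i Bi.
  by apply: h; exists (Some i).
have [f hf] := choice bad.
have : countable [set` `]a, b[%R].
  apply/countable_injP; exists (pickle \o f) => s s'.
  rewrite !inE /= => /andP[sa sb] /andP[sa' sb'] /(pcan_inj pickleK) e.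
  have := hf s sa sb; have := hf s' sa' sb'; rewrite e.
  by case: (f s') => // i h1 h2; exact: uniqB h2 h1.
move=> /countable_lebesgue_measure0; rewrite lebesgue_measure_itv /= lte_fin ab.
rewrite -EFinD => -[] /eqP; rewrite subr_eq0 => /eqP e.
by rewrite e ltxx in ab.
Qed.

Section Cover.
Variables (R : realType) (m : nat) (v : 'I_m -> 'rV[R]_2) (eps : R).
Hypotheses (hv : edge_vectors v) (eps_neq0 : eps != 0).
Local Notation ar := (area eps).
Local Notation sv := (svec v).
Implicit Types (s t : sidx m) (X y w : 'rV[R]_2).
Variable T : set (@tile R m).
Hypothesis T_lt : forall x i j, T (x, i, j) -> (i < j)%N.
Hypothesis T_sep : forall x i j a b, T (x, i, j) ->
  T (x + (a *: v i + b *: v j), i, j) -> -1 < a < 1 -> -1 < b < 1 ->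
  a = 0 /\ b = 0.
Hypothesis T_next : forall s X, sedge v T s X ->
  exists2 t, 0 < ar (sv s) (sv t) & sface v T s t X.

Lemma small_step (a c : R) : 0 < a < 1 ->
  exists2 e, 0 < e & forall k, 0 <= k -> k <= e -> 0 <= a + k * c <= 1.
Proof.
move=> /andP[a0 a1].
have [d [d0 da da1]] : exists d, [/\ 0 < d, d <= a & d <= 1 - a].
  by exists (Num.min a (1 - a)); rewrite lt_min a0 subr_gt0 a1 !ge_min !lexx orbT.
have c1 : 0 < `|c| + 1 by rewrite ltr_wpDl.
exists (d / (`|c| + 1)); first by rewrite divr_gt0.
move=> k k0; rewrite ler_pdivlMr// mulrDr mulr1 => h.
have : `|k * c| <= d by rewrite normrM (ger0_norm k0); lra.
by rewrite ler_norml => /andP[h1 h2]; apply/andP; split; lra.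
Qed.

Lemma edge_forward s X a w : sedge v T s X -> 0 < a < 1 -> 0 <= ar (sv s) w ->
  exists2 e, 0 < e & forall k, 0 <= k -> k <= e -> covered v T (X + a *: sv s + k *: w).
Proof.
move=> eX ha hw; have [t st [tau Tt r]] := T_next eX.
have wE := area_decomp eps_neq0 w (lt0r_neq0 st).
set c1 := (X in X *: sv s) in wE; set c2 := (X in _ + X *: sv t) in wE.
have c20 : 0 <= c2 by rewrite divr_ge0// ltW.
have [e e0 he] := small_step c1 ha.
have c21 : 0 < c2 + 1 by rewrite ltr_wpDl.
exists (Num.min e (c2 + 1)^-1); first by rewrite lt_min e0 invr_gt0.
move=> k k0; rewrite le_min => /andP[ke]; rewrite -[_^-1]mul1r ler_pdivlMr// => kc.
exists tau => //; apply/(rep_set r); exists (a + k * c1), (k * c2); split.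
- exact: he.
- by rewrite mulr_ge0//=; lra.
- by rewrite {1}wE; apply/rowP => l; rewrite !mxE; ring.
Qed.

Lemma edge_forward_any s X a w : sedge v T s X -> 0 < a < 1 ->
  exists2 e, 0 < e & forall k, 0 <= k -> k <= e -> covered v T (X + a *: sv s + k *: w).
Proof.
move=> eX ha; have [h|h] := lerP 0 (ar (sv s) w); first exact: edge_forward.
have eX' := sedge_flip eX.
have [||e e0 he] := @edge_forward _ _ (1 - a) w eX'; first lra.
  by rewrite sv_neg areaNl oppr_ge0 ltW.
exists e => // k k0 ke; have := he k k0 ke.
congr (covered v T (_ + _)).
by rewrite sv_neg; apply/rowP => l; rewrite !mxE; ring.
Qed.

Lemma tile_forward tau y w : T tau -> tile_set v tau y -> ~ tile_vertex v tau y ->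
  exists2 e, 0 < e & forall k, 0 <= k -> k <= e -> covered v T (y + k *: w).
Proof.
case: tau => [[x i] j] Tt yt nv; have ij := T_neq T_lt Tt.
have sf : sface v T (i, false) (j, false) x.
  by exists (x, i, j) => //; exact: rep_pos.
have [ei ei'] := sface_edge sf; have [ej ej'] := sface_edge (sface_sym sf).
rewrite !sv_pos in ei' ej'.
case: yt => a [b [ha hb yE]].
have bnd (c : R) : 0 <= c <= 1 -> (0 < c < 1) \/ exists p : bool, c = p%:R.
  move=> /andP[]; rewrite le_eqVlt => /orP[/eqP <- _|c0].
    by right; exists false.
  rewrite le_eqVlt => /orP[/eqP ->|c1]; first by right; exists true.
  by left; rewrite c0 c1.
case: (bnd a ha) (bnd b hb) => [ha'|[p ap]] [hb'|[q bq]].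
- have wE := coE hv eps_neq0 w ij.
  have [e1 e10 h1] := small_step (coA v eps i j w) ha'.
  have [e2 e20 h2] := small_step (coB v eps i j w) hb'.
  exists (Num.min e1 e2); first by rewrite lt_min e10 e20.
  move=> k k0; rewrite le_min => /andP[k1 k2]; exists (x, i, j) => //.
  exists (a + k * coA v eps i j w), (b + k * coB v eps i j w).
  split; [exact: h1|exact: h2|].
  by rewrite yE {1}wE; apply/rowP => l; rewrite !mxE; ring.
- have -> : y = x + q%:R *: v j + a *: sv (i, false).
    by rewrite yE bq sv_pos -addrA [q%:R *: _ + _]addrC.
  apply: edge_forward_any => //.
  by case: (q); rewrite ?scale1r ?scale0r ?addr0.
- have -> : y = x + p%:R *: v i + b *: sv (j, false).
    by rewrite yE ap sv_pos -addrA.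
  apply: edge_forward_any => //.
  by case: (p); rewrite ?scale1r ?scale0r ?addr0.
by exfalso; apply: nv; exists p, q; rewrite yE ap bq.
Qed.

(** A locally finite set of tiles in which each edge continues to a tile on each of its
    sides covers the plane. Points [y + s *: r] arbitrarily close to [y] are joined to an
    interior point of a tile by a segment that avoids the countably many vertices; along
    such a segment covered points continue to covered points, and local finiteness gives
    the limits. *)
Lemma covers_plane (I : countType) (P : I -> 'rV[R]_2) : (exists tau, T tau) ->
  (forall X, vertex v T X -> exists i, X = P i) -> forall y, covered v T y.
Proof.
move=> [[[x i] j] Tt] vP y; have ij := T_neq T_lt Tt.
pose x0 := x + ((1 / 2) *: v i + (1 / 2) *: v j).
have x0t : tile_set v (x, i, j) x0 by exists (1 / 2), (1 / 2); split => //; lra.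
have x0v : ~ tile_vertex v (x, i, j) x0.
  move=> [p [q]] /addrI/(area_coord (area_v_neq0 hv eps_neq0 ij))[h _].
  by move: h; case: p => /=; lra.
have [->|yx0] := eqVneq y x0; first by exists (x, i, j).
pose r := rot (y - x0).
have dr : area 1 (y - x0) r != 0.
  rewrite det_rot /dot -!expr2 paddr_eq0 ?sqr_ge0// !sqrf_eq0.
  apply: contra_neqN yx0 => /andP[/eqP h0 /eqP h1].
  by apply/eqP; rewrite -subr_eq0; apply/eqP/vec2P; rewrite [RHS]mxE.
have [|tau [e [Tt' e0 he]]] := @covered_initial _ _ v eps hv eps_neq0 T T_lt T_sep y r; last first.
  by exists tau => //; have := he 0 (lexx _) (ltW e0); rewrite scale0r addr0.
move=> e e0.
pose B (k : I) (s : R) := P k <> x0 /\ area 1 (P k - x0) (y + s *: r - x0) = 0.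
have [|s [s0 se nB]] := @avoid_countable R I B 0 e _ e0.
  move=> k s s' [kx h1] [_ h2]; apply/eqP; rewrite -subr_eq0; apply/negP => /negP ss.
  have E (s1 : R) : area 1 (P k - x0) (y + s1 *: r - x0) =
      area 1 (P k - x0) (y - x0) + s1 * area 1 (P k - x0) r.
    by rewrite /area !mxE; ring.
  rewrite !E in h1 h2.
  have z1 : area 1 (P k - x0) r = 0.
    have : (s - s') * area 1 (P k - x0) r = 0 by lra.
    by move/eqP; rewrite mulf_eq0 (negPf ss) => /eqP.
  have z2 : area 1 (P k - x0) (y - x0) = 0 by rewrite z1 in h1; lra.
  apply: kx; apply/eqP; rewrite -subr_eq0; apply/eqP.
  rewrite (area_decomp (oner_neq0 R) (P k - x0) dr) z1 [area 1 (y - x0) (P k - x0)]areaC z2.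
  by rewrite oppr0 mul0r !scale0r addr0.
exists s; split => //; first exact: ltW.
pose w := y + s *: r - x0.
have w0 : w <> 0.
  move=> h; have : area 1 w r = 0 by rewrite h /area !mxE; ring.
  have -> : area 1 w r = area 1 (y - x0) r.
    have -> : w = (y - x0) + s *: r by rewrite /w addrAC.
    by rewrite areaDl areaZl areaxx mulr0 addr0.
  by move/eqP; rewrite (negPf dr).
suff : covered v T (x0 + 1 *: w) by rewrite scale1r /w addrC subrK.
apply: (@real_induction R (fun k => covered v T (x0 + k *: w)) 1) => //.
- by rewrite scale0r addr0; exists (x, i, j).
- move=> k k0 k1 ck.
  have [tau Tt' [ht nv]] : exists2 tau, T tau &
      tile_set v tau (x0 + k *: w) /\ ~ tile_vertex v tau (x0 + k *: w).
    have [kz|knz] := eqVneq k 0; first by exists (x, i, j) => //; rewrite kz scale0r addr0.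
    case: ck => tau Tt' ht; exists tau => //; split => // hvx.
    have [|l hl] := vP (x0 + k *: w); first by exists tau.
    apply: (nB l); split; rewrite -hl.
      move=> /eqP; rewrite -subr_eq0 addrAC subrr add0r scaler_eq0 (negPf knz) /=.
      by move/eqP.
    by rewrite addrAC subrr add0r -/w areaZl areaxx mulr0.
  have [e1 e10 h1] := tile_forward w Tt' ht nv.
  exists e1 => // k' kk' k'e; have := h1 (k' - k) ltac:(lra) ltac:(lra).
  by rewrite -[_ + _ + _]addrA -scalerDl subrKC.
move=> k k0 k1 ck.
have [|tau [e1 [Tt' e10 h1]]] := @covered_initial _ _ v eps hv eps_neq0 T T_lt T_sep (x0 + k *:
  w) (- w).
  move=> e1 e10; pose d := Num.min e1 k.
  have [d0 de dk] : [/\ 0 < d, d <= e1 & d <= k].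
    by rewrite /d lt_min e10 k0 !ge_min !lexx orbT.
  exists d; split => //; have := ck (k - d) ltac:(lra) ltac:(lra).
  by rewrite scalerN -scaleNr -[_ + _ + _]addrA -scalerDl.
by exists tau => //; have := h1 0 (lexx _) (ltW e10); rewrite scale0r addr0.
Qed.
End Cover.

(** * The staircase surface of a multigrid *)

Section Staircase.
Variable R : realType.
Implicit Types (a f : R).

Definition isint a := exists k : int, a = k%:~R.
(** The vertical segment of the staircase above an integer [a], and the point
    [Num.ceil a] above any other [a]. *)
Definition in_step a f := (Num.ceil a)%:~R <= f <= (Num.floor a)%:~R + 1.

Lemma in_step_int (k : int) f : in_step k%:~R f <-> k%:~R <= f <= k%:~R + 1.
Proof. by rewrite /in_step intrKceil intrKfloor. Qed.

Lemma in_step_nonint a f : ~ isint a -> in_step a f -> f = (Num.ceil a)%:~R.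
Proof.
move=> na /andP[h1 h2]; apply/le_anti; rewrite h1 andbT; apply: le_trans h2 _.
rewrite -[1]/(1%:~R) -intrD ler_int lezD1 -(ltr_int R).
apply: lt_le_trans (ceil_ge _); rewrite lt_neqAle floor_le andbT.
by apply/eqP => e; apply: na; exists (Num.floor a).
Qed.

Lemma nonint_ceil a : ~ isint a -> (Num.ceil a)%:~R - 1 < a < (Num.ceil a)%:~R.
Proof.
move=> na; apply/andP; split; first by have := ceilB1_lt a; rewrite intrB.
rewrite lt_neqAle ceil_ge andbT; apply/eqP => e.
by apply: na; exists (Num.ceil a).
Qed.

Lemma in_step_ceil a : in_step a (Num.ceil a)%:~R.
Proof.
rewrite /in_step lexx /= -[1]/(1%:~R) -intrD ler_int.
by rewrite ceil_le_int; exact/ltW/floorD1_gt.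
Qed.

Lemma in_step_lt a a' f f' : a < a' -> in_step a f -> in_step a' f' -> f <= f'.
Proof.
move=> aa' /andP[_ h1] /andP[h2 _]; apply: le_trans h1 (le_trans _ h2).
rewrite -[1]/(1%:~R) -intrD ler_int lezD1 -(ltr_int R).
by apply: le_lt_trans (floor_le _) (lt_le_trans aa' (ceil_ge _)).
Qed.

Lemma in_step_both a a' f : a < a' -> in_step a f -> in_step a' f -> f = (Num.ceil a')%:~R.
Proof.
move=> aa' h1 h2; apply/le_anti; rewrite (in_step_lt aa' h1 (in_step_ceil a')).
by case/andP: h2.
Qed.

Lemma in_step_below a (k : int) : k%:~R - 1 <= a <= k%:~R -> in_step a k%:~R.
Proof.
move=> /andP[h1 h2]; apply/andP; split.
  by rewrite ler_int ceil_le_int.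
by rewrite -lerBlDr -[1]/(1%:~R) -[_ - _]intrB ler_int floor_ge_int intrB.
Qed.
End Staircase.

Section Multigrid.
Variables (R : realType) (m : nat) (v u : 'I_m -> 'rV[R]_2) (eps : R) (q : 'I_m -> R).
Hypotheses (hv : edge_vectors v) (eps_neq0 : eps != 0).
Local Notation ar := (area eps).
Local Notation det := (area 1).
Local Notation sv := (svec v).
Local Notation su := (svec u).
Implicit Types (s t : sidx m) (x y d xi : 'rV[R]_2) (f g : 'rV[R]_m).
Hypothesis compat : forall i j, i != j -> 0 < ar (v i) (v j) * det (u i) (u j).
Hypothesis two_idx : forall i : 'I_m, exists j, i != j.

(** The lines of the multigrid in the direction [l] are the level sets of this height at
    the integers. *)
Definition offset_height l xi : R := dot (u l) xi + q l.
Local Notation th := offset_height.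

(* No three lines of different families meet, so the crossings are dual to rhombi. *)
Hypothesis generic : forall xi i j k, i != j -> j != k -> i != k ->
  isint (th i xi) -> isint (th j xi) -> isint (th k xi) -> False.

(** The points above [xi] of the union of the lifted tiles: a vertex for [xi] in a cell of
    the multigrid, an edge on a line, a face at a crossing. *)
Definition surface xi f := forall l, in_step (th l xi) (f 0 l).
(** The linear map sending the canonical basis to the edge vectors; it inverts the lift. *)
Definition to_plane f : 'rV[R]_2 := \sum_l f 0 l *: v l.

Lemma to_planeD f g : to_plane (f + g) = to_plane f + to_plane g.
Proof. by rewrite /to_plane -big_split; apply: eq_bigr => l _; rewrite mxE scalerDl. Qed.
Lemma to_planeZ a f : to_plane (a *: f) = a *: to_plane f.
Proof. by rewrite /to_plane scaler_sumr; apply: eq_bigr => l _; rewrite mxE scalerA. Qed.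
Lemma to_planeN f : to_plane (- f) = - to_plane f.
Proof. by rewrite -scaleN1r to_planeZ scaleN1r. Qed.

Lemma to_plane_two i j f : i != j -> (forall l, l != i -> l != j -> f 0 l = 0) ->
  to_plane f = f 0 i *: v i + f 0 j *: v j.
Proof.
move=> ij h; rewrite /to_plane (bigD1 i)//= (bigD1 j) 1?eq_sym//=.
by rewrite big1 ?addr0// => l /andP[li lj]; rewrite h// scale0r.
Qed.

Lemma to_plane_e i : to_plane (e_ i) = v i.
Proof.
rewrite /to_plane (bigD1 i)//= big1 ?addr0; first by rewrite /e_ mxE !eqxx scale1r.
by move=> l li; rewrite /e_ mxE (negPf li) andbF scale0r.
Qed.

Lemma to_plane_inj_two i j f : i != j -> (forall l, l != i -> l != j -> f 0 l = 0) ->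
  to_plane f = 0 -> f = 0.
Proof.
move=> ij h; rewrite (to_plane_two ij h) => e.
have [h1 h2] : f 0 i = 0 /\ f 0 j = 0.
  apply: (@area_coord _ eps (v i) (v j)); first exact: area_v_neq0.
  by rewrite e !scale0r addr0.
apply/rowP => l; rewrite [RHS]mxE.
by have [->//|li] := eqVneq l i; have [->//|lj] := eqVneq l j; exact: h.
Qed.

Lemma area_to_plane f d : ar (to_plane f) d = \sum_l f 0 l * ar (v l) d.
Proof.
rewrite /to_plane (big_morph (fun x => ar x d) (id1 := 0) (op1 := +%R)).
- by apply: eq_bigr => l _; rewrite areaZl.
- by move=> a b; rewrite areaDl.
- by rewrite /area !mxE; ring.
Qed.

Lemma det_two_zero i j d : i != j -> det (u i) d = 0 -> det (u j) d = 0 -> d = 0.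
Proof.
move=> ij h1 h2; have h := @det_su_neq0 _ _ v u eps compat (i, false) (j, false) ij.
rewrite !sv_pos in h; rewrite (area_decomp (oner_neq0 R) d h).
by rewrite h1 areaC h2 oppr0 !mul0r !scale0r addr0.
Qed.

Lemma rot_eq0 d : rot d = 0 -> d = 0.
Proof.
move=> /rowP h; have := h 0; have := h 1; rewrite !mxE /= => h0 /eqP.
by rewrite oppr_eq0 => /eqP h1; apply: vec2P; rewrite [RHS]mxE.
Qed.

Lemma dot_two_zero i j d : i != j -> dot (u i) d = 0 -> dot (u j) d = 0 -> d = 0.
Proof. by rewrite -!det_rot => ij h1 h2; apply/rot_eq0/(det_two_zero ij). Qed.

Lemma thD l xi d : th l (xi + d) = th l xi + dot (u l) d.
Proof. by rewrite /offset_height dotDr addrAC. Qed.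

(** The surface projects injectively to the plane. For distinct [xi] and [xi'] each
    coordinate of [f' - f] has the sign of the variation of the height, so that by
    [dual_direction] a linear form takes values of the same sign on all terms of
    [to_plane (f' - f)]; as their sum vanishes, at most one coordinate differs. *)
Lemma surface_inj xi xi' f f' : surface xi f -> surface xi' f' -> to_plane f = to_plane f' ->
  f = f'.
Proof.
move=> hf hf' eV; apply/eqP; rewrite -subr_eq0; apply/eqP.
have V0 : to_plane (f - f') = 0 by rewrite to_planeD to_planeN eV subrr.
have fE l : f 0 l = f' 0 l -> (f - f') 0 l = 0 by move=> e; rewrite !mxE e subrr.
have [exi|nxi] := eqVneq xi xi'.
  subst xi'.
  have eq_nonint l : ~ isint (th l xi) -> (f - f') 0 l = 0.
    by move=> h; apply: fE; rewrite (in_step_nonint h (hf l)) (in_step_nonint h (hf' l)).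
  have [[i hi]|none] := pselect (exists i, isint (th i xi)); last first.
    by apply/rowP => l; rewrite [RHS]mxE eq_nonint// => h; apply: none; exists l.
  have [[j [ij hj]]|none] := pselect (exists j, i != j /\ isint (th j xi)).
    apply: (to_plane_inj_two ij _ V0) => l li lj; apply: eq_nonint => hl.
    by apply: (generic (xi := xi) ij _ _ hi hj hl); rewrite eq_sym.
  have [j ij] := two_idx i.
  apply: (to_plane_inj_two ij _ V0) => l li lj; apply: eq_nonint => hl.
  by apply: none; exists l; rewrite eq_sym.
pose d := xi' - xi.
have d0 : d != 0 by rewrite subr_eq0 eq_sym.
have thE l : th l xi' = th l xi + dot (u l) d by rewrite -thD /d subrKC.
have [|eta heta] := @dual_direction _ _ v u eps compat two_idx (rot d).
  by apply: contra_neq d0; exact: rot_eq0.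
have terms l : 0 <= (f' - f) 0 l * ar (v l) eta.
  have [hp hz] := heta (l, false); have [hn _] := heta (l, true).
  rewrite !sv_pos det_rot in hp hz.
  rewrite -[(l, true)]/(sneg (l, false)) !sv_neg !sv_pos !areaNl det_rot in hn.
  rewrite mxE [X in _ + X]mxE; have [h|h|h] := ltgtP (dot (u l) d) 0.
  - have h1 : f' 0 l <= f 0 l by apply: (in_step_lt _ (hf' l) (hf l)); rewrite thE; lra.
    have h2 := hn ltac:(lra); rewrite -mulrNN; apply: mulr_ge0; lra.
  - have h1 : f 0 l <= f' 0 l by apply: (in_step_lt _ (hf l) (hf' l)); rewrite thE; lra.
    have h2 := hp h; apply: mulr_ge0; lra.
  - by rewrite (hz h) mulr0.
have sum0 : \sum_l (f' - f) 0 l * ar (v l) eta = 0.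
  rewrite -area_to_plane -opprB to_planeN V0 oppr0 /area !mxE; ring.
have z l : dot (u l) d != 0 -> (f - f') 0 l = 0.
  move=> h; have := psumr_eq0P (fun l _ => terms l) sum0 isT => /(_ l)/eqP.
  rewrite mulf_eq0 => /orP[/eqP e|/eqP e].
    by rewrite -opprB mxE e oppr0.
  have [hp _] := heta (l, false); have [hn _] := heta (l, true).
  rewrite !sv_pos det_rot in hp.
  rewrite -[(l, true)]/(sneg (l, false)) !sv_neg !sv_pos !areaNl det_rot in hn.
  exfalso; move: h; rewrite neq_lt => /orP[h|/hp]; last by rewrite e ltxx.
  by have := hn ltac:(lra); rewrite e oppr0 ltxx.
have [[l0 h0]|none] := pselect (exists l0, dot (u l0) d = 0); last first.
  apply/rowP => l; rewrite [RHS]mxE z//; apply/eqP => h; by apply: none; exists l.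
have [j l0j] := two_idx l0.
apply: (to_plane_inj_two l0j _ V0) => l ll0 lj; apply: z; apply: contra_neq d0 => h.
exact: dot_two_zero ll0 h h0.
Qed.

Definition crossing xi i j := [/\ i != j, isint (th i xi) & isint (th j xi)].
(** At a crossing this is the lower corner of the face above it. *)
Definition base xi : 'rV[R]_m := \row_l (Num.ceil (th l xi))%:~R.

Lemma crossing_sym xi i j : crossing xi i j -> crossing xi j i.
Proof. by move=> [? ? ?]; split; rewrite // eq_sym. Qed.

Lemma crossing_nonint xi i j l : crossing xi i j -> l != i -> l != j -> ~ isint (th l xi).
Proof.
move=> [ij hi hj] li lj hl; apply: (generic (xi := xi) ij _ _ hi hj hl);
  by rewrite eq_sym.
Qed.

Lemma baseE xi l : base xi 0 l = (Num.ceil (th l xi))%:~R.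
Proof. by rewrite mxE. Qed.

Lemma base_int xi l : isint (th l xi) -> base xi 0 l = th l xi.
Proof. by move=> [k e]; rewrite baseE e intrKceil. Qed.

Lemma coord_comb f i j a b l : (f + (a *: e_ i + b *: e_ j)) 0 l =
  f 0 l + (a * (l == i)%:R + b * (l == j)%:R) :> R.
Proof. by rewrite /e_ !mxE /=. Qed.

Lemma surface_crossing xi i j f : crossing xi i j -> (surface xi f <-> exists a b : R,
  [/\ 0 <= a <= 1, 0 <= b <= 1 & f = base xi + (a *: e_ i + b *: e_ j)]).
Proof.
move=> cr; have [ij [ki hi] [kj hj]] := cr; split=> [hf|[a [b [ha hb ->]]] l].
  exists (f 0 i - base xi 0 i), (f 0 j - base xi 0 j).
  have := hf i; have := hf j; rewrite hi hj !in_step_int => h1 h2.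
  rewrite !base_int ?hi ?hj; [|by exists kj|by exists ki]; split; [lra|lra|].
  apply/rowP => l; rewrite coord_comb.
  have [->|li] := eqVneq l i.
    rewrite (negPf ij) mulr0 addr0 mulr1 base_int ?hi; last by exists ki.
    by rewrite subrKC.
  have [->|lj] := eqVneq l j.
    by rewrite mulr0 mulr1 add0r base_int ?hj; [rewrite subrKC|exists kj].
  rewrite !mulr0 !addr0 baseE; apply: in_step_nonint; last exact: hf.
  exact: crossing_nonint cr li lj.
rewrite coord_comb; have [->|li] := eqVneq l i.
  rewrite (negPf ij) mulr0 mulr1 addr0 base_int; last by exists ki.
  by rewrite hi in_step_int; lra.
have [->|lj] := eqVneq l j.
  rewrite mulr0 mulr1 add0r base_int; last by exists kj.
  by rewrite hj in_step_int; lra.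
by rewrite !mulr0 !addr0 baseE; exact: in_step_ceil.
Qed.

(** The tiling dual to the multigrid, with one rhombus for each crossing. *)
Definition grid : set (@tile R m) := fun tau => let: (x, i, j) := tau in
  (i < j)%N /\ exists xi, crossing xi i j /\ x = to_plane (base xi).

Lemma to_plane_comb f i j a b : to_plane (f + (a *: e_ i + b *: e_ j)) = to_plane f + (a *: v i +
  b *: v j).
Proof. by rewrite !to_planeD !to_planeZ !to_plane_e. Qed.

Lemma tile_surface xi i j y : crossing xi i j ->
  (tile_set v (to_plane (base xi), i, j) y <-> exists2 f, surface xi f & to_plane f = y).
Proof.
move=> cr; split=> [[a [b [ha hb ->]]]|[f /(surface_crossing _ cr)[a [b [ha hb ->]]] <-]].
  exists (base xi + (a *: e_ i + b *: e_ j)); last exact: to_plane_comb.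
  by apply/(surface_crossing _ cr); exists a, b.
by rewrite to_plane_comb; exists a, b.
Qed.

(** The corner from which the signed directions point into the face is shifted from [base]
    by these vectors. *)
Definition corner_shift s : 'rV[R]_m := if s.2 then e_ s.1 else 0.

Lemma to_plane0 : to_plane 0 = 0.
Proof. by rewrite /to_plane big1// => l _; rewrite mxE scale0r. Qed.

Lemma corner_shiftK s : to_plane (corner_shift s) + corner v s = 0.
Proof.
rewrite /corner_shift /corner; case: s => i [] /=; last by rewrite to_plane0 addr0.
by rewrite to_plane_e -[(i, true)]/(sneg (i, false)) sv_neg sv_pos subrr.
Qed.

Lemma grid_sface xi s t : crossing xi s.1 t.1 ->
  sface v grid s t (to_plane (base xi + (corner_shift s + corner_shift t))).
Proof.
move=> cr; have [st _ _] := cr.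
have e : to_plane (base xi + (corner_shift s + corner_shift t)) + (corner v s + corner v t) =
  to_plane (base xi).
  by rewrite !to_planeD -addrA addrACA !corner_shiftK !addr0.
move: st; rewrite neq_ltn => /orP[lt|lt].
  exists (to_plane (base xi), s.1, t.1); last by left; rewrite e.
  by split => //; exists xi.
exists (to_plane (base xi), t.1, s.1); last by right; rewrite e.
by split => //; exists xi; split => //; exact: crossing_sym.
Qed.

Lemma sface_grid s t X : sface v grid s t X ->
  exists2 xi, crossing xi s.1 t.1 & X = to_plane (base xi + (corner_shift s + corner_shift t)).
Proof.
move=> [[[x i] j] [_ [xi [cr e]]] r]; exists xi.
  by case: r => -[_ <- <-] //; exact: crossing_sym.
have : X + (corner v s + corner v t) = to_plane (base xi) by rewrite -e; case: r => -[].
move=> h; apply: (addIr (corner v s + corner v t)); rewrite h !to_planeD.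
by rewrite -addrA addrACA !corner_shiftK !addr0.
Qed.
End Multigrid.

(** * Neighbouring crossings of a multigrid *)

Lemma interior_direction (R : realType) (B : set 'rV[R]_2) (y r : 'rV[R]_2) :
  interior B y -> exists2 e, 0 < e & B (y + e *: r).
Proof.
move=> /nbhs_ballP[e /= e0 he].
pose c := e / 2 / (`|r 0 0| + `|r 0 1| + 1).
have d0 : 0 < `|r 0 0| + `|r 0 1| + 1 by rewrite ltr_wpDl// addr_ge0.
have c0 : 0 < c by rewrite !divr_gt0.
exists c => //; apply: he; split => // i j.
rewrite /ball /= !mxE opprD addrA subrr add0r normrN normrM (gtr0_norm c0).
have lt_c k : k <= `|r 0 0| + `|r 0 1| -> c * k < e.
  move=> hk; apply: (@le_lt_trans _ _ (e / 2)); last lra.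
  rewrite /c mulrAC ler_pdivrMr// ler_pM2l; [lra|lra].
have -> : i = 0 by apply/val_inj; case: i => -[].
apply: lt_c; case: j => -[|[|//]] hj.
  by rewrite (_ : Ordinal hj = 0) ?lerDl//; exact: val_inj.
by rewrite (_ : Ordinal hj = 1) ?lerDr//; exact: val_inj.
Qed.

Lemma interior_not_segment (R : realType) (B : set 'rV[R]_2) (y X w : 'rV[R]_2) :
  w != 0 -> interior B y -> ~ (B `<=` segment X w).
Proof.
move=> w0 hy sub; have By : B y by exact: interior_subset.
have [e e0 he] := interior_direction (rot w) hy.
have [a _ ea] := sub _ By; have [b _ eb] := sub _ he.
have : e *: rot w = (b - a) *: w.
  apply: (addrI y); rewrite eb ea scalerBl -addrA; congr (_ + _).
  by rewrite addrC subrK.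
move=> /(congr1 (area 1 w)); rewrite !areaZr areaxx mulr0 det_rot => /eqP.
rewrite mulf_eq0 gt_eqF//= /dot -!expr2 paddr_eq0 ?sqr_ge0// !sqrf_eq0.
move=> /andP[/eqP h0 /eqP h1]; move/eqP: w0; apply.
by apply: vec2P; rewrite [RHS]mxE.
Qed.

Section GridTiling.
Variables (R : realType) (m : nat) (v u : 'I_m -> 'rV[R]_2) (eps : R) (q : 'I_m -> R).
Hypotheses (hv : edge_vectors v) (eps_neq0 : eps != 0).
Local Notation ar := (area eps).
Local Notation det := (area 1).
Local Notation sv := (svec v).
Local Notation su := (svec u).
Implicit Types (s t : sidx m) (x y d xi : 'rV[R]_2) (f g : 'rV[R]_m).
Hypothesis compat : forall i j, i != j -> 0 < ar (v i) (v j) * det (u i) (u j).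
Hypothesis two_idx : forall i : 'I_m, exists j, i != j.
Local Notation th := (offset_height u q).
Hypothesis generic : forall xi i j k, i != j -> j != k -> i != k ->
  isint (th i xi) -> isint (th j xi) -> isint (th k xi) -> False.
Local Notation surface := (surface u q).
Local Notation to_plane := (to_plane v).
Local Notation base := (base u q).
Local Notation crossing := (crossing u q).
Local Notation grid := (grid v u q).

(** Moving [xi] in the direction [d] until the first height reaches a step: until then
    the integer vector [g] remains on the surface. *)
Lemma first_hit xi d g : (exists l, dot (u l) d != 0) ->
  (forall l, 0 < dot (u l) d -> g 0 l - 1 <= th l xi < g 0 l) ->
  (forall l, dot (u l) d < 0 -> g 0 l - 1 < th l xi <= g 0 l) ->
  exists xi', [/\ (forall l, dot (u l) d = 0 -> th l xi' = th l xi),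
    (forall l, dot (u l) d != 0 -> g 0 l - 1 <= th l xi' <= g 0 l) &
    exists l, (0 < dot (u l) d /\ th l xi' = g 0 l) \/
              (dot (u l) d < 0 /\ th l xi' = g 0 l - 1)].
Proof.
move=> [l1 hl1] hp hn.
pose tau l := if 0 < dot (u l) d then (g 0 l - th l xi) / dot (u l) d
  else (g 0 l - 1 - th l xi) / dot (u l) d.
have [l Hl lmin] := @arg_minP _ R _ l1 (fun l => dot (u l) d != 0) tau hl1.
have tau0 k : dot (u k) d != 0 -> 0 < tau k.
  rewrite neq_lt /tau => /orP[h|h].
    rewrite (lt_gtF h) -mulrNN -invrN divr_gt0 ?oppr_gt0//.
    by have := hn k h; lra.
  by rewrite h divr_gt0//; have := hp k h; lra.
have thE k : th k (xi + tau l *: d) = th k xi + tau l * dot (u k) d.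
  by rewrite thD dotZr.
exists (xi + tau l *: d); split.
- by move=> k hk; rewrite thE hk mulr0 addr0.
- move=> k hk; have := lmin k hk; have t0 := tau0 l Hl; rewrite thE [tau k]/tau.
  move: hk; rewrite neq_lt => /orP[h|h].
    rewrite (lt_gtF h) ler_ndivlMr// => h1.
    have : tau l * dot (u k) d < 0 by rewrite nmulr_llt0.
    have := hn k h; lra.
  rewrite h ler_pdivlMr// => h1; have := hp k h.
  have : 0 < tau l * dot (u k) d by rewrite mulr_gt0.
  lra.
exists l; move: (Hl); rewrite neq_lt => /orP[h|h]; [right|left]; split => //;
  rewrite thE /tau.
  by rewrite (lt_gtF h) divfK ?lt_eqF//; lra.
by rewrite h divfK ?gt_eqF//; lra.
Qed.

Lemma ceil_of_step (a : R) (k : int) : k%:~R - 1 <= a <= k%:~R -> a <> k%:~R -> a <> k%:~R - 1 ->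
  ~ isint a /\ (Num.ceil a)%:~R = k%:~R :> R.
Proof.
move=> /andP[h1 h2] n1 n2.
have na : ~ isint a.
  move=> [l e]; rewrite e in h1 h2 n1 n2.
  have : l = k \/ l = k - 1.
    move: h1 h2; rewrite -[1]/(1%:~R) -intrB !ler_int => h1 h2.
    by clear -h1 h2; lia.
  by case=> e'; [apply: n1; rewrite e'|apply: n2; rewrite e' intrB].
split => //; apply/esym/(in_step_nonint na)/in_step_below.
by rewrite h1.
Qed.

(** If the tile on the given edge lies on its negative side, then the tile on the positive
    side is dual to the next crossing on the line of the multigrid dual to the edge. *)
Lemma grid_next s X : sedge v grid s X ->
  exists2 t, 0 < ar (sv s) (sv t) & sface v grid s t X.
Proof.
move=> [t0 sf]; have [xi cr eX] := sface_grid sf.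
have [st is_ it_] := cr.
have h0 := compat_signed compat st.
have [h|h] := ltP 0 (ar (sv s) (sv t0)); first by exists t0.
have det_lt : det (su s) (su t0) < 0.
  have n0 : ar (sv s) (sv t0) != 0 by exact: area_sv_neq0.
  by rewrite nmulr_rgt0 in h0 => //; rewrite lt_neqAle n0.
pose d := rot (su s).
have dotE w : dot w d = det (su s) w by rewrite /d /rot /dot /area !mxE /=; ring.
pose g := base xi + (corner_shift R s + corner_shift R t0).
have dot_idx l : l != s.1 -> dot (u l) d != 0.
  move=> h1; rewrite dotE -(sv_pos u).
  by apply: (det_su_neq0 compat) => /=; rewrite eq_sym.
have dot_s : dot (u s.1) d = 0.
  by rewrite dotE /svec areaZl areaxx mulr0.
have ecE r l : corner_shift R r 0 l = ((r.1 == l) && r.2)%:R :> R.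
  case: r => i []; rewrite /corner_shift /= ?andbT ?andbF; last by rewrite mxE.
  by rewrite /e_ mxE eqxx /= eq_sym.
have gE l : l != s.1 -> l != t0.1 -> g 0 l = (Num.ceil (th l xi))%:~R.
  move=> h1 h2; rewrite /g 2!mxE [in X in _ + X]mxE !ecE.
  by rewrite [s.1 == l]eq_sym (negPf h1) [t0.1 == l]eq_sym (negPf h2) /= !addr0.
have gs : g 0 s.1 = th s.1 xi + s.2%:R.
  rewrite /g mxE [in X in _ + X]mxE !ecE eqxx eq_sym (negPf st) /= addr0.
  by rewrite base_int.
have gt : g 0 t0.1 = th t0.1 xi + t0.2%:R.
  rewrite /g mxE [in X in _ + X]mxE !ecE eqxx (negPf st) /= add0r.
  by rewrite base_int.
have nonint l : l != s.1 -> l != t0.1 -> g 0 l - 1 < th l xi < g 0 l.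
  move=> h1 h2; have ni := crossing_nonint generic cr h1 h2.
  by rewrite gE//; exact: nonint_ceil.
have su_sgn r : dot (u r.1) d = sgb R r.2 * det (su s) (su r).
  by rewrite dotE /svec areaZr mulrA sgb_sqr mul1r.
have side_t : (t0.2 = false /\ dot (u t0.1) d < 0) \/ (t0.2 = true /\ 0 < dot (u t0.1) d).
  rewrite su_sgn; case: (t0.2); rewrite /sgb; [right|left]; split => //; lra.
have [||| xi' [fix0 rng [l hit]]] := @first_hit xi d g.
- by exists t0.1; apply: dot_idx; rewrite eq_sym.
- move=> l hl; have ls : l != s.1 by apply: contraTneq hl => ->; rewrite dot_s ltxx.
  have [lt|lt] := eqVneq l t0.1; last by have := nonint l ls lt; lra.
  rewrite lt gt; case: side_t => -[e h1]; rewrite e /=; first by rewrite lt in hl; lra.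
  lra.
- move=> l hl; have ls : l != s.1 by apply: contraTneq hl => ->; rewrite dot_s ltxx.
  have [lt|lt] := eqVneq l t0.1; last by have := nonint l ls lt; lra.
  rewrite lt gt; case: side_t => -[e h1]; rewrite e /=; last by rewrite lt in hl; lra.
  lra.
have g_int k : isint (g 0 k).
  have [->|ks] := eqVneq k s.1.
    rewrite gs; have [z ->] := is_; exists (z + s.2%:Z); rewrite intrD.
    by case: (s.2).
  have [->|kt] := eqVneq k t0.1.
    rewrite gt; have [z ->] := it_; exists (z + t0.2%:Z); rewrite intrD.
    by case: (t0.2).
  by rewrite gE//; exists (Num.ceil (th k xi)).
have ls : l != s.1 by apply/eqP => e; move: hit; rewrite e dot_s ltxx; case=> -[].
pose t : sidx m := (l, ~~ (0 < dot (u l) d)).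
have th_s : th s.1 xi' = th s.1 xi by exact: fix0.
have th_l : g 0 l = th l xi' + t.2%:R.
  rewrite /t /=; case: hit => -[h1 ->]; first by rewrite h1 /= addr0.
  by rewrite (lt_gtF h1) subrK.
have cr' : crossing xi' s.1 t.1.
  split; rewrite /= 1?eq_sym//; first by rewrite th_s.
  have [z hz] := g_int l; exists (z - t.2%:Z); rewrite intrD mulrNz -hz th_l.
  by case: (t.2); rewrite /= ?addrK ?subr0 ?addr0.
have gE' : g = base xi' + (corner_shift R s + corner_shift R t).
  apply/rowP => k; rewrite [RHS]mxE [in X in _ + X]mxE !ecE.
  have [->|ks] := eqVneq k s.1.
    have bs : base xi' 0 s.1 = th s.1 xi by rewrite base_int th_s.
    by rewrite gs bs ?eqxx (negPf ls) /= addr0.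
  have [->|kl] := eqVneq k l.
    rewrite th_l base_int; last by have [_ _ ] := cr'.
    by rewrite ?[s.1 == l]eq_sym ?(negPf ls) /= ?eqxx ?add0r.
  rewrite ?[s.1 == k]eq_sym ?(negPf ks) ?[l == k]eq_sym ?(negPf kl) /= !addr0 baseE.
  have [z hz] := g_int k; rewrite hz.
  have nk := crossing_nonint generic cr' ks kl.
  have := rng k (dot_idx k ks); rewrite hz => hr; apply/esym.
  have [] // := ceil_of_step hr.
    by move=> e; apply: nk; exists z.
  by move=> e; apply: nk; exists (z - 1); rewrite intrB.
exists t; last by rewrite eX -/g gE'; exact: grid_sface.
have stn : s.1 != t.1 by rewrite eq_sym.
rewrite (compat_gt0 compat stn).
have := su_sgn t; rewrite /t /=; case: hit => -[h1 _].
  by rewrite h1 /= => e; move: h1; rewrite e mul1r.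
rewrite (lt_gtF h1) => e; move: h1; rewrite e mulN1r oppr_lt0; by [].
Qed.

(** Every point of the surface lies in a face: from a cell move to a line, and then along
    this line to a crossing. *)
Lemma surface_hits_crossing xi f : surface xi f -> (exists i : 'I_m, True) ->
  exists xi' i j, crossing xi' i j /\ surface xi' f.
Proof.
move=> hf [i0 _].
have move1 xi0 d : surface xi0 f -> (exists l, dot (u l) d != 0) ->
    (forall l, dot (u l) d != 0 -> ~ isint (th l xi0)) ->
    exists xi', [/\ surface xi' f, (forall l, dot (u l) d = 0 -> th l xi' = th l xi0) &
      exists2 l, dot (u l) d != 0 & isint (th l xi')].
  move=> h0 hex nint.
  have f_ceil l : dot (u l) d != 0 -> f 0 l = (Num.ceil (th l xi0))%:~R.
    by move=> hl; apply: in_step_nonint (nint l hl) (h0 l).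
  have rng l : dot (u l) d != 0 -> f 0 l - 1 < th l xi0 < f 0 l.
    move=> hl; have ni := nint l hl; rewrite f_ceil//.
    exact: nonint_ceil.
  have [||xi' [fix0 hr [l hit]]] := @first_hit xi0 d f hex.
  - by move=> l hl; have := rng l (lt0r_neq0 hl); lra.
  - by move=> l hl; have := rng l (ltr0_neq0 hl); lra.
  exists xi'; split => //.
    move=> k; have [hk|hk] := eqVneq (dot (u k) d) 0; first by rewrite fix0.
    by rewrite f_ceil//; apply: in_step_below; rewrite -f_ceil//; exact: hr.
  have hl : dot (u l) d != 0 by case: hit => -[h _]; [rewrite gt_eqF|rewrite lt_eqF].
  exists l => //; have := f_ceil l hl; set z := Num.ceil _ => e.
  case: hit => -[_ ->]; rewrite e; first by exists z.
  by exists (z - 1); rewrite intrB.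
have one xi0 i : surface xi0 f -> isint (th i xi0) ->
    exists xi' i j, crossing xi' i j /\ surface xi' f.
  move=> h0 hi.
  have [[j [ij hj]]|none] := pselect (exists j, i != j /\ isint (th j xi0)).
    by exists xi0, i, j.
  pose d := rot (u i).
  have dotE w : dot w d = det (u i) w by rewrite /d /rot /dot /area !mxE /=; ring.
  have dn l : i != l -> dot (u l) d != 0.
    by move=> il; rewrite dotE -!(sv_pos u); apply: (det_su_neq0 compat).
  have di l : dot (u l) d != 0 -> i != l.
    by apply: contraNneq => <-; rewrite dotE areaxx.
  have [j ij] := two_idx i.
  have [||xi' [h1 h2 [l hl il]]] := move1 xi0 d h0.
  - by exists j; exact: dn.
  - by move=> l /di il hl; apply: none; exists l.
  exists xi', i, l; split => //; split => //; first exact: di.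
  by rewrite h2// dotE areaxx.
have [[i hi]|none] := pselect (exists i, isint (th i xi)); first exact: (one xi i).
have [j ij] := two_idx i0.
have ui : u i0 != 0.
  have := @det_su_neq0 _ _ v u eps compat (i0, false) (j, false) ij.
  by rewrite !sv_pos; apply: contraNneq => ->; rewrite /area !mxE; apply/eqP; ring.
have [||xi' [h1 _ [l _ il]]] := move1 xi (u i0) hf.
- exists i0; apply: contraNneq ui => /eqP; rewrite /dot -!expr2 paddr_eq0 ?sqr_ge0//.
  rewrite !sqrf_eq0 => /andP[/eqP e0 /eqP e1].
  by apply/eqP/vec2P; rewrite [RHS]mxE.
- by move=> l _ hl; apply: none; exists l.
exact: (one xi' l).
Qed.

(** Two translates of a tile that overlap in a neighbourhood share the point symmetric in
    both, at which [surface_inj] makes their coordinates agree. *)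
Lemma grid_sep x i j a b : grid (x, i, j) ->
  grid (x + (a *: v i + b *: v j), i, j) -> -1 < a < 1 -> -1 < b < 1 -> a = 0 /\ b = 0.
Proof.
move=> [_ [xi [cr ex]]] [_ [xi' [cr' ex']]] ha hb.
pose f := base xi + (((1 + a) / 2) *: e_ i + ((1 + b) / 2) *: e_ j).
pose f' := base xi' + (((1 - a) / 2) *: e_ i + ((1 - b) / 2) *: e_ j).
have hf : surface xi f.
  by apply/(surface_crossing generic _ cr); exists ((1 + a) / 2), ((1 + b) / 2); split => //; lra.
have hf' : surface xi' f'.
  by apply/(surface_crossing generic _ cr'); exists ((1 - a) / 2), ((1 - b) / 2); split => //; lra.
have : f = f'.
  apply: (surface_inj hv eps_neq0 compat two_idx generic hf hf').
  by rewrite !to_plane_comb -ex -ex'; apply/rowP => l; rewrite !mxE; field.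
move=> /rowP e; have [ij _ _] := cr; have ji : j != i by rewrite eq_sym.
have small (c : R) (k k' : int) : -1 < c < 1 ->
    k%:~R + (1 + c) / 2 = k'%:~R + (1 - c) / 2 -> c = 0.
  move=> hc e1; have ck : c = (k' - k)%:~R by rewrite intrB; lra.
  have : -1 < k' - k < 1.
    by move: hc; rewrite ck -[1]/(1%:~R) -mulrNz !ltr_int.
  rewrite ck => h; suff -> : k' - k = 0 by [].
  by clear -h; lia.
split.
  have := e i; rewrite /f /f' !coord_comb eqxx (negPf ij) !mulr1 !mulr0 !addr0 !baseE.
  exact: small.
have := e j; rewrite /f /f' !coord_comb eqxx (negPf ji) !mulr1 !mulr0 !add0r !baseE.
exact: small.
Qed.
End GridTiling.

(** * The tiling dual to a generic multigrid *)

Section GridRhombusTiling.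
Variables (R : realType) (m : nat) (v u : 'I_m -> 'rV[R]_2) (eps : R) (q : 'I_m -> R).
Hypotheses (hv : edge_vectors v) (eps_neq0 : eps != 0).
Local Notation ar := (area eps).
Local Notation det := (area 1).
Local Notation sv := (svec v).
Local Notation su := (svec u).
Implicit Types (s t : sidx m) (x y d xi : 'rV[R]_2) (f g : 'rV[R]_m).
Hypothesis compat : forall i j, i != j -> 0 < ar (v i) (v j) * det (u i) (u j).
Hypothesis two_idx : forall i : 'I_m, exists j, i != j.
Hypothesis idx : exists i : 'I_m, True.
Local Notation th := (offset_height u q).
Hypothesis generic : forall xi i j k, i != j -> j != k -> i != k ->
  isint (th i xi) -> isint (th j xi) -> isint (th k xi) -> False.
Local Notation surface := (surface u q).
Local Notation to_plane := (to_plane v).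
Local Notation base := (base u q).
Local Notation crossing := (crossing u q).
Local Notation grid := (grid v u q).

Lemma grid_covers y : covered v grid y.
Proof.
apply: (@covers_plane _ _ v eps hv eps_neq0 grid _ _ _ {ffun 'I_m -> int}
  (fun z => to_plane (\row_l (z l)%:~R))).
- by move=> x i j [].
- exact: (grid_sep hv eps_neq0 compat two_idx generic).
- exact: (grid_next hv eps_neq0 compat generic).
- have [i _] := idx.
  have [|xi [a [b [cr _]]]] := @surface_hits_crossing _ _ v u eps q compat two_idx 0 (base 0) _ idx.
    by move=> l; rewrite baseE; exact: in_step_ceil.
  have := @grid_sface _ _ v u q xi (a, false) (b, false) cr.
  by move=> [tau gt _]; exists tau.
move=> X /vertex_sface[s [t /sface_grid[xi cr ->]]].
exists [ffun l => Num.floor ((base xi + (corner_shift R s + corner_shift R t)) 0 l)];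
  congr to_plane.
apply/rowP => l; rewrite [RHS]mxE ffunE.
have ecE r : exists k : int, corner_shift R r 0 l = k%:~R.
  by case: r => i []; rewrite /corner_shift /e_ /= mxE;
    [exists ((0 == 0 :> 'I_1) && (l == i))%:Z|exists 0].
have [k hk] := ecE s; have [k' hk'] := ecE t.
rewrite mxE baseE [X in _ + X]mxE hk hk' -!intrD.
by rewrite intrKfloor.
Qed.

Lemma int_zero_one (a : R) : 0 <= a <= 1 -> isint a -> exists b : bool, a = b%:R.
Proof.
move=> h [k e]; have /andP[h1 h2] : 0 <= k <= 1 by rewrite -!(ler_int R) -e.
have [e1|e1] : k = 0 \/ k = 1 by clear -h1 h2; lia.
  by exists false; rewrite e e1.
by exists true; rewrite e e1.
Qed.

Lemma surface_int_crossing xi i j g : crossing xi i j -> surface xi g -> (forall l,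
  isint (g 0 l)) ->
  exists a b : bool, g = base xi + (a%:R *: e_ i + b%:R *: e_ j).
Proof.
move=> cr hg gi; have [ij _ _] := cr.
have /(surface_crossing generic _ cr)[a [b [ha hb e]]] := hg.
have sub_int (x : R) (k : int) : isint (k%:~R + x) -> isint x.
  by move=> [k' e']; exists (k' - k); rewrite intrB -e' addrAC subrr add0r.
have [a' ea] : exists a' : bool, a = a'%:R.
  apply: int_zero_one ha _; have := gi i.
  by rewrite e coord_comb eqxx (negPf ij) mulr1 mulr0 addr0 baseE => /sub_int.
have [b' eb] : exists b' : bool, b = b'%:R.
  apply: int_zero_one hb _; have := gi j.
  by rewrite e coord_comb eqxx eq_sym (negPf ij) mulr1 mulr0 add0r baseE => /sub_int.
by exists a', b'; rewrite -ea -eb.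
Qed.

Lemma grid_vertex xi i j g : crossing xi i j -> surface xi g -> (forall l, isint (g 0 l)) ->
  tile_vertex v (to_plane (base xi), i, j) (to_plane g).
Proof.
move=> cr hg gi; have [a [b ->]] := surface_int_crossing cr hg gi.
by exists a, b; rewrite to_plane_comb.
Qed.

Lemma grid_edge xi i j g l0 : crossing xi i j -> surface xi g -> (forall l, isint (g 0 l)) ->
  isint (th l0 xi) -> g 0 l0 = th l0 xi ->
  tile_edge v (to_plane (base xi), i, j) (segment (to_plane g) (v l0)).
Proof.
move=> cr hg gi il0; have [a [b ->]] := surface_int_crossing cr hg gi.
have [ij _ _] := cr; rewrite coord_comb base_int// => e.
have [li|li] := eqVneq l0 i.
  exists b; left; rewrite to_plane_comb; subst l0.
  move: e; rewrite eqxx (negPf ij) mulr0 mulr1 addr0 => e.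
  have -> : a%:R = 0 :> R by lra.
  by rewrite scale0r add0r.
have [lj|lj] := eqVneq l0 j; last by have := crossing_nonint generic cr li lj il0.
exists a; right; rewrite to_plane_comb; subst l0.
move: e; rewrite eqxx (negPf li) mulr0 mulr1 add0r => e.
have -> : b%:R = 0 :> R by lra.
by rewrite scale0r addr0.
Qed.

(** A point common to two tiles is the image of a point of the surface above both
    crossings. Every coordinate whose height differs at the two crossings is then a fixed
    integer. Only one height can agree, and its coordinate varies if and only if both
    crossings lie on a common line, dual to a common edge. *)
Lemma grid_meet xi (i j : 'I_m) xi' (i' j' : 'I_m) : (i < j)%N -> (i' < j')%N ->
  crossing xi i j -> crossing xi' i' j' ->
  (to_plane (base xi), i, j) <> (to_plane (base xi'), i', j') ->
  let A := tile_set v (to_plane (base xi), i, j) `&` tile_set v (to_plane (base xi'), i', j') in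
  A !=set0 -> exists g, [/\ surface xi g, surface xi' g, forall l, isint (g 0 l) &
    A = [set to_plane g] \/ exists l0, [/\ A = segment (to_plane g) (v l0), isint (th l0 xi),
      g 0 l0 = th l0 xi & th l0 xi' = th l0 xi]].
Proof.
move=> ij ij' cr cr' ne A [y0 [y1 y2]].
have AE y : A y <-> exists f, [/\ surface xi f, surface xi' f & to_plane f = y].
  split=> [[/(tile_surface v generic _ cr)[f h1 e1] /(tile_surface v generic _ cr')[f' h2 e2]]|].
    exists f; split=> //; rewrite (surface_inj hv eps_neq0 compat two_idx generic h1 h2) ?e1//.
  move=> [f [h1 h2 <-]]; split; [apply/(tile_surface v generic _ cr)|apply/(tile_surface v
    generic _ cr')];
    by exists f.
have [f0 [h0 h0' _]] := (AE y0).1 (conj y1 y2).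
have nxi : xi != xi'.
  apply/eqP => e; subst xi'; apply: ne.
  have in2 l : isint (th l xi) -> l = i \/ l = j.
    move=> hl; have [->|li] := eqVneq l i; first by left.
    have [->|lj] := eqVneq l j; first by right.
    by case: (crossing_nonint generic cr li lj hl).
  have [_ a b] := cr'.
  have ii : i' = i.
    have [//|ei] := in2 _ a; exfalso; have [ej|ej] := in2 _ b; move: ij'; rewrite ei ej.
      by move=> h; move: (ltn_trans ij h); rewrite ltnn.
    by rewrite ltnn.
  have [ej|->] := in2 _ b; last by rewrite ii.
  by move: ij'; rewrite ii ej ltnn.
pose d := xi' - xi.
have d0 : d != 0 by rewrite subr_eq0 eq_sym.
have thE l : th l xi' = th l xi + dot (u l) d by rewrite -thD /d subrKC.
have det_int l : dot (u l) d != 0 -> exists k : int, forall f, surface xi f -> surface xi' f ->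
  f 0 l = k%:~R.
  rewrite neq_lt => /orP[h|h].
    exists (Num.ceil (th l xi)) => f hf hf'; apply: (in_step_both _ (hf' l) (hf l)).
    by rewrite thE; lra.
  exists (Num.ceil (th l xi')) => f hf hf'; apply: (in_step_both _ (hf l) (hf' l)).
  by rewrite thE; lra.
have [[l0 [dl0 il0]]|none] := pselect (exists l0, dot (u l0) d = 0 /\ isint (th l0 xi)).
  have thl0 : th l0 xi' = th l0 xi by rewrite thE dl0 addr0.
  have det_oth l : l != l0 -> exists k : int, forall f, surface xi f -> surface xi' f ->
    f 0 l = k%:~R.
    move=> ll; apply: det_int; apply: contra_neq d0 => h.
    exact: (dot_two_zero compat ll h dl0).
  pose g := f0 + ((th l0 xi - f0 0 l0) *: e_ l0).
  have gE l : g 0 l = if l == l0 then th l0 xi else f0 0 l.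
    by rewrite /g /e_ !mxE eqxx /=; case: eqVneq => [->|_]; rewrite ?mulr1 ?subrKC// mulr0 addr0.
  have [k0 ek0] := il0.
  have g_srf zeta : surface zeta f0 -> th l0 zeta = th l0 xi -> forall c, 0 <= c <= 1 ->
      surface zeta (g + c *: e_ l0).
    move=> hz ez c hc l; rewrite mxE gE [X in _ + X]mxE /e_ [delta_mx _ _ _ _]mxE eqxx /=.
    have [->|_] := eqVneq l l0; last by rewrite mulr0 addr0.
    by rewrite ez mulr1 ek0 in_step_int; lra.
  have g0 zeta : surface zeta f0 -> th l0 zeta = th l0 xi -> surface zeta g.
    by move=> hz ez; have := g_srf _ hz ez 0; rewrite scale0r addr0; apply; lra.
  exists g; split; [exact: g0|exact: g0| |].
    move=> l; rewrite gE; case: eqVneq => // ll.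
    by have [k hk] := det_oth l ll; exists k; exact: hk.
  right; exists l0; split=> //; last by rewrite gE eqxx.
  apply/seteqP; split=> [y /AE[f [hf hf' <-]]|y [c hc ->]].
    exists (f 0 l0 - th l0 xi).
      have := hf l0; rewrite ek0 in_step_int; lra.
    rewrite -(to_plane_e v l0) -to_planeZ -to_planeD; congr to_plane; apply/rowP => l.
    rewrite mxE gE [X in _ + X]mxE /e_ [delta_mx _ _ _ _]mxE eqxx /=.
    have [->|ll] := eqVneq l l0; first by rewrite mulr1 subrKC.
    by rewrite mulr0 addr0; have [k hk] := det_oth l ll; rewrite !hk.
  apply/AE; exists (g + c *: e_ l0); split; [exact: g_srf|exact: g_srf|].
  by rewrite to_planeD to_planeZ to_plane_e.
have det_all l : exists k : int, forall f, surface xi f -> surface xi' f -> f 0 l = k%:~R.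
  have [h|h] := eqVneq (dot (u l) d) 0; last exact: det_int.
  exists (Num.ceil (th l xi)) => f hf _; apply: in_step_nonint (hf l) => hl.
  by apply: none; exists l.
exists f0; split=> //; first by move=> l; have [k hk] := det_all l; exists k; exact: hk.
left; apply/seteqP; split=> [y /AE[f [hf hf' <-]]|y ->].
  by congr to_plane; apply/rowP => l; have [k hk] := det_all l; rewrite !hk.
by apply/AE; exists f0.
Qed.

Lemma v_neq0 i : v i != 0.
Proof.
by apply: contra_eq_neq (hv.1 i) => ->; rewrite !mxE expr0n addr0 eq_sym oner_eq0.
Qed.

(** Tiles meet in a point or a segment by [grid_meet], neither of which has an interior
    point. *)
Theorem grid_tiling : rhombus_tiling v grid.
Proof.
split.
- by move=> x i j [].
- exact: grid_covers.
- move=> [[x i] j] [[x' i'] j'] [ij [xi [cr ex]]] [ij' [xi' [cr' ex']]] ne.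
  rewrite ex ex' in ne *; apply/seteqP; split=> // y; rewrite -interiorI => hy.
  have [|g [_ _ _ hA]] := grid_meet ij ij' cr cr' ne.
    by exists y; exact: interior_subset hy.
  case: hA => [e|[l0 [e _ _ _]]]; rewrite e in hy.
    apply: (interior_not_segment (v_neq0 i) hy (X := to_plane g)) => z ->.
    by exists 0; rewrite ?scale0r ?addr0//; lra.
  exact: (interior_not_segment (v_neq0 l0) hy (fun z h => h)).
move=> [[x i] j] [[x' i'] j'] [ij [xi [cr ex]]] [ij' [xi' [cr' ex']]] ne.
rewrite ex ex' in ne * => A hA.
have [g [h1 h2 gi]] := grid_meet ij ij' cr cr' ne hA.
case=> [e|[l0 [e il0 gl0 thl0]]].
  by left; exists (to_plane g); split=> //; exact: grid_vertex.
right; rewrite /A e; split; first exact: grid_edge.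
by apply: grid_edge; rewrite ?thl0.
Qed.
End GridRhombusTiling.

(** * Lift, planarity and shadow periods of the dual tiling *)

Section GridLift.
Variables (R : realType) (m : nat) (v u : 'I_m -> 'rV[R]_2) (eps : R) (q : 'I_m -> R).
Hypotheses (hv : edge_vectors v) (eps_neq0 : eps != 0).
Local Notation ar := (area eps).
Local Notation det := (area 1).
Local Notation es := (@es R m).
Implicit Types (s t : sidx m) (x y d xi : 'rV[R]_2) (f g z p : 'rV[R]_m).
Hypothesis compat : forall i j, i != j -> 0 < ar (v i) (v j) * det (u i) (u j).
Hypothesis two_idx : forall i : 'I_m, exists j, i != j.
Hypothesis idx : exists i : 'I_m, True.
Local Notation th := (offset_height u q).
Hypothesis generic : forall xi i j k, i != j -> j != k -> i != k ->
  isint (th i xi) -> isint (th j xi) -> isint (th k xi) -> False.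
Local Notation surface := (surface u q).
Local Notation to_plane := (to_plane v).
Local Notation base := (base u q).
Local Notation crossing := (crossing u q).
Local Notation grid := (grid v u q).

Lemma dot_solve x y (a b : R) : det x y != 0 -> exists d, dot x d = a /\ dot y d = b.
Proof.
move=> D; exists ((b / det x y) *: rot x + (- a / det x y) *: rot y).
move: D; rewrite /dot /rot /area !mxE /= !mul1r => D.
by split; field.
Qed.

Lemma crossing_exists j : exists xi l, crossing xi j l.
Proof.
have [l jl] := two_idx j.
have D : det (u j) (u l) != 0.
  by have := compat jl; rewrite lt0r mulf_eq0 negb_or -andbA => /and3P[].
have [d [e1 e2]] := dot_solve (- q j) (- q l) D.
exists d, l; split=> //; exists 0; rewrite /offset_height ?e1 ?e2; lra.
Qed.

(** A lift whose lifted tiles make up the whole surface, up to an integer translation. *)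
Definition grid_lift L z0 := [/\ is_lift v grid L, forall l, isint (z0 0 l) &
  forall z, lifted grid L z <-> exists xi f, surface xi f /\ z = f - z0].

Theorem grid_lift_exists : exists L z0, grid_lift L z0.
Proof.
have surj y : exists f, (exists xi, surface xi f) /\ to_plane f = y.
  have [[[x i] j] [ij [xi [cr ->]]]] := grid_covers hv eps_neq0 compat two_idx idx generic y.
  by move=> /(tile_surface v generic _ cr)[f hf e]; exists f; split => //; exists xi.
have [F hF] := choice surj.
have FE xi f : surface xi f -> F (to_plane f) = f.
  move=> h; have [[xi' h'] e] := hF (to_plane f).
  exact: (surface_inj hv eps_neq0 compat two_idx generic h' h e).
have [i0 _] := idx; have [xi0 [l0 cr0]] := crossing_exists i0.
have sb xi : surface xi (base xi) by move=> l; rewrite baseE; exact: in_step_ceil.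
have tileE xi i j (a b : R) : crossing xi i j -> 0 <= a <= 1 -> 0 <= b <= 1 ->
    surface xi (base xi + (a *: e_ i + b *: e_ j)).
  by move=> cr ha hb; apply/(surface_crossing generic _ cr); exists a, b.
have Lv x i j : grid (x, i, j) -> exists xi, [/\ crossing xi i j,
  F x = base xi & x = to_plane (base xi)].
  by move=> [_ [xi [cr e]]]; exists xi; split => //; rewrite e; exact: FE.
exists (fun x => F x - base xi0), (base xi0); split.
- split.
    exists (to_plane (base xi0)); last by rewrite (FE xi0)// subrr.
    have := @grid_sface _ _ v u q xi0 (i0, false) (l0, false) cr0.
    by rewrite /corner_shift /= !addr0 => h; exact: (sedge_vertex (sface_edge h).1).1.
  move=> x i j /Lv[xi [cr e ex]] a b.
  rewrite addrAC; congr (_ - _); rewrite e {1}ex -to_plane_comb (@FE xi)//.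
  by apply: tileE => //; [case: a|case: b]; rewrite ?lexx ?ler01.
- by move=> l; rewrite baseE; exists (Num.ceil (th l xi0)).
move=> z; split.
  move=> [x [i [j [/Lv[xi [cr e ex]] [a [b [ha hb ->]]]]]]].
  exists xi, (base xi + (a *: e_ i + b *: e_ j)); split; first exact: tileE.
  by rewrite e addrAC.
move=> [xi [f [/surface_hits_crossing - /(_ v eps compat two_idx idx)[xi' [i [j [cr hf]]]] ->]]].
have side i' j' (a b : R) : crossing xi' i' j' -> (i' < j')%N -> 0 <= a <= 1 -> 0 <= b <= 1 ->
    lifted grid (fun x => F x - base xi0) (base xi' + (a *: e_ i' + b *: e_ j') - base xi0).
  move=> cr' lt ha hb; exists (to_plane (base xi')), i', j'; split.
    by split=> //; exists xi'.
  by exists a, b; split=> //; rewrite (FE xi')// addrAC.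
have /(surface_crossing generic _ cr)[a [b [ha hb ->]]] := hf.
have [ij _ _] := cr; move: ij; rewrite neq_ltn => /orP[lt|lt]; first exact: side.
by rewrite [a *: _ + _]addrC; apply: side => //; exact: crossing_sym.
Qed.

Variables (L : 'rV[R]_2 -> 'rV[R]_m) (z0 : 'rV[R]_m).
Hypothesis gL : grid_lift L z0.

Lemma in_step_bounds (a b : R) : in_step a b -> 0 <= b - a <= 1.
Proof.
move=> /andP[h1 h2]; have := ceil_ge a; have := floor_le a; lra.
Qed.

(** On the surface each coordinate exceeds the height by at most 1. *)
Theorem grid_planar (E : affine_plane) : plane_point E = \row_l q l - z0 ->
  (forall d, \row_l dot (u l) d \in plane_dir E) -> lifts_into v grid E 1.
Proof.
move=> e hd; have [isL _ liftedE] := gL; exists L => // z /liftedE[xi [f [hf ->]]].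
exists (\row_l th l xi - z0), (f - \row_l th l xi); split.
- rewrite /plane_set /= e (_ : _ - _ = \row_l dot (u l) xi)//.
  by apply/rowP => l; rewrite !mxE /offset_height; ring.
- by move=> l; rewrite !mxE; exact: in_step_bounds (hf l).
by apply/rowP => l; rewrite !mxE; ring.
Qed.

Lemma in_step_shift (a b : R) (k : int) : in_step a b -> in_step (a + k%:~R) (b + k%:~R).
Proof.
rewrite /in_step => /andP[h1 h2].
have -> : Num.ceil (a + k%:~R) = Num.ceil a + k by rewrite ceilDrz ?intr_int// intrKceil.
have -> : Num.floor (a + k%:~R) = Num.floor a + k by rewrite floorDrz ?intr_int// intrKfloor.
rewrite !intrD; lra.
Qed.

(** If the heights of three families all change by integers when [xi] moves by [d], then
    so do the corresponding coordinates of the surface; the other coordinates are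
    irrelevant for the shadow. *)
Lemma grid_shift (i j k : 'I_m) d p z : (forall l, isint (p 0 l)) ->
  (forall l, l \in [:: i; j; k] -> p 0 l = dot (u l) d) ->
  (forall l, l \notin [:: i; j; k] -> p 0 l = 0) ->
  shadow grid L i j k z -> shadow grid L i j k (z + p).
Proof.
have [_ _ liftedE] := gL.
move=> pi hd hp0 [z' /liftedE[xi [f [hf ->]]] <-].
pose g := \row_l if l \in [:: i; j; k] then f 0 l + p 0 l else (Num.ceil (th l (xi + d)))%:~R.
exists (g - z0).
  apply/liftedE; exists (xi + d), g; split=> // l; rewrite mxE; case: ifP => h.
    by rewrite thD -hd//; have [n ->] := pi l; exact: in_step_shift.
  exact: in_step_ceil.
apply/rowP => l; rewrite !mxE; case: ifP => h; rewrite ?h; last by rewrite hp0 ?addr0 ?h.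
by ring.
Qed.

Lemma grid_period (i j k : 'I_m) d p : (forall l, isint (p 0 l)) ->
  (forall l, l \in [:: i; j; k] -> p 0 l = dot (u l) d) ->
  (forall l, l \notin [:: i; j; k] -> p 0 l = 0) ->
  period (shadow grid L i j k) p.
Proof.
move=> pi hd hp0; apply/seteqP; split=> [z [z' hz <-]|z hz].
  exact: (grid_shift pi hd hp0 hz).
exists (z - p); last by rewrite subrK.
apply: (@grid_shift _ _ _ (- d)) hz => l.
- by have [n e] := pi l; exists (- n); rewrite mxE e mulrNz.
- by move=> /hd e; rewrite mxE e dotNr.
by move=> /hp0 e; rewrite mxE e oppr0.
Qed.

Lemma grid_two_nonint (z : 'rV[R]_m) i j k : lifted grid L z ->
  i != j -> j != k -> i != k ->
  ~ isint (z 0 i) -> ~ isint (z 0 j) -> ~ isint (z 0 k) -> False.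
Proof.
have [_ z0i liftedE] := gL.
move=> /liftedE[xi [f [/surface_hits_crossing - /(_ v eps compat two_idx idx)[xi' [a [b [cr
  hf]]]] ->]]].
move=> ij jk ik hi hj hk.
have nonint l : ~ isint ((f - z0) 0 l) -> l = a \/ l = b.
  move=> h; have [->|la] := eqVneq l a; first by left.
  have [->|lb] := eqVneq l b; first by right.
  case: h; have [c e] := z0i l; rewrite !mxE e.
  rewrite (in_step_nonint (crossing_nonint generic cr la lb) (hf l)).
  by eexists; rewrite -intrB.
by have [ei|ei] := nonint _ hi; have [ej|ej] := nonint _ hj; have [ek|ek] := nonint _ hk;
  move: ij jk ik; rewrite ei ej ek ?eqxx.
Qed.

(** The midpoint of an edge. *)
Lemma grid_mid_edge j : exists2 z, lifted grid L z &
  ~ isint (z 0 j) /\ forall l, l != j -> isint (z 0 l).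
Proof.
have [_ z0i liftedE] := gL; have [xi [l0 cr]] := crossing_exists j.
exists (base xi + ((1 / 2) *: e_ j + 0 *: e_ l0) - z0).
  apply/liftedE; do 2 eexists; split; last by reflexivity.
  by apply/(surface_crossing generic _ cr); exists (1 / 2), 0; split=> //; lra.
have cE l : (base xi + (1 / 2 *: e_ j + 0 *: e_ l0) - z0) 0 l =
    base xi 0 l + 1 / 2 * (l == j)%:R - z0 0 l.
  by rewrite mxE coord_comb mul0r addr0 [(- z0) 0 l]mxE.
split; last first.
  move=> l lj; rewrite cE (negPf lj) mulr0 addr0 baseE.
  by have [c ->] := z0i l; eexists; rewrite -intrB.
rewrite cE eqxx mulr1 baseE; have [c ->] := z0i j; move=> [k].
set a := Num.ceil _ => e.
have : (2 * (k - a + c))%:~R = 1 :> R by rewrite intrM !intrD mulrNz; lra.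
move=> /eqP; rewrite -[1]/(1%:~R) eqr_int => /eqP h; clear -h; lia.
Qed.

(** If a period were a proper multiple of [p'], then translating the midpoint of a
    [j]-edge by [p'] would make three coordinates non-integers, whereas the points of a
    face have at most two non-integer coordinates. *)
Theorem grid_prime_period s r j (i' j' k' : 'I_m) d :
  s.1 != j -> j != r.1 -> s.1 != r.1 ->
  [:: i'; j'; k'] =i [:: s.1; j; r.1] ->
  dot (u s.1) d = sgb R s.2 -> dot (u j) d = 0 -> dot (u r.1) d = - sgb R r.2 ->
  prime_period (shadow grid L i' j' k') (es s - es r).
Proof.
move=> sj jr sr mem ds dj dr; pose p := es s - es r.
have pE l : p 0 l = es s 0 l - es r 0 l by rewrite !mxE.
have ps : p 0 s.1 = sgb R s.2.
  by rewrite pE es_coord_same es_coord_other ?subr0// eq_sym.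
have pr : p 0 r.1 = - sgb R r.2.
  by rewrite pE es_coord_same es_coord_other ?sub0r.
have p0 l : l != s.1 -> l != r.1 -> p 0 l = 0.
  by move=> ls lr; rewrite pE !es_coord_other ?subr0// eq_sym.
have sgb_int b : isint (sgb R b) by case: b; [exists (-1)|exists 1].
split.
- apply/eqP => e; move: ps; rewrite -/p in e; rewrite e mxE => /esym/eqP.
  by rewrite (negPf (sgb_neq0 _ _)).
- apply: (@grid_period _ _ _ d) => l; rewrite -/p.
  + have [->|ls] := eqVneq l s.1; first by rewrite ps; exact: sgb_int.
    have [->|lr] := eqVneq l r.1; last by rewrite p0//; exists 0.
    by rewrite pr; have [c ->] := sgb_int r.2; exists (- c); rewrite mulrNz.
  + rewrite mem !inE => /or3P[] /eqP->; first by rewrite ps ds.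
      by rewrite p0 ?dj// eq_sym.
    by rewrite pr dr.
  by rewrite mem !inE !negb_or => /and3P[ls _ lr]; exact: p0.
move=> [p' [c [per c1 e]]].
have [z hz [zj zint]] := grid_mid_edge j.
have : [set w + p' | w in shadow grid L i' j' k'] (shadow_proj i' j' k' z + p').
  by exists (shadow_proj i' j' k' z) => //; exists z.
rewrite per => -[z' hz' ez].
have coord l : l \in [:: s.1; j; r.1] -> z' 0 l = z 0 l + p' 0 l.
  by rewrite -mem => h; move/rowP: ez => /(_ l); rewrite !mxE h.
have pe l : p 0 l = p' 0 l * c%:R by rewrite /p e -scaler_nat mxE mulrC.
have cn0 : c%:R != 0 :> R by rewrite pnatr_eq0 -lt0n; exact: ltn_trans c1.
have not_int l : l != j -> l \in [:: s.1; j; r.1] -> p 0 l = 1 \/ p 0 l = -1 -> ~ isint (z' 0 l).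
  move=> lj lin pl; rewrite coord//; have [a ->] := zint l lj; move=> [b h].
  have e1 : p' 0 l = (b - a)%:~R by rewrite intrB; lra.
  have : (b - a) * c%:Z = 1 \/ (b - a) * c%:Z = -1.
    have : ((b - a) * c%:Z)%:~R = p 0 l by rewrite intrM -e1 pe.
    by case: pl => -> h1; [left|right]; apply/eqP; rewrite -(eqr_int R) h1.
  by case=> /(congr1 absz); rewrite abszM /= => /eqP; rewrite muln_eq1 => /andP[_ /eqP h2];
    rewrite h2 in c1.
have sgbv b : sgb R b = 1 \/ sgb R b = -1 by case: b; [right|left].
apply: (grid_two_nonint hz' sj jr sr).
- by apply: not_int => //; rewrite ?inE ?eqxx// ps.
- rewrite coord ?inE ?eqxx ?orbT//.
  have : p 0 j = 0 by rewrite p0// eq_sym.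
  by rewrite pe => /eqP; rewrite mulf_eq0 (negPf cn0) orbF => /eqP->; rewrite addr0.
apply: not_int; rewrite ?inE ?eqxx ?orbT//; first by rewrite eq_sym.
by rewrite pr; case: (sgbv r.2) => ->; [right|left; rewrite opprK].
Qed.
End GridLift.

(** * Orientation forced by a planar tiling *)

Section SlopeOrientation.
Variables (R : realType) (m : nat) (v u : 'I_m -> 'rV[R]_2).
Hypothesis hv : edge_vectors v.
Local Notation det := (area 1).
Local Notation sv := (svec v).
Local Notation es := (@es R m).
Implicit Types (s t : sidx m) (X Y d : 'rV[R]_2) (D : 'rV[R]_m).
Variable T : set (@tile R m).
Hypothesis hT : rhombus_tiling v T.
Variable L : 'rV[R]_2 -> 'rV[R]_m.
Hypothesis hL : is_lift v T L.
Local Notation sedge := (sedge v T).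
Hypothesis u_unit : forall l, dot (u l) (u l) = 1.
Hypothesis u_free : forall i j, i != j -> det (u i) (u j) != 0.
Hypothesis slope : forall X Y, vertex v T X -> vertex v T Y ->
  exists d, forall l, `|L Y 0 l - L X 0 l - dot (u l) d| <= 1.

Lemma sedge_pos s X : sedge s X -> exists Z, sedge (s.1, false) Z.
Proof.
by case: s => l [] h; [exists (X + sv (l, true)); exact: (sedge_flip h)|exists X].
Qed.

(** Along a ribbon every direction is used with the sign that makes its area with [s]
    positive, so that the sum of the absolute displacements is the length. *)
Lemma ribbon_walk s X N : sedge s X -> exists Y D,
  [/\ sedge s Y, L Y = L X + D, \sum_l Num.sg (det (sv s) (v l)) * D 0 l = N%:R,
    D 0 s.1 = 0 & forall l, 0 <= D 0 l * det (sv s) (v l)] /\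
  forall l, D 0 l != 0 -> exists Z, sedge (l, false) Z.
Proof.
move=> hX; elim: N => [|N [Y [D [[hY eY eN Ds hD] hZ]]]].
  exists X, 0; split; last by move=> l; rewrite mxE eqxx.
  split; rewrite ?addr0 ?mxE//; first by rewrite big1// => l _; rewrite mxE mulr0.
  by move=> l; rewrite mxE mul0r.
have [t pos sf] := next_face hv (oner_neq0 R) hT hY.
have [_ e _] := sface_lift (lift_faces hL) sf.
have st : s.1 != t.1.
  apply: contraTneq pos => e1; rewrite area_signed e1 areaxx mulr0 ltxx//.
have et l : es t 0 l = sgb R t.2 * (l == t.1)%:R by rewrite /es /e_ !mxE eqxx.
have pt : 0 < sgb R t.2 * det (sv s) (v t.1) by rewrite -areaZr.
exists (Y + sv t), (D + es t); split; last first.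
  move=> l; rewrite mxE et; have [->|lt] := eqVneq l t.1.
    by move=> _; have [/sface_sym/sface_edge[h _] _] := (conj sf I); exact: sedge_pos h.
  by rewrite mulr0 addr0; exact: hZ.
split.
- exact: (sface_edge sf).2.
- by rewrite e eY addrA.
- transitivity (\sum_l (Num.sg (det (sv s) (v l)) * D 0 l + Num.sg (det (sv s) (v l)) * es t 0 l)).
    by apply: eq_bigr => l _; rewrite mxE mulrDr.
  rewrite big_split /= eN (bigD1 t.1)//= big1 ?addr0.
    rewrite et eqxx mulr1 -natr1; congr (_ + _); move: pt; case: (t.2); rewrite /sgb => pt.
      by rewrite ltr0_sg; lra.
    by rewrite gtr0_sg; lra.
  by move=> l lt; rewrite et (negPf lt) !mulr0.
- by rewrite mxE Ds et (negPf st) mulr0 addr0.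
move=> l; rewrite mxE et; have [->|lt] := eqVneq l t.1.
  by rewrite mulr1 mulrDl addr_ge0// ltW.
by rewrite mulr0 addr0.
Qed.

Lemma dot_decomp (s : 'I_m) d l : dot (u l) d =
  dot (u s) (u l) * dot (u s) d + det (u s) (u l) * det (u s) d.
Proof.
transitivity (dot (u s) (u s) * dot (u l) d); first by rewrite u_unit mul1r.
by rewrite /dot /area; ring.
Qed.

Lemma lagrange_unit (s l : 'I_m) : dot (u s) (u l) ^+ 2 + det (u s) (u l) ^+ 2 = 1.
Proof.
transitivity (dot (u s) (u s) * dot (u l) (u l)); last by rewrite !u_unit mulr1.
by rewrite /dot /area; ring.
Qed.

(** The displacement along a ribbon of direction [s] stays close to a multiple [r] of the
    vector of the areas of the [u l] with [u s], because its [s]-coordinate vanishes. For a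
    long ribbon [r] is large, so all coordinates but [s] are nonzero; their signs are those
    of [r * det (u s) (u l)] as well as those of the areas of [v s] and [v l]. *)
Lemma edge_orientation s X : sedge s X -> exists2 c : R, c != 0 &
  forall l, l != s.1 -> 0 < c * (det (u s.1) (u l) * det (v s.1) (v l)) /\
    exists Z, sedge (l, false) Z.
Proof.
move=> hX.
(* For [M < `|r|] each [r * det (u s) (u l)] exceeds the error 2 of the displacement. *)
pose M := \sum_l (if l == s.1 then 0 else 2 / `|det (u s.1) (u l)|).
have M_ge l : l != s.1 -> 2 / `|det (u s.1) (u l)| <= M.
  move=> ls; rewrite /M (bigD1 l)//= (negPf ls) lerDl sumr_ge0// => k _.
  by case: ifP => // _; rewrite divr_ge0.
have M0 : 0 <= M by rewrite sumr_ge0// => k _; case: ifP => // _; rewrite divr_ge0.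
have [N hN] : exists N : nat, m%:R * (2 + M) < N%:R.
  exists (Num.truncn (m%:R * (2 + M))).+1.
  exact: truncnS_gt.
have [Y [D [[hY eY eN Ds hD] hZ]]] := ribbon_walk N hX.
have [d hd] := slope (sedge_vertex hX).1 (sedge_vertex hY).1.
pose r := det (u s.1) d.
have le1 l : `|dot (u s.1) (u l)| <= 1 /\ `|det (u s.1) (u l)| <= 1.
  have := lagrange_unit s.1 l; set a := dot _ _; set b := det _ _ => h.
  have := sqr_ge0 a; have := sqr_ge0 b => ha hb.
  by split; rewrite -(@expr_le1 _ 2)// real_normK ?num_real//; lra.
have hDl l : `|D 0 l - det (u s.1) (u l) * r| <= 2.
  have := hd s.1; have := hd l; rewrite eY.
  have -> : (L X + D) 0 l - L X 0 l = D 0 l by rewrite mxE addrAC subrr add0r.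
  have -> : (L X + D) 0 s.1 - L X 0 s.1 = D 0 s.1 by rewrite mxE addrAC subrr add0r.
  rewrite Ds sub0r normrN (dot_decomp s.1 d l) => h1 h2.
  have : `|dot (u s.1) (u l) * dot (u s.1) d| <= 1.
    by rewrite normrM -[1]mulr1 ler_pM// (le1 l).1.
  move: h1; rewrite !ler_norml -/r; lra.
have big_r : M < `|r|.
  rewrite ltNge; apply/negP => hr; move: hN; rewrite -eN ltNge => /negP; apply.
  apply: le_trans (ler_norm _) _; apply: le_trans (ler_norm_sum _ _ _) _.
  apply: le_trans (_ : \sum_(l < m) (2 + M) <= _); last first.
    by rewrite sumr_const card_ord mulr_natl.
  apply: ler_sum => l _; rewrite normrM.
  apply: le_trans (_ : 1 * `|D 0 l| <= _).
    by apply: ler_wpM2r => //; rewrite normr_sg; case: (_ != 0); rewrite ?lexx ?ler01.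
  rewrite mul1r; have : `|det (u s.1) (u l) * r| <= M.
    rewrite normrM; apply: le_trans hr; rewrite -[X in _ <= X]mul1r.
    by apply: ler_wpM2r => //; exact: (le1 l).2.
  have := hDl l; rewrite !ler_norml; lra.
exists (r * sgb R s.2).
  apply: mulf_neq0; last exact: sgb_neq0.
  by rewrite -normr_gt0; exact: le_lt_trans big_r.
move=> l ls; have gl : 0 < `|det (u s.1) (u l)|.
  by rewrite normr_gt0 u_free// eq_sym.
have big : 2 < `|det (u s.1) (u l) * r|.
  rewrite normrM mulrC -ltr_pdivrMr//; apply: le_lt_trans big_r; exact: M_ge.
have hl := hDl l.
have Dn0 : D 0 l != 0.
  apply/eqP => e; move: hl; rewrite e sub0r normrN; lra.
split; last exact: hZ.
have vn0 : det (sv s) (v l) != 0.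
  by rewrite -(sv_pos v l); apply: (area_sv_neq0 hv (oner_neq0 R)); rewrite /= eq_sym.
have pos : 0 < D 0 l * det (sv s) (v l) by rewrite lt0r hD andbT mulf_neq0.
have posD : 0 < D 0 l * (det (u s.1) (u l) * r).
  move: big hl; rewrite ltr_normr ler_norml => /orP[h1|h1] h2.
    by apply: mulr_gt0; lra.
  by rewrite -mulrNN; apply: mulr_gt0; lra.
have : 0 < (D 0 l * det (sv s) (v l)) * (D 0 l * (det (u s.1) (u l) * r)) by exact: mulr_gt0.
rewrite {1}/svec areaZl.
rewrite (_ : _ * _ * _ = (D 0 l) ^+ 2 * (r * sgb R s.2 * (det (u s.1) (u l) * det (v s.1) (v l)))).
  by rewrite pmulr_rgt0// lt0r sqr_ge0 andbT sqrf_eq0.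
by ring.
Qed.

(** The sign in [edge_orientation] depends on [s] only, and by antisymmetry of areas it is
    the same for all indices. *)
Theorem slope_orientation : exists2 eps : R, eps != 0 &
  forall i j, i != j -> 0 < area eps (v i) (v j) * det (u i) (u j).
Proof.
have [s [X hX]] : exists s X, sedge s X.
  have [[x0 /vertex_sface[s [t h]] _] _] := hL.
  by exists s, x0; exact: (sface_edge h).1.
have all_edges i : exists Z, sedge (i, false) Z.
  have [c _ h] := edge_orientation hX.
  have [->|is_] := eqVneq i s.1; first exact: sedge_pos hX.
  by have [] := h i is_.
have [c c0 hc] : exists2 c : R, c != 0 & forall l, l != s.1 ->
    0 < c * (det (u s.1) (u l) * det (v s.1) (v l)).
  have [c c0 h] := edge_orientation hX.
  by exists c => // l /h[].
have step i : exists ci : R, forall l, l != i -> 0 < ci * (det (u i) (u l) * det (v i) (v l)).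
  have [Z hZ] := all_edges i; have [ci _ h] := edge_orientation hZ.
  by exists ci => l /h[].
exists c => // i j ij; rewrite {1}/area.
rewrite (_ : _ * _ * _ = c * (det (u i) (u j) * det (v i) (v j))); last by rewrite /area; ring.
have [e|is_] := eqVneq i s.1; first by rewrite e; apply: hc; rewrite -e eq_sym.
have [ci hi] := step i.
have := hi s.1; rewrite eq_sym is_ => /(_ isT) h1; have := hi j; rewrite eq_sym ij => /(_ isT) h2.
have h3 := hc i is_.
have e : det (u i) (u s.1) * det (v i) (v s.1) = det (u s.1) (u i) * det (v s.1) (v i).
  by rewrite areaC [det (v i) _]areaC mulrNN.
rewrite e in h1; move: h1 h2 h3.
set a := det (u s.1) _ * _; set b := det (u i) _ * _ => h1 h2 h3.
have : 0 < (ci * b) * (ci * a) * (c * a) by apply: mulr_gt0 => //; exact: mulr_gt0.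
have -> : (ci * b) * (ci * a) * (c * a) = (ci * a) ^+ 2 * (c * b) by ring.
by rewrite pmulr_rgt0// exprn_gt0.
Qed.
End SlopeOrientation.

(** * Roots of unity *)

Section RootsOfUnity.
Variables (R : realType) (n : nat).
Hypothesis n_gt4 : (4 < n)%N.
Local Notation m := (nfold_dim n).
Local Notation det := (area (1 : R)).
Implicit Types (k l a b d : nat).

Definition angle k : R := 2 * k%:R * pi / n%:R.
Definition root_vec k : 'rV[R]_2 := \row_b (if b == 0 then cos (angle k) else sin (angle k)).
Definition root_vecs (l : 'I_m) := root_vec l.

Lemma n_neq0 : n%:R != 0 :> R.
Proof. by rewrite pnatr_eq0 -lt0n (ltn_trans _ n_gt4). Qed.

Lemma angleD a b : angle (a + b) = angle a + angle b.
Proof. by rewrite /angle natrD; have := n_neq0 => h; field. Qed.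

Lemma angle_n : angle n = pi *+ 2.
Proof. by rewrite /angle; have := n_neq0 => h; field. Qed.

Lemma det_root_vec a d : det (root_vec a) (root_vec (a + d)) = sin (angle d).
Proof.
rewrite /area /root_vec !mxE /= mul1r angleD.
have -> : angle d = (angle a + angle d) - angle a by rewrite addrAC subrr add0r.
rewrite sinB; rewrite (_ : angle a + (angle a + angle d - angle a) = angle a + angle d);
  first by ring.
by rewrite addrC subrK.
Qed.

Lemma dot_root_vec a : dot (root_vec a) (root_vec a) = 1.
Proof. by rewrite /dot /root_vec !mxE /= -!expr2 cos2Dsin2. Qed.

Lemma root_vec_sum a d x : dot (root_vec a) x + dot (root_vec (a + d.*2)) x =
  2 * cos (angle d) * dot (root_vec (a + d)) x.
Proof.
rewrite /dot /root_vec !mxE /= -addnn addnA angleD.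
have -> : angle a = angle (a + d) - angle d by rewrite angleD addrK.
rewrite cosB sinB cosD sinD; ring.
Qed.

Lemma sin_angle_gt0 d : (0 < d)%N -> (d.*2 < n)%N -> 0 < sin (angle d).
Proof.
move=> d0 dn; have n0 : 0 < n%:R :> R by rewrite ltr0n (ltn_trans _ n_gt4).
apply: sin_gt0_pi; apply/andP; split.
  rewrite /angle; apply: divr_gt0 => //; apply: mulr_gt0; last exact: pi_gt0.
  by apply: mulr_gt0 => //; rewrite ltr0n.
rewrite /angle ltr_pdivrMr// mulrC ltr_pM2l ?pi_gt0//.
by rewrite -natrM ltr_nat mul2n.
Qed.

Lemma sin_angle_lt0 d : (n < d.*2)%N -> (d < n)%N -> sin (angle d) < 0.
Proof.
move=> nd dn; have n0 : 0 < n%:R :> R by rewrite ltr0n (ltn_trans _ n_gt4).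
rewrite -[angle d](subrK pi) sinDpi oppr_lt0; apply: sin_gt0_pi.
have p0 := pi_gt0 R.
have e : angle d = pi * ((d.*2)%:R / n%:R) by rewrite /angle -mul2n natrM; field; exact: lt0r_neq0.
have h1 : 1 < (d.*2)%:R / n%:R :> R by rewrite ltr_pdivlMr// mul1r ltr_nat.
have h2 : (d.*2)%:R / n%:R < 2 :> R.
  by rewrite ltr_pdivrMr// -natrM ltr_nat mul2n ltn_double.
by rewrite e; apply/andP; split; nra.
Qed.

Lemma nfold_dim_cases : (odd n /\ m = n) \/ (~~ odd n /\ m.*2 = n).
Proof.
rewrite /nfold_dim; case: ifP => h; first by left.
by right; split; rewrite // -[RHS]odd_double_half h.
Qed.

Lemma m_gt0 : (0 < m)%N.
Proof. by have := n_gt4; case: nfold_dim_cases => -[_ ?]; lia. Qed.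

Lemma root_vec_period k : root_vec (k + m) = sgb R (~~ odd n) *: root_vec k.
Proof.
have [[ho e]|[ho e]] := nfold_dim_cases; rewrite ho /sgb ?scale1r.
  apply/rowP => b; rewrite !mxE angleD e angle_n; case: ifP => _.
    exact: cosD2pi.
  exact: sinD2pi.
have em : angle m = pi.
  have : angle m + angle m = pi *+ 2 by rewrite -angleD addnn e angle_n.
  by rewrite mulr2n; lra.
apply/rowP => b; rewrite !mxE angleD em; case: ifP => _.
  by rewrite cosDpi mulN1r.
by rewrite sinDpi mulN1r.
Qed.

(** The roots of unity beyond the first [m] are, up to sign, the first ones again. This
    signed index lets all of them be treated alike. *)
Definition cyclic_idx k : sidx m := (Ordinal (ltn_pmod k m_gt0), ~~ odd n && odd (k %/ m)).

Lemma svec_cyclic_idx k : svec root_vecs (cyclic_idx k) = root_vec k.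
Proof.
rewrite /svec /cyclic_idx /root_vecs /= {3}(divn_eq k m) addnC; elim: (k %/ m)%N => [|c IH].
  by rewrite andbF scale1r mul0n addn0.
rewrite mulSn [(m + _)%N]addnC addnA root_vec_period -IH scalerA /=.
by case: (odd n); case: (odd c); rewrite /sgb /= ?mulr1 ?mul1r ?mulrNN ?mulr1.
Qed.

Lemma cyclic_idx_period k : cyclic_idx (k + m) = if odd n then cyclic_idx k else sneg (cyclic_idx
  k).
Proof.
rewrite /cyclic_idx /sneg /= divnDr// divnn m_gt0 addn1 /=.
have -> : Ordinal (ltn_pmod (k + m) m_gt0) = Ordinal (ltn_pmod k m_gt0).
  by apply: val_inj; rewrite /= modnDr.
by case: (odd n).
Qed.

Lemma cyclic_idx_eq k d : ((cyclic_idx k).1 == (cyclic_idx (k + d)).1) = (m %| d)%N.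
Proof.
by rewrite -val_eqE /= eq_sym; have := eqn_modDl k d 0 m; rewrite addn0 mod0n => ->.
Qed.

Lemma root_vecs_free i j : i != j -> det (root_vecs i) (root_vecs j) != 0.
Proof.
wlog lt : i j / (i < j)%N.
  move=> h ij; have [lt|ge] := ltnP i j; first exact: h.
  rewrite areaC oppr_eq0; apply: h; last by rewrite eq_sym.
  by rewrite ltn_neqAle eq_sym ij.
move=> _; rewrite /root_vecs -(subnKC (ltnW lt)) det_root_vec.
have d0 : (0 < j - i)%N by rewrite subn_gt0.
have dm : (j - i < m)%N by apply: leq_ltn_trans (ltn_ord j); exact: leq_subr.
have [h|h] := ltnP (j - i).*2 n; first by rewrite gt_eqF// sin_angle_gt0.
rewrite lt_eqF//; apply: sin_angle_lt0.
  rewrite ltn_neqAle h andbT; apply/eqP => e.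
  have [[ho _]|[_ e2]] := nfold_dim_cases; first by move: ho; rewrite e odd_double.
  by move: dm; rewrite -ltn_double e2 -e ltnn.
apply: leq_trans dm _; have [[_ e2]|[_ e2]] := nfold_dim_cases; rewrite -[X in (_ <= X)%N]e2//.
by rewrite -addnn leq_addr.
Qed.

Lemma two_idx (i : 'I_m) : exists j, i != j.
Proof.
have m1 : (1 < m)%N by have := n_gt4; case: nfold_dim_cases => -[_ ?]; lia.
have [i0|i0] := eqVneq (val i) 0%N.
  by exists (Ordinal m1); rewrite -val_eqE /= i0.
by exists (Ordinal m_gt0); rewrite -val_eqE.
Qed.

Lemma span2P (V : vectType R) (a b z : V) : reflect (exists x y, z = x *: a + y *: b)
  (z \in <<[:: a; b]>>%VS).
Proof.
rewrite span_cons span_seq1; apply: (iffP memv_addP) => [[p /vlineP[x ->] [r /vlineP[y ->] ->]]|].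
  by exists x, y.
by move=> [x [y ->]]; exists (x *: a); rewrite ?memvZ ?memv_line//; exists (y *: b);
  rewrite ?memvZ ?memv_line.
Qed.

Lemma nfold_dirP (z : 'rV[R]_m) : z \in @nfold_dir R n <-> exists d : 'rV[R]_2,
  z = \row_l dot (root_vecs l) d.
Proof.
split=> [/span2P[x [y ->]]|[d ->]].
  exists (\row_b if b == 0 then x else y); apply/rowP => l.
  by rewrite /dot /root_vecs /root_vec /angle !mxE /=; ring.
apply/span2P; exists (d 0 0), (d 0 1); apply/rowP => l.
by rewrite /dot /root_vecs /root_vec /angle !mxE /=; ring.
Qed.

(** By the identity for the sum of the sines of three angles of sum zero; geometrically,
    three distinct points of a circle are not collinear. *)
Lemma sin_sum_neq0 (i j k : 'I_m) : i != j -> j != k -> i != k ->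
  det (root_vecs j) (root_vecs k) + det (root_vecs k) (root_vecs i) + det (root_vecs i)
    (root_vecs j) != 0.
Proof.
have detE (a b : 'I_m) : det (root_vecs a) (root_vecs b) =
    2 * sin ((angle b - angle a) / 2) * cos ((angle b - angle a) / 2).
  set c := (angle b - angle a) / 2.
  have -> : det (root_vecs a) (root_vecs b) = sin (c + c).
    rewrite (_ : c + c = angle b - angle a); last by rewrite /c; lra.
    by rewrite sinB /area /root_vecs /root_vec !mxE /=; ring.
  by rewrite sinD; ring.
have sin_n0 (a b : 'I_m) : a != b -> sin ((angle b - angle a) / 2) != 0.
  by move=> /root_vecs_free; rewrite detE; apply: contra_neq => ->; ring.
move=> ij jk ik; rewrite !detE.
set x := (angle k - angle j) / 2; set y := (angle i - angle k) / 2.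
have -> : (angle j - angle i) / 2 = - (x + y) by rewrite /x /y; lra.
have sx0 : sin x != 0 by exact: sin_n0.
have sy0 : sin y != 0 by apply: sin_n0; rewrite eq_sym.
have sz0 : sin (x + y) != 0.
  have := sin_n0 _ _ ij; have -> : (angle j - angle i) / 2 = - (x + y) by rewrite /x /y; lra.
  by rewrite sinN oppr_eq0.
rewrite sinN cosN.
have -> : 2 * sin x * cos x + 2 * sin y * cos y + 2 * - sin (x + y) * cos (x + y) =
    4 * sin x * sin y * sin (x + y).
  move: {sx0 sy0 sz0} (cos2Dsin2 x) (cos2Dsin2 y); rewrite sinD cosD.
  set cx := cos x; set s1 := sin x; set cy := cos y; set s2 := sin y => h1 h2.
  transitivity (2 * s1 * cx * (cy ^+ 2 + s2 ^+ 2) + 2 * s2 * cy * (cx ^+ 2 + s1 ^+ 2) +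
    2 * - (s1 * cy + cx * s2) * (cx * cy - s1 * s2)); last by ring.
  by rewrite h1 h2; ring.
by rewrite !mulf_neq0.
Qed.

(** With the same offset [t] for all families, the concurrency of three lines determines
    [t] by [sin_sum_neq0], so only countably many offsets are excluded. *)
Lemma generic_offset : exists t : R, forall xi (i j k : 'I_m), i != j -> j != k -> i != k ->
  isint (offset_height root_vecs (fun=> t) i xi) -> isint (offset_height root_vecs (fun=> t) j
    xi) ->
  isint (offset_height root_vecs (fun=> t) k xi) -> False.
Proof.
pose I := ('I_m * 'I_m * 'I_m * (int * int * int))%type.
pose B (a : I) (t : R) := let: (i, j, k, (a1, a2, a3)) := a in [/\ i != j, j != k, i != k &
  exists xi, [/\ dot (root_vecs i) xi + t = a1%:~R, dot (root_vecs j) xi + t = a2%:~R &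
    dot (root_vecs k) xi + t = a3%:~R]].
have [|t [_ _ ht]] := @avoid_countable R I B 0 1 _ ltr01.
  have uniq (i j k : 'I_m) (a1 a2 a3 : int) t : B (i, j, k, (a1, a2, a3)) t ->
      t * (det (root_vecs j) (root_vecs k) + det (root_vecs k) (root_vecs i) + det (root_vecs i)
        (root_vecs j)) =
      a1%:~R * det (root_vecs j) (root_vecs k) + a2%:~R * det (root_vecs k) (root_vecs i) +
        a3%:~R * det (root_vecs i) (root_vecs j).
    move=> [_ _ _ [xi [<- <- <-]]]; rewrite /area /dot; ring.
  move=> [[[i j] k] [[a1 a2] a3]] t t' h1 h2.
  have [ij jk ik _] := h1.
  by apply: (mulIf (sin_sum_neq0 ij jk ik)); rewrite (uniq _ _ _ _ _ _ _ h1) (uniq _ _ _ _ _ _ _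
    h2).
exists t => xi i j k ij jk ik [a1 h1] [a2 h2] [a3 h3].
by apply: (ht (i, j, k, (a1, a2, a3))); split=> //; exists xi.
Qed.
End RootsOfUnity.

(** * Subperiods of n-fold tilings *)

Section Thickness.
Variables (R : realType) (m : nat) (v : 'I_m -> 'rV[R]_2).
Implicit Types (T : set (@tile R m)) (E : @affine_plane R m) (t : R).

Lemma thickness_le T E t : 1 <= t -> lifts_into v T E t -> thickness v T <= t.
Proof.
move=> t1 h; apply: ge_inf; last by split=> //; exists E.
by exists 1 => x [].
Qed.

Lemma thickness1 T E : lifts_into v T E 1 -> thickness v T = 1.
Proof.
move=> h; apply/le_anti; rewrite (thickness_le _ h)//=.
apply: lb_le_inf; last by move=> x [].
by exists 1; split=> //; exists E.
Qed.
End Thickness.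

Section NFoldSubperiods.
Variables (R : realType) (n : nat).
Hypothesis n_gt4 : (4 < n)%N.
Local Notation m := (nfold_dim n).
Local Notation det := (area (1 : R)).
Local Notation cyclic_idx := (cyclic_idx n_gt4).
Local Notation root_vecs := (@root_vecs R n).
Local Notation root_vec := (root_vec R n).
Variable v : 'I_m -> 'rV[R]_2.
Hypothesis hv : edge_vectors v.

(** A given n-fold tiling is strongly planar, so the differences of its lifted vertices
    are within 1 of the slope. *)
Theorem nfold_orientation T : nfold_tiling v T -> exists2 eps : R, eps != 0 &
  forall i j, i != j -> 0 < area eps (v i) (v j) * det (root_vecs i) (root_vecs j).
Proof.
move=> [hT [_ th1] [E hE dE]]; rewrite /is_slope th1 in hE; have [L hL sub] := hE.
apply: (slope_orientation hv hT hL).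
- by move=> l; exact: dot_root_vec.
- by move=> i j; exact: root_vecs_free.
move=> X Y hX hY.
have vertex_lifted Z : vertex v T Z -> lifted T L (L Z).
  move=> [[[x i] j] Tt [a [b ->]]]; exists x, i, j; split=> //.
  exists a%:R, b%:R; split; [by case: a; rewrite ?lexx ?ler01|by case: b; rewrite ?lexx ?ler01|].
  exact: hL.2.
have form Z : vertex v T Z -> exists d : 'rV[R]_2, forall l,
    0 <= L Z 0 l - plane_point E 0 l - dot (root_vecs l) d <= 1.
  move=> /vertex_lifted/sub[y [c [hy hc ->]]].
  have [d /rowP hd] : exists d : 'rV[R]_2, y - plane_point E = \row_l dot (root_vecs l) d.
    by apply/nfold_dirP; rewrite -dE.
  by exists d => l; have := hd l; have := hc l; rewrite !mxE; lra.
have [d hd] := form X hX; have [d' hd'] := form Y hY.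
exists (d' - d) => l; rewrite dotDr dotNr ler_norml.
by have := hd l; have := hd' l; lra.
Qed.

(** Directions in arithmetic progression are linearly dependent, their outer two summing
    to a multiple of the middle one. Hence some [w] has the scalar products 1, 0 and -1
    with them, and translating the generic multigrid by [w] maps its lines of these
    three families to such lines. *)
Theorem ap_subperiod (T0 : set tile) k d (i' j' k' : 'I_m) : nfold_tiling v T0 ->
  ~~ (m %| d.*2)%N -> [:: i'; j'; k'] =i [:: (cyclic_idx k).1; (cyclic_idx (k + d)).1;
    (cyclic_idx (k + d.*2)).1] ->
  nfold_subperiods v i' j' k' (es R (cyclic_idx k) - es R (cyclic_idx (k + d.*2))).
Proof.
move=> nT0 d2 mem; have [eps eps0 compat] := nfold_orientation nT0.
have [t gen] := generic_offset R n_gt4.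
have two := two_idx n_gt4.
have idx : exists i : 'I_m, True by exists (Ordinal (m_gt0 n_gt4)).
have [L [z0 gL]] := grid_lift_exists hv eps0 compat two idx gen.
have hT := grid_tiling hv eps0 compat two idx gen.
have [_ _ [E0 _ dE0]] := nT0.
have dim2 : \dim (@nfold_dir R n) = 2 by rewrite -dE0; case: E0 {dE0}.
pose E := AffinePlane (\row_l t - z0) dim2.
have inE : lifts_into v (grid v root_vecs (fun=> t)) E 1.
  apply: (grid_planar gL) => //= x; apply/nfold_dirP; by exists x.
have nd : ~~ (m %| d)%N by apply: contra d2 => h; rewrite -muln2 dvdn_mulr.
have s1 : (cyclic_idx k).1 != (cyclic_idx (k + d)).1 by rewrite cyclic_idx_eq.
have s2 : (cyclic_idx (k + d)).1 != (cyclic_idx (k + d.*2)).1 by rewrite -addnn addnA cyclic_idx_eq.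
have s3 : (cyclic_idx k).1 != (cyclic_idx (k + d.*2)).1 by rewrite cyclic_idx_eq.
exists (grid v root_vecs (fun=> t)).
  split=> //; first by split; [exists 1, E; split|exact: thickness1 inE].
  by exists E => //; rewrite /is_slope (thickness1 inE).
exists L; first by have [] := gL.
have su := svec_cyclic_idx R n_gt4.
have [w [e1 e2]] : exists w, dot (root_vec k) w = 1 /\ dot (root_vec (k + d)) w = 0.
  by apply: dot_solve; rewrite -!su; exact: (det_su_neq0 compat).
have e3 : dot (root_vec (k + d.*2)) w = -1.
  by have := root_vec_sum n_gt4 k d w; rewrite e1 e2 mulr0; lra.
have flip a : dot (root_vecs (cyclic_idx a).1) w = sgb R (cyclic_idx a).2 * dot (root_vec a) w.
  have dotZl (c : R) x : dot (c *: x) w = c * dot x w by rewrite /dot !mxE; ring.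
  by rewrite -su /svec dotZl mulrA sgb_sqr mul1r.
apply: (grid_prime_period compat two idx gen gL s1 s2 s3 mem (d := w)).
- by rewrite flip e1 mulr1.
- by rewrite flip e2 mulr0.
by rewrite flip e3 mulrN1.
Qed.

Lemma sort3 (a b c : 'I_m) : a != b -> b != c -> a != c ->
  exists i j k : 'I_m, [/\ (i < j)%N, (j < k)%N & [:: i; j; k] =i [:: a; b; c]].
Proof.
move=> ab bc ac.
have lt_of (x y : 'I_m) : x != y -> (x < y)%N \/ (y < x)%N.
  by rewrite neq_ltn => /orP.
have mem (x y z x' y' z' : 'I_m) : perm_eq [:: x; y; z] [:: x'; y'; z'] ->
  [:: x; y; z] =i [:: x'; y'; z'] by exact: perm_mem.
have [h1|h1] := lt_of _ _ ab; have [h2|h2] := lt_of _ _ bc; have [h3|h3] := lt_of _ _ ac.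
- by exists a, b, c.
- by move: (ltn_trans (ltn_trans h1 h2) h3); rewrite ltnn.
- by exists a, c, b; split=> // x; rewrite !inE; do ?case: eqP.
- by exists c, a, b; split=> // x; rewrite !inE; do ?case: eqP.
- by exists b, a, c; split=> // x; rewrite !inE; do ?case: eqP.
- by exists b, c, a; split=> // x; rewrite !inE; do ?case: eqP.
- by move: (ltn_trans (ltn_trans h3 h2) h1); rewrite ltnn.
by exists c, b, a; split=> // x; rewrite !inE; do ?case: eqP.
Qed.

Theorem nfold_swing (T0 T : set tile) L (eps : R) : eps != 0 -> nfold_tiling v T0 ->
  rhombus_tiling v T -> is_lift v T L ->
  (forall (i j k : 'I_m) p, (i < j)%N -> (j < k)%N -> nfold_subperiods v i j k p ->
    period (shadow T L i j k) p) ->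
  forall k d, ~~ (m %| d.*2)%N -> swing v T L (cyclic_idx k) (cyclic_idx (k + d)) (cyclic_idx (k
    + d.*2)).
Proof.
move=> eps0 nT0 hT hL per k d d2.
have nd : ~~ (m %| d)%N by apply: contra d2 => h; rewrite -muln2 dvdn_mulr.
have s1 : (cyclic_idx k).1 != (cyclic_idx (k + d)).1 by rewrite cyclic_idx_eq.
have s2 : (cyclic_idx (k + d)).1 != (cyclic_idx (k + d.*2)).1 by rewrite -addnn addnA cyclic_idx_eq.
have s3 : (cyclic_idx k).1 != (cyclic_idx (k + d.*2)).1 by rewrite cyclic_idx_eq.
have [i' [j' [k' [lt1 lt2 mem]]]] := sort3 s1 s2 s3.
apply: (period_swing hv eps0 hT hL s1 s2 s3 mem).
by apply: per => //; exact: (ap_subperiod nT0).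
Qed.
End NFoldSubperiods.

(** * The webs of a tiling with the n-fold subperiods *)

Section TilingWeb.
Variables (R : realType) (n : nat).
Hypothesis n_gt4 : (4 < n)%N.
Local Notation m := (nfold_dim n).
Local Notation det := (area (1 : R)).
Local Notation cyclic_idx := (cyclic_idx n_gt4).
Local Notation root_vecs := (@root_vecs R n).
Local Notation root_vec := (root_vec R n).
Variables (v : 'I_m -> 'rV[R]_2) (eps : R).
Hypotheses (hv : edge_vectors v) (eps_neq0 : eps != 0).
Local Notation ar := (area eps).
Local Notation sv := (svec v).
Hypothesis compat : forall i j, i != j -> 0 < ar (v i) (v j) * det (root_vecs i) (root_vecs j).
Variable T : set (@tile R m).
Hypothesis hT : rhombus_tiling v T.
Variable L : 'rV[R]_2 -> 'rV[R]_m.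
Hypothesis hL : is_lift v T L.
Local Notation sedge := (sedge v T).
Hypothesis swings : forall k d, ~~ (m %| d.*2)%N ->
  swing v T L (cyclic_idx k) (cyclic_idx (k + d)) (cyclic_idx (k + d.*2)).

Definition tiling_vertex := {X | vertex v T X}.
Implicit Types (k d j : nat) (x u : int) (p : tiling_vertex) (X Y : 'rV[R]_2).
(** The level of a vertex in the direction of the [k]-th root of unity. *)
Definition cyclic_level k X : int := level L (cyclic_idx k) X.

Lemma cyclic_level_period k X : vertex v T X -> cyclic_level (k + m) X = if odd n then
  cyclic_level k X else - cyclic_level k X.
Proof.
move=> vX; rewrite /cyclic_level cyclic_idx_period; case: ifP => // _.
exact: (level_neg hv eps_neq0 hT hL).
Qed.

Lemma cyclic_level_mod k X : vertex v T X -> `|cyclic_level k X| = `|cyclic_level (k %% m) X|.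
Proof.
move=> vX; rewrite {1}(divn_eq k m) addnC; elim: (k %/ m)%N => [|c IH].
  by rewrite mul0n addn0.
rewrite mulSn [(m + _)%N]addnC addnA cyclic_level_period//; case: ifP => _ //.
by rewrite normrN.
Qed.

Lemma ar_gt0 k d : ~~ (m %| d)%N -> 0 < sin (angle R n d) ->
  0 < ar (sv (cyclic_idx k)) (sv (cyclic_idx (k + d))).
Proof.
move=> md s0; rewrite (compat_gt0 compat) ?cyclic_idx_eq//.
by rewrite !svec_cyclic_idx det_root_vec.
Qed.

Lemma ar_lt0 k d : ~~ (m %| d)%N -> sin (angle R n d) < 0 ->
  ar (sv (cyclic_idx k)) (sv (cyclic_idx (k + d))) < 0.
Proof.
move=> md s0; have st : (cyclic_idx k).1 != (cyclic_idx (k + d)).1 by rewrite cyclic_idx_eq.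
have := compat_signed compat st.
rewrite !svec_cyclic_idx det_root_vec// => h; rewrite nmulr_lgt0// in h.
Qed.

Lemma dvdm_half d : ~~ (m %| d.*2)%N -> ~~ (m %| d)%N.
Proof. by apply: contra => h; rewrite -muln2 dvdn_mulr. Qed.

Lemma edge_exists k d x : ~~ (m %| d.*2)%N -> exists Z,
  sedge (cyclic_idx k) Z /\ cyclic_level k Z = x.
Proof.
move=> md; have [[x0 vx0 _] _] := hL.
have [mv _] := swings k md.
have [X [vX eX _ _]] := mv x0 (x - cyclic_level k x0) vx0.
have [Y [vY eY _ _]] := mv x0 (x - cyclic_level k x0 + 1) vx0.
have [||Z hZ eZ] := edge_at_level hv eps_neq0 hT hL (s := cyclic_idx k) (u := x) vX vY.
- by rewrite eX /cyclic_level; lia.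
- by rewrite eY /cyclic_level; lia.
by exists Z.
Qed.

Section Step.
Variable d : nat.
Hypotheses (d_gt0 : (0 < d)%N) (md : ~~ (m %| d.*2)%N) (dn : (d.*2 < n)%N).

Lemma step_area k : 0 < ar (sv (cyclic_idx k)) (sv (cyclic_idx (k + d))) /\
  0 < ar (sv (cyclic_idx (k + d))) (sv (cyclic_idx (k + d.*2))).
Proof.
have sd : 0 < sin (angle R n d) by exact: sin_angle_gt0.
by rewrite -addnn addnA; split; apply: ar_gt0 => //; exact: dvdm_half.
Qed.

Lemma edge_sum_close k X Y : sedge (cyclic_idx (k + d)) X -> sedge (cyclic_idx (k + d)) Y ->
  cyclic_level (k + d) X = cyclic_level (k + d) Y ->
  `|cyclic_level k X + cyclic_level (k + d.*2) X - (cyclic_level k Y + cyclic_level (k + d.*2)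
    Y)| <= 1.
Proof.
move=> hX hY e; have [a1 a2] := step_area k; have sw := swings k md.
have := swing_edge_sum hv eps_neq0 hT hL sw a1 a2 hX hY e.
have := swing_edge_sum hv eps_neq0 hT hL sw a1 a2 hY hX (esym e).
rewrite -!/(cyclic_level _ _); lia.
Qed.

Lemma stair_acute k X Y : (d.*2.*2 < n)%N -> vertex v T X -> sedge (cyclic_idx (k + d)) Y ->
  (cyclic_level (k + d) X <= cyclic_level (k + d) Y ->
    cyclic_level k X + cyclic_level (k + d.*2) X <= cyclic_level k Y + cyclic_level (k + d.*2) Y
      + 2) /\
  (cyclic_level (k + d) Y < cyclic_level (k + d) X ->
    cyclic_level k Y + cyclic_level (k + d.*2) Y <= cyclic_level k X + cyclic_level (k + d.*2) X
      + 2).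
Proof.
move=> d4 vX hY; have [a1 a2] := step_area k; have sw := swings k md.
have a3 : 0 < ar (sv (cyclic_idx k)) (sv (cyclic_idx (k + d.*2))).
  by apply: ar_gt0 => //; apply: sin_angle_gt0 => //; rewrite double_gt0.
by split; [exact: (swing_stair hv eps_neq0 hT hL sw a1 a2 a3 vX hY)
          |exact: (swing_stair_lower hv eps_neq0 hT hL sw a1 a2 a3 vX hY)].
Qed.

Lemma stair_obtuse k X Y : (n < d.*2.*2)%N -> vertex v T X -> sedge (cyclic_idx (k + d)) Y ->
  cyclic_level (k + d) X <= cyclic_level (k + d) Y ->
    cyclic_level k Y + cyclic_level (k + d.*2) Y <= cyclic_level k X + cyclic_level (k + d.*2) X
      + 2.
Proof.
move=> d4 vX hY; have [a1 a2] := step_area k; have sw := swings k md.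
have a3 : ar (sv (cyclic_idx k)) (sv (cyclic_idx (k + d.*2))) < 0.
  by apply: ar_lt0 => //; apply: sin_angle_lt0.
exact: (swing_stair_obtuse hv eps_neq0 hT hL sw a1 a2 a3 vX hY).1.
Qed.
End Step.

Lemma edge_choice : (exists d, ~~ (m %| d.*2)%N) -> exists Ed : nat -> int -> 'rV[R]_2,
  forall k x, sedge (cyclic_idx k) (Ed k x) /\ cyclic_level k (Ed k x) = x.
Proof.
move=> [d md]; have ex (a : nat * int) : exists Z, sedge (cyclic_idx a.1) Z /\ cyclic_level a.1 Z
  = a.2.
  exact: edge_exists md.
have [f hf] := choice ex; exists (fun k x => f (k, x)) => k x; exact: (hf (k, x)).
Qed.

Section Family.
Variables (off e : nat).
Hypotheses (e_gt0 : (0 < e)%N) (me : ~~ (m %| e.*2)%N) (en : (e.*2.*2 < n)%N).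
Hypothesis degenerate_or : (m = e.*2.*2 /\ ~~ odd n) \/
  (~~ (m %| e.*2.*2)%N /\ e.*2.*2.*2 != n).
Variable Ed : nat -> int -> 'rV[R]_2.
Hypothesis EdP : forall k x, sedge (cyclic_idx k) (Ed k x) /\ cyclic_level k (Ed k x) = x.

(** The directions of the family: an arithmetic progression of step [e]. *)
Definition idx k := (off + e * k)%N.
(** The sum of the levels [k] and [k + 2 * d] at a chosen edge in the direction between
    them, as a function of the level [x] of this edge. *)
Definition rung k d x := cyclic_level k (Ed (k + d) x) + cyclic_level (k + d.*2) (Ed (k + d) x).
Definition family_sum b x := rung (idx b.-1) e x.
Definition family_wide_sum b x := if (m %| e.*2.*2)%N then 0 else rung (idx b.-2) e.*2 x.
Definition family_level k p := cyclic_level (idx k) (sval p).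

Lemma idxS k : idx k.+1 = (idx k + e)%N.
Proof. by rewrite /idx mulnS; lia. Qed.
Lemma idx2 k : idx k.+2 = (idx k + e.*2)%N.
Proof. by rewrite !idxS; lia. Qed.
Lemma idx4 k : idx k.+4 = (idx k + e.*2.*2)%N.
Proof. by rewrite !idxS; lia. Qed.

Lemma en2 : (e.*2 < n)%N.
Proof. by apply: leq_ltn_trans en; rewrite -[X in (_ <= X)%N]addnn leq_addr. Qed.

Lemma Ed_vertex k x : vertex v T (Ed k x).
Proof. exact: (sedge_vertex (EdP k x).1).1. Qed.

Lemma rung_close k d X : (0 < d)%N -> ~~ (m %| d.*2)%N -> (d.*2 < n)%N ->
  sedge (cyclic_idx (k + d)) X ->
  `|cyclic_level k X + cyclic_level (k + d.*2) X - rung k d (cyclic_level (k + d) X)| <= 1.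
Proof.
move=> d0 md dn hX; have [h1 h2] := EdP (k + d) (cyclic_level (k + d) X).
exact: edge_sum_close.
Qed.

(** Here the directions at distance [4 * e] are opposite. *)
Lemma degenerate_sum k p : (m %| e.*2.*2)%N -> family_level k p + family_level k.+4 p = 0.
Proof.
move=> h; case: degenerate_or => [[em on]|[]]; last by rewrite h.
rewrite /family_level idx4 -em cyclic_level_period; last exact: svalP.
by rewrite (negPf on) subrr.
Qed.

Lemma nondegenerate : ~~ (m %| e.*2.*2)%N -> e.*2.*2.*2 != n.
Proof. by move=> h; case: degenerate_or => [[em _]|[]//]; rewrite em dvdnn in h. Qed.

Lemma th_close k X : sedge (cyclic_idx (idx k.+2)) X -> forall p, sval p = X ->
  `|family_level k p + family_level k.+4 p - family_wide_sum k.+2 (family_level k.+2 p)| <= 3.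
Proof.
move=> hX p pX; rewrite /family_wide_sum; case: ifP => h.
  by rewrite degenerate_sum// subrr normr0.
move: hX; rewrite /family_level pX idx4 idx2 /= => hX.
have := @rung_close (idx k) e.*2 X _ _ _ hX.
rewrite double_gt0 h => /(_ e_gt0 isT en) h1; apply: le_trans h1 _; lia.
Qed.

Lemma tiling_web_corner k x u : exists p, [/\ family_level k.+1 p = x, family_level k.+2 p = u,
  `|family_level k.+1 p + family_level k.+3 p - family_sum k.+2 u| <= 3,
  `|family_level k p + family_level k.+2 p - family_sum k.+1 x| <= 3
  & `|family_level k p + family_level k.+4 p - family_wide_sum k.+2 u| <= 3].
Proof.
have [h1 h2] := EdP (idx k.+2) u.
have sw := swings (idx k.+1) me.
have [a1 _] := step_area e_gt0 me en2 (idx k.+1).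
rewrite -idxS in sw a1.
have [Q [sf eQ1 eQ2]] := swing_corner hv eps_neq0 hT hL x sw (lt0r_neq0 a1) h1.
rewrite -!/(cyclic_level _ _) h2 in eQ1 eQ2.
have hQ1 : sedge (cyclic_idx (idx k.+1)) Q := (sface_edge sf).1.
have hQ2 : sedge (cyclic_idx (idx k.+2)) Q := (sface_edge (sface_sym sf)).1.
exists (exist _ Q (sedge_vertex hQ1).1 : tiling_vertex).
split=> //.
- rewrite /family_sum /= /family_level /= -eQ2 [idx k.+3]idx2 [in cyclic_level (idx k.+2)]idxS.
  have h := hQ2; rewrite idxS in h.
  by apply: le_trans (rung_close e_gt0 me en2 h) _; lia.
- rewrite /family_sum /= /family_level /= -eQ1 idx2 idxS.
  have h := hQ1; rewrite idxS in h.
  by apply: le_trans (rung_close e_gt0 me en2 h) _; lia.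
by rewrite -[in family_wide_sum _ _]eQ2; apply: (th_close hQ2).
Qed.

Lemma tiling_web_stair k p u :
  (family_level k.+1 p <= u -> family_level k p + family_level k.+2 p <= family_sum k.+1 u + 3) /\
  (u < family_level k.+1 p -> family_sum k.+1 u - 3 <= family_level k p + family_level k.+2 p).
Proof.
have [h1 h2] := EdP (idx k + e) u.
have [s1 s2] := stair_acute e_gt0 me en2 en (svalP p) h1.
rewrite /family_sum /rung /family_level idx2 idxS /=; split=> hu.
  have := s1; rewrite h2 => /(_ hu); lia.
have := s2; rewrite h2 => /(_ hu); lia.
Qed.

Lemma tiling_web_unbounded k (B : int) : (exists p, B <= family_level k p + family_level k.+2 p) /\
  (exists p, family_level k p + family_level k.+2 p <= B).
Proof.
have [[X0 vX0 _] _] := hL; pose p0 : tiling_vertex := exist _ X0 vX0.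
suff [c [c0 shift]] : exists c : int, 0 < c /\ forall a : int, exists p,
    family_level k p + family_level k.+2 p = family_level k p0 + family_level k.+2 p0 + c * a.
  pose s0 := family_level k p0 + family_level k.+2 p0.
  have [p hp] := shift (`|B| + `|s0|); have [p' hp'] := shift (- (`|B| + `|s0|)).
  split; [exists p; rewrite hp|exists p'; rewrite hp']; rewrite -/s0; nia.
have [h|h] := boolP (m %| e.*2.*2)%N; last first.
  have [mv _] := swings (idx k) h.
  exists 1; split=> // a; have [X [vX e1 e2 _]] := mv X0 a vX0.
  exists (exist _ X vX); rewrite /family_level idx2 /=; move: e1 e2;
    rewrite -!/(cyclic_level _ _) => -> ->; lia.
case: degenerate_or => [[em on]|[]]; last by rewrite h.
have [mv _] := swings (idx k.+2) me.
exists 2; split=> // a; have [X [vX e1 _ e3]] := mv X0 a vX0.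
exists (exist _ X vX); have := degenerate_sum k p0 h.
have := degenerate_sum k (exist _ X vX) h; rewrite /family_level (idx2 k.+2) /=.
by move: e1 e3; rewrite -!/(cyclic_level _ _) => -> ->; lia.
Qed.

(** There are only [m] directions up to sign. *)
Lemma tiling_web_closed : exists N, forall p, exists2 a, (a < N)%N &
  forall k, `|family_level k p| <= `|family_level a.+2 p|.
Proof.
have m0 := m_gt0 n_gt4; exists m => p.
have [a _ hmax] := @arg_maxP _ int _ (Ordinal m0) xpredT (fun a => `|family_level a.+2 p|) isT.
exists a => // k; pose b := ((k + (m * 2 - 2)) %% m)%N.
have bm : (b < m)%N by rewrite ltn_mod.
apply: le_trans (_ : `|family_level b.+2 p| <= _); last exact: (hmax (Ordinal bm)).
have vp : vertex v T (sval p) := svalP p.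
rewrite /family_level cyclic_level_mod// [X in _ <= X]cyclic_level_mod// (_ : (idx b.+2 %% m =
  idx k %% m)%N)//.
rewrite /idx; apply/eqP; rewrite eqn_modDl -modnMmr -[X in _ == X]modnMmr.
rewrite -addn2 /b modnDml -addnA subnK; last by have := m0; lia.
have e1 : ((k + m * 2) %% m = k %% m)%N by rewrite addnC mulnC modnMDl.
by rewrite e1.
Qed.

(** The outer directions of a wide triple are [4 * e] steps apart; whether this is less or
    more than a half-turn decides which case of the last clause of [web] holds. *)
Theorem tiling_web : web 3 family_level family_sum family_wide_sum.
Proof.
split; [exact: tiling_web_corner|exact: tiling_web_stair|exact: tiling_web_unbounded|].
have [h|h] := boolP (m %| e.*2.*2)%N.
  by left=> k u u' _; rewrite /family_wide_sum h; lia.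
have e2_gt0 : (0 < e.*2)%N by rewrite double_gt0.
have [lt|ge] := ltnP n e.*2.*2.*2; [left=> k u u' huu|right; split].
- have [_ h2] := EdP (idx k + e.*2) u; have [h3 h4] := EdP (idx k + e.*2) u'.
  rewrite /family_wide_sum (negPf h) /rung /=.
  have := stair_obtuse e2_gt0 h en lt (Ed_vertex (idx k + e.*2) u) h3.
  by rewrite h4 h2 => /(_ huu); lia.
- move=> k p u; have [h1 h2] := EdP (idx k + e.*2) u.
  have lt : (e.*2.*2.*2 < n)%N by rewrite ltn_neqAle (nondegenerate h).
  have [s1 s2] := stair_acute e2_gt0 h en lt (svalP p) h1.
  rewrite /family_wide_sum (negPf h) /rung /family_level idx2 idx4 /=; split=> hu.
    by have := s1; rewrite h2 => /(_ hu); lia.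
  by have := s2; rewrite h2 => /(_ hu); lia.
exact: tiling_web_closed.
Qed.
End Family.
End TilingWeb.

(** * Planes through approximate affine relations *)

Section Planes.
Variables (R : realType) (m : nat) (v : 'I_m -> 'rV[R]_2).

(** If all coordinates of the lifted vertices are within [B] of affine functions of two of
    them, the graph of these functions, lowered by [B], is a slope. A face adds at most 1
    to each coordinate of its lower corner. *)
Lemma planar_of_coordinates (T : set (@tile R m)) L (i0 i1 : 'I_m) (B : R) :
  rhombus_tiling v T -> is_lift v T L -> i0 != i1 -> 0 <= B ->
  (forall l, exists p q d : R, forall X, vertex v T X ->
    `|L X 0 l - (p * L X 0 i0 + q * L X 0 i1 + d)| <= B) ->
  exists E, lifts_into v T E (2 * B + 1).
Proof.
move=> [T_lt _ _ _] hL i01 B0 forms.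
have ex l : exists pqd : R * R * R, let: (p, q, d) := pqd in
    [/\ l = i0 -> p = 1 /\ q = 0, l = i1 -> p = 0 /\ q = 1 &
    forall X, vertex v T X -> `|L X 0 l - (p * L X 0 i0 + q * L X 0 i1 + d)| <= B].
  have [->|l0] := eqVneq l i0.
    exists (1, 0, 0); split=> //; first by move=> e; move: i01; rewrite e eqxx.
    by move=> X _; rewrite mul1r mul0r !addr0 subrr normr0.
  have [->|l1] := eqVneq l i1.
    exists (0, 1, 0); split=> //; first by move=> e; move: i01; rewrite e eqxx.
    by move=> X _; rewrite mul1r mul0r add0r addr0 subrr normr0.
  have [p [q [d h]]] := forms l; exists (p, q, d); split=> //.
    by move=> e; rewrite e eqxx in l0.
  by move=> e; rewrite e eqxx in l1.
have [f hf] := choice ex.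
have [P [Q [D fP]]] : exists P Q D : 'rV[R]_m, forall l,
    [/\ l = i0 -> P 0 l = 1 /\ Q 0 l = 0, l = i1 -> P 0 l = 0 /\ Q 0 l = 1 &
    forall X, vertex v T X ->
      `|L X 0 l - (P 0 l * L X 0 i0 + Q 0 l * L X 0 i1 + D 0 l)| <= B].
  exists (\row_l (f l).1.1), (\row_l (f l).1.2), (\row_l (f l).2) => l.
  by have := hf l; rewrite !mxE; case: (f l) => -[p q] d.
have [P0 Q0] : P 0 i0 = 1 /\ Q 0 i0 = 0 by have [h _ _] := fP i0; exact: h.
have [P1 Q1] : P 0 i1 = 0 /\ Q 0 i1 = 1 by have [_ h _] := fP i1; exact: h.
have dim2 : \dim <<[:: P; Q]>> = 2.
  apply/eqP; rewrite -[_ == _]/(free [:: P; Q]) free_cons free_cons span_seq1 span_nil nil_free.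
  rewrite memv0 andbT; apply/andP; split; last first.
    by apply/eqP => /rowP/(_ i1); rewrite Q1 mxE => /eqP; rewrite oner_eq0.
  apply/negP => /vlineP[c /rowP/(_ i0)]; rewrite mxE P0 Q0 mulr0 => /eqP.
  by rewrite oner_eq0.
pose c0 : 'rV[R]_m := D - const_mx B.
exists (AffinePlane c0 dim2), L => // z [x [i [j [Tt [a [b [ha hb ->]]]]]]].
have vx : vertex v T x.
  by exists (x, i, j) => //; exists false, false; rewrite !scale0r !addr0.
pose y := L x 0 i0 *: P + L x 0 i1 *: Q + c0.
exists y, (L x + (a *: e_ i + b *: e_ j) - y); split; last by apply/rowP => l; rewrite !mxE; ring.
  by rewrite /plane_set /= /y addrK; apply/span2P; exists (L x 0 i0), (L x 0 i1).
move=> l; have [_ _ /(_ x vx)] := fP l.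
have -> : (L x + (a *: e_ i + b *: e_ j) - y) 0 l = L x 0 l + (a * (l == i)%:R + b * (l == j)%:R)
    - (P 0 l * L x 0 i0 + Q 0 l * L x 0 i1 + (D 0 l - B)).
  by rewrite /y /c0 /e_ !mxE /=; ring.
have : 0 <= a * (l == i)%:R + b * (l == j)%:R <= 1.
  have lt := T_lt _ _ _ Tt; have [->|li] := eqVneq l i.
    have -> : (i == j) = false by apply/eqP => e; rewrite e ltnn in lt.
    by rewrite mulr1 mulr0 addr0.
  by rewrite mulr0 add0r; case: (l == j); rewrite ?mulr1 ?mulr0 ?lexx ?ler01.
set s := _ + b * _; rewrite ler_norml; lra.
Qed.

(** A linear recursion of order two with slopes at most 2 multiplies errors by at most 4
    at each step. *)
Lemma recursion_near (V : Type) (w : nat -> V -> R) (s d : nat -> R) (C : R) :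
  0 <= C -> (forall k, `|s k| <= 2) ->
  (forall k X, `|w k X + w k.+2 X - s k * w k.+1 X - d k| <= C) ->
  forall k, exists p q r : R, forall X, `|w k X - (p * w 0%N X + q * w 1%N X + r)| <= C * 4 ^+ k.
Proof.
move=> C0 hs hw k.
suff [] : (exists p q r : R, forall X, `|w k X - (p * w 0%N X + q * w 1%N X + r)| <= C * 4 ^+ k) /\
   exists p q r : R, forall X, `|w k.+1 X - (p * w 0%N X + q * w 1%N X + r)| <= C * 4 ^+ k.+1 by [].
elim: k => [|k [[p [q [r h]]] [p' [q' [r' h']]]]].
  split; [exists 1, 0, 0|exists 0, 1, 0] => X.
    by rewrite mul1r mul0r !addr0 subrr normr0 mulr_ge0// exprn_ge0.
  by rewrite mul1r mul0r add0r addr0 subrr normr0 mulr_ge0// exprn_ge0.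
split; first by exists p', q', r'.
exists (s k * p' - p), (s k * q' - q), (s k * r' - r + d k) => X.
have := hw k X; have := h X; have := h' X; rewrite !exprS.
set e0 := w k X - _; set e1 := w k.+1 X - _; set e2 := _ - d k => h1 h0 h2.
have -> : w k.+2 X - ((s k * p' - p) * w 0%N X + (s k * q' - q) * w 1%N X + (s k * r' - r + d k))
    = e2 + s k * e1 - e0 by rewrite /e0 /e1 /e2; ring.
have g : 1 <= 4 ^+ k :> R by rewrite exprn_ege1// ler1n.
have hC : C <= C * 4 ^+ k by rewrite ler_peMr.
have : `|s k * e1| <= 2 * (C * (4 * 4 ^+ k)) by rewrite normrM ler_pM.
move: h0 h2; rewrite !ler_norml; set t := C * 4 ^+ k in hC *.
rewrite !(mulrCA C) -/t; lra.
Qed.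

Lemma bounded_multiple_eq0 (a K : R) : (forall x : int, `|a * x%:~R| <= K) -> a = 0.
Proof.
move=> h; apply/eqP; apply: contraT => a0.
have a1 : 0 < `|a| by rewrite normr_gt0.
have := truncnS_gt (K / `|a|); set N := (Num.truncn _).+1; rewrite ltr_pdivrMr// => hN.
have := h N%:Z; rewrite normrM mulrC normr_nat; lra.
Qed.
End Planes.

(** * Planarity from the webs *)

Lemma web_relation (R : realType) (P : Type) (z : nat -> P -> int) sg th (al : nat -> R) (C : R) :
  web 3 z sg th -> 0 < C -> (forall b, 0 <= al b.+1) ->
  (forall b u n, `|(sg b.+1 (u + n))%:~R - (sg b.+1 u)%:~R - al b.+1 * n%:~R| <=
    C * (1 + al b.+1)) ->
  forall k p, `|(z k p)%:~R + (z k.+2 p)%:~R - al k.+1 * (z k.+1 p)%:~R - (sg k.+1 0)%:~R| <=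
    (C + 4) * (1 + al k.+1).
Proof.
move=> [_ stair _ _] C0 al0 aff k p; have a0 := al0 k.
have [s1 _] := stair k p (z k.+1 p); have [_ s2] := stair k p (z k.+1 p - 1).
have := s1 (lexx _); have := s2 ltac:(lia).
rewrite -!(ler_int R) !intrD mulrNz => h2 h1.
have := aff k 0 (z k.+1 p); have := aff k 0 (z k.+1 p - 1).
rewrite !add0r intrD !mulrNz; rewrite !ler_norml.
set t := al k.+1 in a0 *; set x := (z k.+1 p)%:~R.
have -> : t * (x - 1) = t * x - t by ring.
set tx := t * x; have -> : (C + 4) * (1 + t) = C * (1 + t) + 4 + 4 * t by ring.
lra.
Qed.

Section Enforcement.
Variables (R : realType) (n : nat).
Hypothesis n_gt4 : (4 < n)%N.
Local Notation m := (nfold_dim n).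
Hypothesis m_gt3 : (3 < m)%N.
Local Notation det := (area (1 : R)).
Local Notation cyclic_idx := (cyclic_idx n_gt4).
Local Notation root_vecs := (@root_vecs R n).
Variable C : R.
Hypothesis C_gt0 : 0 < C.
(* The conclusion of [web_affine], with one constant for all tilings. *)
Hypothesis webC : forall (P : Type) (z : nat -> P -> int) sg th, web 3 z sg th ->
  exists al : nat -> R,
  [/\ forall b, 0 <= al b.+1, forall b, al b.+3 = al b.+1,
      forall b, al b.+1 * al b.+2 <= 4,
      forall b u k, `|(sg b.+1 (u + k))%:~R - (sg b.+1 u)%:~R - al b.+1 * k%:~R| <=
        C * (1 + al b.+1)
    & forall b u u',
       `|(th b.+2 u + 2 * u - (th b.+2 u' + 2 * u'))%:~R -
         al b.+3 * (sg b.+2 u - sg b.+2 u')%:~R| <= C * (1 + al b.+3)].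

Variables (v : 'I_m -> 'rV[R]_2) (eps : R).
Hypotheses (hv : edge_vectors v) (eps_neq0 : eps != 0).
Local Notation ar := (area eps).
Hypothesis compat : forall i j, i != j -> 0 < ar (v i) (v j) * det (root_vecs i) (root_vecs j).
Variable T : set (@tile R m).
Hypothesis hT : rhombus_tiling v T.
Variable L : 'rV[R]_2 -> 'rV[R]_m.
Hypothesis hL : is_lift v T L.
Hypothesis swings : forall k d, ~~ (m %| d.*2)%N ->
  swing v T L (cyclic_idx k) (cyclic_idx (k + d)) (cyclic_idx (k + d.*2)).
Local Notation P := (tiling_vertex v T).
Implicit Types (p : P) (k b i : nat) (l : 'I_m).

Definition real_level k p : R := (cyclic_level n_gt4 L k (sval p))%:~R.

Lemma real_level_period k p : real_level (k + m) p = sgb R (~~ odd n) * real_level k p.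
Proof.
rewrite /real_level (cyclic_level_period n_gt4 hv eps_neq0 hT hL _ (svalP p)).
by case: (odd n); rewrite /sgb ?mul1r ?mulN1r ?mulrNz.
Qed.

Lemma real_level_coord l p : L (sval p) 0 l = real_level l p.
Proof.
rewrite /real_level /cyclic_level -(levelE hv eps_neq0 hT hL _ (svalP p)).
have -> : cyclic_idx l = (l, false).
  congr (_, _); first by apply: val_inj; rewrite /= modn_small.
  by rewrite divn_small// andbF.
by rewrite /signed_coord /= mul1r.
Qed.

Lemma m_ndvd d : (0 < d < m)%N -> ~~ (m %| d)%N.
Proof. by move=> /andP[d0 dm]; apply/negP => /(dvdn_leq d0); rewrite leqNgt dm. Qed.

Definition relation_error := C + 4.
(** An error bound for all coordinates, reached by at most [2 * m + 2] steps of the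
    recursion. *)
Definition bound := 3 * relation_error * 4 ^+ (m.*2 + 2).

Lemma relation_error_gt0 : 0 < relation_error. Proof. by rewrite /relation_error; move: C_gt0;
  lra. Qed.

Lemma bound_ge k (a : R) : (k <= m.*2 + 2)%N -> a <= 3 * relation_error * 4 ^+ k -> a <= bound.
Proof.
move=> hk h; apply: le_trans h _; rewrite /bound ler_pM2l; last by have := relation_error_gt0; lra.
by rewrite ler_weXn2l// ler1n.
Qed.

Lemma edge_function : exists Ed : nat -> int -> 'rV[R]_2,
  forall k x, sedge v T (cyclic_idx k) (Ed k x) /\ cyclic_level n_gt4 L k (Ed k x) = x.
Proof.
apply: (edge_choice (n_gt4 := n_gt4) hv eps_neq0 hT hL swings).
by exists 1%N; apply: m_ndvd; rewrite (ltn_trans _ m_gt3).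
Qed.

Variable Ed : nat -> int -> 'rV[R]_2.
Hypothesis EdP : forall k x, sedge v T (cyclic_idx k) (Ed k x) /\ cyclic_level n_gt4 L k (Ed k x)
  = x.
Local Notation rung := (rung n_gt4 L Ed).

Lemma near_planar (i0 i1 : 'I_m) : i0 != i1 ->
  (forall l, exists p q d : R, forall X, `|real_level l X - (p * real_level i0 X + q * real_level
    i1 X + d)| <= bound) ->
  exists E, lifts_into v T E (2 * bound + 1).
Proof.
move=> i01 h; apply: (planar_of_coordinates hT hL i01).
  by rewrite /bound mulr_ge0// ?exprn_ge0// mulr_ge0// ltW// relation_error_gt0.
move=> l; have [p [q [d hl]]] := h l; exists p, q, d => X vX.
by have := hl (exist _ X vX); rewrite -!real_level_coord.
Qed.

Lemma e1_conditions : [/\ ~~ (m %| 1.*2)%N, (1.*2.*2 < n)%N &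
  (m = 1.*2.*2 /\ ~~ odd n) \/ (~~ (m %| 1.*2.*2)%N /\ 1.*2.*2.*2 != n)].
Proof.
split; [by apply: m_ndvd; rewrite (ltn_trans _ m_gt3)|by []|].
have [e|ne] := eqVneq m 4.
  by left; split; rewrite ?e//; apply/negP => o; case: (nfold_dim_cases n) => -[ho he];
    [move: o; rewrite -he e|rewrite o in ho].
right; split; first by apply: m_ndvd; rewrite /= ltn_neqAle eq_sym ne.
apply/eqP => e; case: (nfold_dim_cases n) => -[ho he]; first by rewrite -e in ho.
by move: ne; rewrite -(eqn_pmul2r (isT : 0 < 2)%N) !muln2 he -e.
Qed.

(** The web of step 1. The last clause gives the slope of the sums of levels at distance
    two from the middle one, without control of the error. *)
Lemma base_slopes : exists (al : nat -> R) (c : nat -> R),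
  [/\ forall b, 0 <= al b.+1, forall b, al b.+3 = al b.+1, forall b, al b.+1 * al b.+2 <= 4,
   forall k p, `|real_level k p + real_level k.+2 p - al k.+1 * real_level k.+1 p - c k.+1| <=
     relation_error * (1 + al k.+1)
   & ~~ (m %| 4)%N -> forall k, exists K : R, forall u : int,
    `|(rung k 2 u)%:~R - (rung k 2 0)%:~R - (al k.+2 * al k.+3 - 2) * u%:~R| <= K].
Proof.
have [h1 h2 h3] := e1_conditions.
have W := tiling_web hv eps_neq0 compat hT hL swings 0 (isT : 0 < 1)%N h1 h2 h3 EdP.
have [al [al0 alt pr aff th]] := webC W.
exists al, (fun k => (family_sum n_gt4 L 0 1 Ed k 0)%:~R); split=> //.
  move=> k p; have := web_relation W C_gt0 al0 aff k p.
  by rewrite /family_level /idx !add0n !mul1n.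
move=> m4 k; pose A := al k.+2; pose B := al k.+3.
exists (C * (1 + B) + B * (C * (1 + A))) => u.
have := th k u 0; have := aff k.+1 0 u.
rewrite add0r /family_wide_sum (negPf m4) /= /idx add0n mul1n -/A -/B.
set s1 := family_sum _ _ _ _ _ _ u; set s0 := family_sum _ _ _ _ _ _ 0.
set r1 := rung _ _ u; set r0 := rung _ _ 0.
move: s1 s0 r1 r0 (al0 k.+2 : 0 <= B) => s1 s0 r1 r0 B0.
rewrite !(intrD, intrM, mulrNz) mulr0 addr0 => hs ht.
have hB : `|B * (s1%:~R - s0%:~R - A * u%:~R)| <= B * (C * (1 + A)).
  by rewrite normrM (ger0_norm B0) ler_wpM2l.
rewrite (_ : _ - _ - _ = r1%:~R + 2 * u%:~R - r0%:~R - B * (s1%:~R - s0%:~R) +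
  B * (s1%:~R - s0%:~R - A * u%:~R)); last by ring.
by apply: le_trans (ler_normD _ _) _; apply: lerD.
Qed.

Lemma bounded_slopes_planar al c : (forall b, 0 <= al b.+1 <= 2) ->
  (forall k p, `|real_level k p + real_level k.+2 p - al k.+1 * real_level k.+1 p - c k.+1| <=
    relation_error * (1 + al k.+1)) ->
  exists E, lifts_into v T E (2 * bound + 1).
Proof.
move=> hal rel; have m1 : (1 < m)%N by exact: ltn_trans m_gt3.
apply: (@near_planar (Ordinal (m_gt0 n_gt4)) (Ordinal m1)) => // l /=.
have E0 := relation_error_gt0.
have [|||p [q [r h]]] := @recursion_near R P real_level (fun k => al k.+1) (fun k => c k.+1) (3 *
  relation_error) _ _ _ l.
- lra.
- by move=> k; have := hal k; rewrite ler_norml; lra.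
- move=> k X; apply: le_trans (rel k X) _; rewrite mulrC ler_pM2r//; have := hal k; lra.
exists p, q, r => X; apply: (@bound_ge l); last exact: h.
by apply: leq_trans (ltnW (ltn_ord l)) _; rewrite -addnn -addnA leq_addr.
Qed.

Section Slopes.
Variables (al c : nat -> R).
Hypotheses (al0 : forall b, 0 <= al b.+1) (alt : forall b, al b.+3 = al b.+1).
Hypothesis (pr : forall b, al b.+1 * al b.+2 <= 4).
Hypothesis rel : forall k p,
  `|real_level k p + real_level k.+2 p - al k.+1 * real_level k.+1 p - c k.+1| <= relation_error
    * (1 + al k.+1).

Lemma slope_parity b i : al (b + 2 * i).+1 = al b.+1.
Proof.
by elim: i => [|i IH]; [rewrite muln0 addn0|rewrite mulnS addnCA -[RHS]IH; exact: alt].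
Qed.

Lemma slope_cases b : al b.+1 = al 1 \/ al b.+1 = al 2.
Proof.
rewrite -(odd_double_half b) -mul2n; case: (odd b); first by right; exact: slope_parity 1 _.
by left; exact: (slope_parity 0).
Qed.

(** If [m] is odd, then the directions [b] and [b + m], which agree up to sign, belong to
    different classes of the alternating slopes; hence both slopes agree, and their
    product is at most 4. *)
Lemma odd_slopes : odd m -> forall b, 0 <= al b.+1 <= 2.
Proof.
move=> om.
have am : al m.+1 = al 2.
  by rewrite -[m in al m.+1]odd_double_half om -mul2n; exact: slope_parity 1 _.
have sq : al 1 = al 2.
  apply/eqP; rewrite -subr_eq0; apply/eqP.
  pose K := relation_error * (1 + al 1) + relation_error * (1 + al 2) + `|c 1%N| + `|c m.+1|.
  apply: (@bounded_multiple_eq0 R _ K) => x.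
  have [hZ eZ] := EdP 1 x.
  pose p : P := exist _ (Ed 1 x) (sedge_vertex hZ).1.
  have z1 : real_level 1 p = x%:~R by rewrite /real_level /= eZ.
  have := rel 0%N p; have := rel m p.
  rewrite am (real_level_period 0 p : real_level m p = _) (real_level_period 1 p : real_level
    m.+1 p = _).
  rewrite (real_level_period 2 p : real_level m.+2 p = _) z1 /K => h2 h1.
  have := ler_norm (c 1%N); have := ler_norm (- c 1%N); rewrite normrN.
  have := ler_norm (c m.+1); have := ler_norm (- c m.+1); rewrite normrN.
  rewrite mulrBl; move: h1 h2; rewrite !ler_norml.
  set a1 := al 1 * _; set e1 := relation_error * (1 + al 1); set e2 := relation_error * (1 + al 2).
  rewrite (mulrCA (al 2)); set a2 := al 2 * _; move: a1 a2 e1 e2 => a1 a2 e1 e2.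
  by case: (~~ odd n); rewrite /sgb ?mul1r ?mulN1r; lra.
have le2 : al 1 <= 2 by have := pr 0; have := al0 0; rewrite -sq; nra.
by move=> b; case: (slope_cases b) => ->; rewrite -?sq le2 al0.
Qed.

Hypothesis wide_slope : ~~ (m %| 4)%N -> forall k, exists K : R, forall u : int,
  `|(rung k 2 u)%:~R - (rung k 2 0)%:~R - (al k.+2 * al k.+3 - 2) * u%:~R| <= K.

(** If [m] is even, the web of step 2 on the directions of one parity has slopes equal to
    the product of the alternating slopes minus 2, because both describe the same sums;
    they are thus at most 2. For [m = 4] these sums vanish. *)
Lemma double_step_slopes b0 : ~~ odd m -> exists s d : nat -> R,
  (forall i, `|s i| <= 2) /\ forall i p,
  `|real_level (b0 + 2 * i) p + real_level (b0 + 2 * i.+2) p - s i * real_level (b0 + 2 * i.+1) p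
    - d i| <= 3 * relation_error.
Proof.
move=> em; have E0 := relation_error_gt0.
have [nodd nE] : ~~ odd n /\ m.*2 = n.
  by case: (nfold_dim_cases n) => -[ho he] //; rewrite he ho in em.
have [m4|m4] := eqVneq m 4.
  exists (fun=> 0), (fun=> 0); split=> [i|i p]; first by rewrite normr0.
  have -> : (b0 + 2 * i.+2 = b0 + 2 * i + m)%N by rewrite m4; lia.
  by rewrite real_level_period nodd /sgb mulN1r subrr mul0r !subr0 normr0; lra.
have m6 : (5 < m)%N by move: m_gt3 em m4; case: (nfold_dim n) => [|[|[|[|[|[|k]]]]]].
have h1 : ~~ (m %| 2.*2)%N by apply: m_ndvd; exact: ltnW m6.
have h2 : (2.*2.*2 < n)%N by rewrite -nE; lia.
have h3 : (m = 2.*2.*2 /\ ~~ odd n) \/ (~~ (m %| 2.*2.*2)%N /\ 2.*2.*2.*2 != n).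
  have [m8|m8] := eqVneq m 8; first by left.
  right; split; last by rewrite -nE; apply/eqP => e; move/eqP: m8; apply; lia.
  apply/negP => d8; have : (m <= 8)%N by exact: dvdn_leq d8.
  move: m6 m8 d8 em.
  by case: (nfold_dim n) => [|[|[|[|[|[|[|[|[|k]]]]]]]]].
have W := tiling_web hv eps_neq0 compat hT hL swings b0 (isT : 0 < 2)%N h1 h2 h3 EdP.
have [al2 [al20 alt2 pr2 aff2 _]] := webC W.
have slopeE i : al2 i.+1 = al (b0 + 2 * i).+2 * al (b0 + 2 * i).+3 - 2.
  have := wide_slope h1 (b0 + 2 * i); set g := al _ * al _ - 2; move: g => g [K hK].
  apply/eqP; rewrite -subr_eq0; apply/eqP.
  apply: (@bounded_multiple_eq0 R _ (C * (1 + al2 i.+1) + K)) => u.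
  have := aff2 i 0 u; have := hK u; rewrite add0r /family_sum /= -/(idx b0 2 i).
  set r1 := rung _ _ u; set r0 := rung _ _ 0; move: r1 r0 => r1 r0.
  rewrite mulrBl; set a := al2 i.+1 * _; set b := g * _.
  set e := C * (1 + _); move: a b e => a b e.
  by rewrite !ler_norml; lra.
have s2 i : 0 <= al2 i.+1 <= 2.
  by rewrite al20 slopeE; have := pr (b0 + 2 * i).+1; lra.
exists (fun i => al2 i.+1), (fun i => (family_sum n_gt4 L b0 2 Ed i.+1 0)%:~R); split.
  by move=> i; have := s2 i; rewrite ler_norml; lra.
move=> i p; have := web_relation W C_gt0 al20 aff2 i p.
move/le_trans; apply; rewrite mulrC -/relation_error ler_pM2r//; have := s2 i; lra.
Qed.

(** The relations of step 1 for the steep parity have errors that are not uniformly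
    bounded. The coordinates of the parity of [b0] are therefore obtained from
      [double_step_slopes], and the relation
    of step 1 divided by the large slope gives those in between. *)
Lemma steep_planar b0 : ~~ odd m -> (b0 < 2)%N -> 2 < al b0.+1 ->
  exists E, lifts_into v T E (2 * bound + 1).
Proof.
move=> em b2 steep; have [s [d [hs hd]]] := double_step_slopes b0 em.
have E0 := relation_error_gt0; set A := al b0.+1 in steep.
have i0P : (b0 < m)%N by apply: leq_trans b2 _; exact: ltnW (ltnW m_gt3).
have i1P : (b0 + 2 < m)%N by apply: leq_trans m_gt3; rewrite addn2 !ltnS.
apply: (@near_planar (Ordinal i0P) (Ordinal i1P)).
  by rewrite -val_eqE /= -[X in X != _]addn0 eqn_add2l.
have near i : exists p q r : R, forall X,
    `|real_level (b0 + 2 * i) X - (p * real_level b0 X + q * real_level (b0 + 2) X + r)| <= 3 *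
      relation_error * 4 ^+ i.
  have := @recursion_near R P (fun i => real_level (b0 + 2 * i)) s d (3 * relation_error) _ hs hd i.
  by rewrite muln0 addn0 muln1; apply; lra.
move=> l /=.
suff [p [q [r h]]] : exists p q r : R, forall X,
    `|real_level (l + m) X - (p * real_level b0 X + q * real_level (b0 + 2) X + r)| <= bound.
  exists (sgb R (~~ odd n) * p), (sgb R (~~ odd n) * q), (sgb R (~~ odd n) * r) => X.
  have := h X; rewrite real_level_period; case: (~~ odd n); rewrite /sgb; last by rewrite !mul1r.
  rewrite !mulN1r => H; suff -> : real_level l X - (- p * real_level b0 X + - q * real_level (b0
    + 2) X + - r) =
    - (- real_level l X - (p * real_level b0 X + q * real_level (b0 + 2) X + r)) by rewrite normrN.
  by ring.
have [i [hi lm]] : exists i, (i <= m.*2)%N /\ ((l + m = b0 + 2 * i)%N \/ (l + m = (b0 + 2 *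
  i).+1)%N).
  exists ((l + m - b0)./2); have := odd_double_half (l + m - b0); have := ltn_ord l.
  by case: (odd _) => /=; lia.
have [p [q [r h]]] := near i; have [p' [q' [r' h']]] := near i.+1.
case: lm => ->.
  by exists p, q, r => X; apply: bound_ge (h X); lia.
pose a := (b0 + 2 * i)%N.
exists ((p + p') / A), ((q + q') / A), ((r + r' - c a.+1) / A) => X.
apply: (@bound_ge i.+1); first lia.
have hX := h X; have hX' := h' X; have := rel a X; rewrite slope_parity -/A.
have -> : a.+2 = (b0 + 2 * i.+1)%N by rewrite /a; lia.
move: hX hX'; rewrite -/a.
set e0 := real_level a X - _; set e1 := real_level (b0 + 2 * _) X - _; set e2 :=
  _ - c a.+1 => h0 h1 h2.
have A0 : A != 0 by apply: lt0r_neq0; lra.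
have -> : real_level a.+1 X - ((p + p') / A * real_level b0 X + (q + q') / A * real_level (b0 +
  2) X +
    (r + r' - c a.+1) / A) = (e0 + e1 - e2) / A.
  by rewrite /e0 /e1 /e2; field.
have Ap : 0 < A by lra.
rewrite normrM normfV (gtr0_norm Ap) ler_pdivrMr//.
have g : 1 <= 4 ^+ i :> R by rewrite exprn_ege1// ler1n.
have hE : relation_error <= relation_error * 4 ^+ i by rewrite ler_peMr// ltW.
have hEA : relation_error * A <= relation_error * 4 ^+ i * A by rewrite ler_pM2r.
have hEA2 : relation_error * 4 ^+ i * 2 <= relation_error * 4 ^+ i * A by rewrite ler_pM2l ?ltW//
  mulr_gt0// exprn_gt0.
have : `|e0 + e1 - e2| <= `|e0| + `|e1| + `|e2|.
  by rewrite -[`|e2|]normrN; apply: le_trans (ler_normD _ _) _; rewrite lerD2r ler_normD.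
move: h0 h1 h2; rewrite exprS; move: (4 ^+ i : R) => t in g hE hEA hEA2 * => h0 h1 h2 h3.
rewrite (_ : 3 * relation_error * (4 * t) * A = 12 * (relation_error * t * A)); last by ring.
move: h1 h2; rewrite (_ : 3 * relation_error * (4 * t) = 12 * (relation_error * t)); last by ring.
rewrite mulrDr mulr1; move: h0; rewrite -mulrA => h0 h1 h2; lra.
Qed.
End Slopes.

Theorem swings_planar : exists E, lifts_into v T E (2 * bound + 1).
Proof.
have [al [c [al0 alt pr rel wide_slope]]] := base_slopes.
have [om|em] := boolP (odd m).
  exact: bounded_slopes_planar (odd_slopes al0 alt pr rel om) rel.
have [h1|h1] := lerP (al 1) 2; last exact: (@steep_planar al c alt pr rel wide_slope 0 em isT h1).
have [h2|h2] := lerP (al 2) 2; last exact: (@steep_planar al c alt pr rel wide_slope 1 em isT h2).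
apply: (bounded_slopes_planar (al := al)) rel => b.
by rewrite al0; case: (slope_cases alt b) => ->.
Qed.
End Enforcement.

(** * Subperiods enforce planarity *)

Lemma fold_large n : (0 < n)%N -> [|| 5 %| n, 7 %| n, 8 %| n | 12 %| n]%N ->
  (4 < n)%N /\ (3 < nfold_dim n)%N.
Proof.
move=> n0 dv; have [n4 n6] : (4 < n)%N /\ n <> 6 by case: n n0 dv => [|[|[|[|[|[|[|]]]]]]].
by split=> //; case: (nfold_dim_cases n) => -[_ e]; lia.
Qed.

Theorem proposition8 (R : realType) (n : nat)
    (v : 'I_(nfold_dim n) -> 'rV[R]_2) :
  (0 < n)%N ->
  [|| 5 %| n, 7 %| n, 8 %| n | 12 %| n]%N ->
  edge_vectors v ->
  (exists T, nfold_tiling v T) ->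
  enforces_planarity v (nfold_subperiods v).
Proof.
move=> n0 dv hv [T0 nT0]; have [n4 m3] := fold_large n0 dv.
have [eps eps0 compat] := nfold_orientation n4 hv nT0.
have [C C0 webC] := @web_affine R 3 isT.
exists (2 * bound n C + 1) => T hT [L hL per].
have swings := nfold_swing n4 hv eps0 nT0 hT hL per.
have [Ed EdP] := edge_function m3 hv eps0 hT hL swings.
have [E hE] := swings_planar m3 C0 webC hv eps0 compat hT hL swings EdP.
have t1 : 1 <= 2 * bound n C + 1.
  by rewrite lerDr /bound !mulr_ge0// ?exprn_ge0// ltW// relation_error_gt0.
split; first by exists (2 * bound n C + 1), E.
exact: (thickness_le t1 hE).
Qed.
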